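(* Let $\Omega\subset\mathbb{R}^N$ be an open set and assume that $\Omega$ satisfies the interior sphere condition at $x_0\in\partial\Omega$. If $v\in C(\mathbb{R}^N)\cap\mathcal{V}(\Omega)$ is a nontrivial nonnegative function such that $v(x_0)=0$ and $$\mathcal{E}_L(v,\varphi)\ge0\qquad\text{for all }\varphi\in C_c^\infty(\Omega)\text{ with }\varphi\ge0\text{ in }\Omega,$$ then $$\liminf_{t\to0^+}\frac{v(x_0-t\eta(x_0))}{\ell^{\frac12}(t)}>0,$$ where $\eta(x_0)$ is an outer unit normal vector to $\partial\Omega$ at $x_0$.
   Context: Notation: $N\ge1$; $B_r(x)$ is the open ball of radius $r$ centered at $x$, $S_r(x)=\partial B_r(x)$. $\ell:[0,\infty)\to[0,\infty)$ is $\ell(r)=\frac{1}{|\ln(\min\{r,0.1\})|}$ (with $\ell(0)=0$), and $\ell^{\frac12}(r)=(\ell(r))^{1/2}$. Interior sphere condition at $x_0\in\partial\Omega$: there are $\delta>0$ and $y_0\in\mathbb{R}^N$ with $B_\delta(y_0)\subset\Omega$ and $S_\delta(y_0)\cap\partial\Omega=\{x_0\}$. The outer unit normal at $x_0$ is $\eta(x_0)=(x_0-y_0)/\delta$ for such a ball. $\mathcal{V}(\Omega)$ is the set of $u\in L^1_{loc}(\mathbb{R}^N)$ with $\int_{\mathbb{R}^N}\frac{|u(x)|}{(1+|x|)^N}dx+\iint_{x,y\in\Omega,\,|x-y|<1}\frac{|u(x)-u(y)|^2}{|x-y|^N}dx\,dy+\int_\Omega u^2dx<\infty$. Constants: $c_N=\pi^{-N/2}\Gamma(N/2)$,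 $\rho_N=2\ln2+\Psi(N/2)-\gamma$, with $\Psi=\Gamma'/\Gamma$ and $\gamma=-\Gamma'(1)$. Bilinear form (of the logarithmic Laplacian): $\mathcal{E}_L(u,v)=\frac{c_N}{2}\int_{\mathbb{R}^N}\int_{B_1(x)}\frac{(u(x)-u(y))(v(x)-v(y))}{|x-y|^N}dy\,dx-c_N\iint_{|x-y|\ge1}\frac{u(x)v(y)}{|x-y|^N}dx\,dy+\rho_N\int_{\mathbb{R}^N}uv\,dx$; it is finite for $u\in\mathcal{V}(\Omega)$ and $v\in C_c^\infty(\Omega)$. *)

(* Defs.v *)
From HB Require Import structures.
From mathcomp Require Import all_boot all_order all_algebra.
From mathcomp Require Import all_classical all_reals all_analysis.

Set Implicit Arguments.
Unset Strict Implicit.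
Unset Printing Implicit Defensive.
Import Order.TTheory GRing.Theory Num.Theory.
Import numFieldNormedType.Exports.

Local Open Scope classical_set_scope.
Local Open Scope ring_scope.

(* Points of R^N are row vectors 'rV[R]_N. Their library topology (the product
   topology) is the usual one, but the library norm `|x| is the sup norm, so
   Euclidean lengths, balls and spheres are introduced separately. *)
Section Euclidean.
Context {R : realType} {N : nat}.
Implicit Types (x y : 'rV[R]_N) (r : R) (A : set 'rV[R]_N).

Definition enorm x : R := Num.sqrt (\sum_(i < N) x 0 i ^+ 2).
Definition eball x r : set 'rV[R]_N := [set y | enorm (y - x) < r].
Definition esphere x r : set 'rV[R]_N := [set y | enorm (y - x) = r].
Definition boundary A : set 'rV[R]_N := closure A `\` interior A.

End Euclidean.

(* Lebesgue measure on R^N. The sigma-algebra is the one generated by the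
   coordinates, i.e. the Borel sigma-algebra (see [open_measurable_rV]). *)
Definition rV_display : measure_display.
Proof. exact: default_measure_display. Qed.

Section MeasurableRow.
Context (R : realType) (n : nat).

Let coord : 'I_n -> 'rV[R]_n -> measurableTypeR R := fun i x => x 0 i.

Let rV_set0 : g_sigma_preimage coord set0.
Proof. exact: sigma_algebra0. Qed.

Let rV_setC A : g_sigma_preimage coord A -> g_sigma_preimage coord (~` A).
Proof. exact: sigma_algebraC. Qed.

Let rV_bigcup (F : (set 'rV[R]_n)^nat) :
  (forall i, g_sigma_preimage coord (F i)) ->
  g_sigma_preimage coord (\bigcup_i (F i)).
Proof. exact: sigma_algebra_bigcup. Qed.

HB.instance Definition _ := @isMeasurable.Build rV_display
  'rV[R]_n (g_sigma_preimage coord) rV_set0 rV_setC rV_bigcup.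

End MeasurableRow.

Section LebesgueRow.
Context {R : realType}.

Lemma measurable_coord n (i : 'I_n) :
  measurable_fun setT (fun x : 'rV[R]_n => x 0 i : measurableTypeR R).
Proof.
move=> _ Y mY; rewrite setTI; apply: sub_sigma_algebra => /=.
rewrite -bigcup_seq/=; exists i => /=; first by rewrite mem_index_enum.
by exists Y => //; rewrite setTI.
Qed.

Lemma measurable_fun_coordP d (T : measurableType d) n (f : T -> 'rV[R]_n) :
  (forall i, measurable_fun setT (fun t => f t 0 i : measurableTypeR R)) ->
  measurable_fun setT f.
Proof.
move=> mf; apply: (@measurability _ _ _ _ _ f
  (\big[setU/set0]_(i < n) preimage_set_system setT
     (fun x : 'rV[R]_n => x 0 i : measurableTypeR R) measurable)) => //.
move=> _ [Y + <-]; rewrite -bigcup_seq/= => -[i _ [B mB <-]].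
by rewrite !setTI; have := mf i measurableT B mB; rewrite setTI.
Qed.

Definition cons_rV n (p : measurableTypeR R * 'rV[R]_n) : 'rV[R]_n.+1 :=
  row_mx (\row_(i < 1) p.1) p.2.

Lemma cons_rVE n (p : measurableTypeR R * 'rV[R]_n) i :
  cons_rV p 0 i = oapp (p.2 0) p.1 (unlift ord0 i).
Proof.
rewrite /cons_rV; case: unliftP => [j|] -> /=.
  have -> : lift ord0 j = rshift 1 j by apply/val_inj.
  exact: (@row_mxEr _ 1 1 n).
have -> : ord0 = lshift n (@ord0 0) by apply/val_inj.
by apply: etrans (@row_mxEl _ 1 1 n _ _ _ _) _; rewrite mxE.
Qed.

Lemma measurable_cons_rV n : measurable_fun setT (@cons_rV n).
Proof.
apply: measurable_fun_coordP => i; under eq_fun do rewrite cons_rVE.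
case: unlift => [j|] /=; last exact: measurable_fst.
apply: (@measurableT_comp _ _ _ _ _ _ (fun x : 'rV[R]_n => x 0 j : measurableTypeR R)) => //.
exact: measurable_coord.
Qed.

Definition uncons_rV n (x : 'rV[R]_n.+1) : measurableTypeR R * 'rV[R]_n :=
  (x 0 0, \row_j x 0 (lift ord0 j)).

Lemma uncons_rVK n : cancel (@uncons_rV n) (@cons_rV n).
Proof.
move=> x; apply/rowP => i; rewrite cons_rVE.
by case: unliftP => [j|] -> //=; rewrite mxE.
Qed.

Lemma cons_rVK n : cancel (@cons_rV n) (@uncons_rV n).
Proof.
move=> [a w]; congr pair; first by rewrite cons_rVE unlift_none.
by apply/rowP => j; rewrite mxE cons_rVE liftK.
Qed.

Lemma measurable_uncons_rV n : measurable_fun setT (@uncons_rV n).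
Proof.
apply/measurable_fun_pairP; split; first exact: measurable_coord.
apply: measurable_fun_coordP => i /=; under eq_fun do rewrite mxE.
exact: measurable_coord.
Qed.

Section Step.
Context (n : nat) (mu : {sigma_finite_measure set 'rV[R]_n -> \bar R}).

Let prod_mu : {measure set (measurableTypeR R * 'rV[R]_n)%type -> \bar R} :=
  (@lebesgue_measure R \x mu)%E.

Definition lebesgue_rV_step : set 'rV[R]_n.+1 -> \bar R :=
  pushforward prod_mu (@cons_rV n).

Let mcons := @measurable_cons_rV n.

Let step0 : lebesgue_rV_step set0 = 0%E.
Proof. exact: (@measure0 _ _ _ (pushforward prod_mu _)). Qed.

Let step_ge0 A : (0 <= lebesgue_rV_step A)%E.
Proof. exact: (@measure_ge0 _ _ _ (pushforward prod_mu _)). Qed.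

Let step_sigma_additive : semi_sigma_additive lebesgue_rV_step.
Proof. exact: (@measure_semi_sigma_additive _ _ _ (pushforward prod_mu _)). Qed.

HB.instance Definition _ := isMeasure.Build _ _ _ lebesgue_rV_step
  step0 step_ge0 step_sigma_additive.

Let step_sigma_finite : sigma_finite setT lebesgue_rV_step.
Proof.
have /sigma_finiteP[F [TF ndF Foo]] := sigma_finiteT (@lebesgue_measure R).
have /sigma_finiteP[G [TG ndG Goo]] := sigma_finiteT mu.
exists (fun k => @uncons_rV n @^-1` (F k `*` G k)) => [|k].
  rewrite -preimage_bigcup predeqE => x; split=> // _ /=.
  have [k _ Fk] : (\bigcup_k F k) (uncons_rV x).1 by rewrite -TF.
  have [l _ Gl] : (\bigcup_k G k) (uncons_rV x).2 by rewrite -TG.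
  exists (maxn k l) => //; split.
    by move: Fk; exact/subsetPset/ndF/leq_maxl.
  by move: Gl; exact/subsetPset/ndG/leq_maxr.
have [mF Fk] := Foo k; have [mG Gk] := Goo k; split.
  rewrite -[X in measurable X]setTI; apply: measurable_uncons_rV => //.
  exact: measurableX.
rewrite /lebesgue_rV_step /pushforward -comp_preimage.
rewrite (_ : _ \o _ = id); last by apply/funext => p /=; rewrite cons_rVK.
by rewrite preimage_id /prod_mu /= product_measure1E// lte_mul_pinfty// ge0_fin_numE.
Qed.

HB.instance Definition _ := Measure_isSigmaFinite.Build _ _ _ lebesgue_rV_step
  step_sigma_finite.

End Step.

Fixpoint lebesgue_rV n : {sigma_finite_measure set 'rV[R]_n -> \bar R} :=
  match n with
  | 0 => \d_(0 : 'rV[R]_0)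
  | m.+1 => lebesgue_rV_step (lebesgue_rV m)
  end.

Lemma lebesgue_rV_box n (A : 'I_n -> set (measurableTypeR R)) :
  (forall i, measurable (A i)) ->
  lebesgue_rV n [set x | forall i, A i (x 0 i)] =
    (\prod_(i < n) lebesgue_measure (A i))%E.
Proof.
elim: n A => [A _|n IHn A mA].
  by rewrite big_ord0 /= diracE mem_set// => -[].
rewrite big_ord_recl -IHn// /= /lebesgue_rV_step /pushforward.
set B := (X in (_ * lebesgue_rV n X)%E).
have mB : measurable B.
  rewrite (_ : B = \bigcap_(i in [set: 'I_n])
      ((fun x : 'rV[R]_n => x 0 i : measurableTypeR R) @^-1` A (lift ord0 i))).
    apply: fin_bigcap_measurable => // i _.
    by rewrite -[X in measurable X]setTI; exact: measurable_coord.
  by rewrite predeqE => x; split=> [Bx i _|Bx i]; exact: Bx.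
rewrite -product_measure1E//; congr (_ _).
rewrite predeqE => -[a w]; split=> /= [H|[Aa Bw] i].
  split=> /= [|i]; first by have := H ord0; rewrite cons_rVE unlift_none.
  by have := H (lift ord0 i); rewrite cons_rVE liftK.
by rewrite cons_rVE; case: unliftP => [j|] -> //=; exact: Bw.
Qed.

Lemma open_measurable_rV n (U : set 'rV[R]_n) : open U -> measurable U.
Proof.
move=> oU.
pose Q (p : 'rV[rat]_n * 'rV[rat]_n) : set 'rV[R]_n :=
  [set x | forall i, ratr (p.1 0 i) < x 0 i < ratr (p.2 0 i)].
have mQ p : measurable (Q p).
  rewrite (_ : Q p = \bigcap_(i in [set: 'I_n])
      ((fun x : 'rV[R]_n => x 0 i : measurableTypeR R) @^-1`
         `]ratr (p.1 0 i), ratr (p.2 0 i)[)).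
    apply: fin_bigcap_measurable => // i _.
    rewrite -[X in measurable X]setTI; exact: measurable_coord.
  rewrite predeqE => x; split=> [Qx i _|Qx i] /=.
    by rewrite in_itv/=; exact: Qx.
  by have := Qx i I; rewrite /= in_itv.
rewrite (_ : U = \bigcup_(p in [set p | Q p `<=` U]) Q p); last first.
  rewrite predeqE => x; split=> [Ux|[p pU Qx]]; last exact: pU.
  have /nbhs_ballP[e /= e0 eU] : nbhs x U by exact: open_nbhs_nbhs.
  have qlt (a b : R) : a < b -> exists q : rat, a < ratr q < b.
    by move=> ab; have [q] := rat_in_itvoo ab; rewrite in_itv/=; exists q.
  have /fin_all_exists[f Hf] : forall i : 'I_n, exists q : rat * rat,
      x 0 i - e < ratr q.1 < x 0 i /\ x 0 i < ratr q.2 < x 0 i + e.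
    move=> i; have [q1 Hq1] : exists q, x 0 i - e < ratr q < x 0 i.
      by apply: qlt; rewrite ltrBlDr ltrDl.
    have [q2 Hq2] : exists q, x 0 i < ratr q < x 0 i + e.
      by apply: qlt; rewrite ltrDl.
    by exists (q1, q2).
  exists (\row_i (f i).1, \row_i (f i).2) => [y Qy|i] /=; last first.
    by rewrite !mxE; have [/andP[_ ->] /andP[-> _]] := Hf i.
  apply: eU; split=> // i j; rewrite /ball /= ord1.
  have [/andP[H1 H2] /andP[H3 H4]] := Hf j.
  have := Qy j; rewrite !mxE /= => /andP[H5 H6].
  by rewrite ltr_distlC (lt_trans H1 H5) (lt_trans H6 H4).
rewrite bigcup_mkcond; apply: countable_bigcupT_measurable => [|p].
  exact: countableP.
by case: ifPn.
Qed.

End LebesgueRow.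

Section Smooth.
Context {R : realType} {N : nat}.
Implicit Types (Omega : set 'rV[R]_N) (phi : 'rV[R]_N -> R).

Definition partial_derive (i : 'I_N) phi : 'rV[R]_N -> R :=
  fun x => 'D_(delta_mx 0 i) phi x.

Definition smooth phi := forall s : seq 'I_N,
  let g := foldr partial_derive phi s in
  continuous g /\ forall (i : 'I_N) x, derivable g x (delta_mx 0 i).

(* C_c^oo(Omega), its elements being extended by 0 to R^N. *)
Definition test_function Omega phi :=
  let supp := closure [set x | phi x != 0] in
  [/\ smooth phi, compact supp & supp `<=` Omega].

End Smooth.

Section SphereCondition.
Context {R : realType} {N : nat}.
Implicit Types (Omega : set 'rV[R]_N) (x y eta : 'rV[R]_N) (delta : R).

Definition interior_sphere Omega x0 y0 delta :=
  [/\ 0 < delta, eball y0 delta `<=` Omega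
    & esphere y0 delta `&` boundary Omega = [set x0]].

Definition interior_sphere_condition Omega x0 :=
  exists y0 delta, interior_sphere Omega x0 y0 delta.

Definition outer_unit_normal Omega x0 eta :=
  exists y0 delta,
    interior_sphere Omega x0 y0 delta /\ eta = delta^-1 *: (x0 - y0).

End SphereCondition.

Section Constants.
Context {R : realType}.
Implicit Types (s r : R) (N : nat).

Definition ell r : R := if r == 0 then 0 else 1 / `|ln (Num.min r 10%:R^-1)|.

Definition Gamma s : R :=
  \int[lebesgue_measure]_(t in `]0, +oo[) (t `^ (s - 1) * expR (- t)).
Definition digamma s : R := derive1 Gamma s / Gamma s.
Definition euler_gamma : R := - derive1 Gamma 1.

Definition c_ N : R := pi `^ (- (N%:R / 2)) * Gamma (N%:R / 2).
Definition rho_ N : R := 2 * ln 2 + digamma (N%:R / 2) - euler_gamma.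

End Constants.

Section LogarithmicLaplacian.
Context {R : realType} {N : nat}.
Implicit Types (Omega : set 'rV[R]_N) (u v : 'rV[R]_N -> R).

Local Notation mu := (@lebesgue_rV R N).

Definition loc_integrable u :=
  measurable_fun setT u /\
  forall K, compact K -> (\int[mu]_(x in K) `|u x|%:E < +oo)%E.

Definition calV Omega u :=
  loc_integrable u /\
  (\int[mu]_x (`|u x| / (1 + enorm x) ^+ N)%:E +
   \int[mu \x mu]_(z in [set z : 'rV[R]_N * 'rV[R]_N |
       [/\ Omega z.1, Omega z.2 & (enorm (z.1 - z.2) < 1)%R]])
     (`|u z.1 - u z.2| ^+ 2 / enorm (z.1 - z.2) ^+ N)%:E +
   \int[mu]_(x in Omega) (u x ^+ 2)%:E < +oo)%E.

(* Absolutely convergent for u in [calV Omega] and v in C_c^oo(Omega); otherwise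
   [E_L] takes the junk values of non-convergent integrals. *)
Definition E_L u v : R :=
  c_ N / 2 *
    \int[mu]_x \int[mu]_(y in eball x 1)
       ((u x - u y) * (v x - v y) / enorm (x - y) ^+ N)
  - c_ N *
    \int[(mu \x mu)%E]_(z in [set z : 'rV[R]_N * 'rV[R]_N |
        1 <= enorm (z.1 - z.2)])
       (u z.1 * v z.2 / enorm (z.1 - z.2) ^+ N)
  + rho_ N * \int[mu]_x (u x * v x).

End LogarithmicLaplacian.

(* Main.v *)
Require Import Defs.
From mathcomp Require Import all_boot all_order all_algebra.
From mathcomp Require Import all_classical all_reals all_analysis.
From mathcomp Require Import measurable_realfun ring lra.
Import Order.TTheory GRing.Theory Num.Theory.
Import numFieldNormedType.Exports.
Local Open Scope classical_set_scope.
Local Open Scope ring_scope.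

(** Near the boundary point the function [v] dominates a multiple of an
    explicit barrier, which has size [ell t ^ (1/2)] at the relevant points.

    The barrier on the ball of radius [r] about [y] is
    [prof (r ^ 2 - |x - y| ^ 2)], where [prof] is the square root of [ell],
    extended by zero. The form of the logarithmic Laplacian, near the diagonal,
    integrates second differences [2 w (z) - w (z + h) - w (z - h)] against
    [|h| ^ (- N)] over [|h| < 1], and this kernel gives the same mass to every
    dyadic shell [2 ^ (- k - 1) <= |h| < 2 ^ (- k)] ([kern_dyadicE]). Let
    [r ^ 2 - |z - y| ^ 2] be about [2 ^ (- m)]. On the shells [k <= m] one of
    the points [z + h], [z - h] moves inwards and there the barrier is about
    [prof (2 ^ (- k))] ([sdiff_barrier_shell_le]), so that these shells
    contribute at most a multiple of the sum of
    [2 * prof (2 ^ (- m)) - prof (2 ^ (- k))]. As [prof (2 ^ (- k))] is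
    proportional to [k ^ (- 1/2)] and the sum of [k ^ (- 1/2)] over [k <= m] is
    about [2 * m ^ (1/2)], the two terms cancel up to a constant
    ([sum_shell_le]); this is where the exponent one half comes from. The
    directions [h] almost tangent to the sphere cost [prof ^ 3], that is
    [k ^ (- 3/2)], which is summable, and on the shells [k > m] the barrier is
    Lipschitz. Hence the operator applied to the barrier is bounded above,
    uniformly in [z] and in [r] ([barrier_bound]).

    The function [v] is nonnegative and at least some [c > 0] on a ball [K],
    whose centre can be taken at a distance from [x0] that is neither 0 nor 1.
    If a small multiple [eps] of the barrier exceeded [v] somewhere in a small
    ball tangent at [x0], then [eps * w - V] would have a positive maximum at
    some [z], where [V] is a mollification of [v] at a scale small enough for
    the inequality to persist. Testing the hypothesis with the mollifier
    centred at [z] expresses the form through second differences of [V] at [z]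
    ([near_form], [E_L_moll]), so no regularity of [v] beyond continuity is
    involved. At [z] these second differences are at most those of [eps * w],
    whose total is [O (eps)]; the mass of [v] on [K] enters with the negative
    sign, through the near part if [K] lies within distance 1 of [z] and
    through the far part otherwise ([far_form_ge]); and the zero order term,
    whose sign is arbitrary, is absorbed because the shells of radius between
    [2 ^ (- n)] and 1 multiply the positive maximum by the mass of [n] shells.
    For small [eps] the form is negative, a contradiction
    ([barrier_comparison]).

    Finally, [x0 - t eta] lies at distance [r0 - t] from the centre of the
    ball, so the argument of [prof] is at least [t ^ 2] there, and
    [prof (t ^ 2)] is [prof t] divided by the square root of 2 ([prof_sqr]). *)

(** * Affine changes of variables for Lebesgue measure *)

(** The pushforward of a measure, bundled so that uniqueness theorems can be
    applied to it. *)
Definition pushforward_measure d d' (T : measurableType d)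
    (T' : measurableType d') (R : realType) (m : {measure set T -> \bar R})
    (f : T -> T') (mf : measurable_fun setT f) : {measure set T' -> \bar R} :=
  measure_function_pushforward__canonical__measure_function_Measure m mf.

Lemma lebesgue_measure_affine {R : realType} (a b : R) (a0 : 0 < a)
    (A : set (measurableTypeR R)) : measurable A ->
  lebesgue_measure ((fun x : R => a * x + b) @^-1` A) =
  ((a^-1)%:E * lebesgue_measure A)%E.
Proof.
move=> mA.
pose f (x : measurableTypeR R) : measurableTypeR R := a * x + b.
have mf : measurable_fun setT f.
  by apply: measurable_funD => //; exact: measurable_funM.
pose an : {nonneg R} := NngNum (ltW a0).
pose m := pushforward_measure _ _ _ _ _ (@lebesgue_measure R) f mf.
suff -> : lebesgue_measure A = mscale an m A.
  by rewrite /mscale/= muleA -EFinM mulVf ?gt_eqF// mul1e.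
refine (@lebesgue_measure_unique R (mscale an m) _ A mA) => X [] [x y] /= _ <-.
rewrite /mscale /= /pushforward.
rewrite (_ : _ @^-1` _ = `](x - b) / a, (y - b) / a]%classic); last first.
  rewrite predeqE => z /=; rewrite !in_itv/= ltr_pdivrMr// ler_pdivlMr//.
  by rewrite /f mulrC ltrBlDr lerBrDr.
rewrite !lebesgue_measure_itv/= !lte_fin ltr_pM2r ?invr_gt0// ltrD2r.
case: ifPn => _; last by rewrite mule0.
by rewrite -!EFinD -EFinM; congr EFin; field; rewrite gt_eqF.
Qed.

Section ChangeOfVariables.
Context {R : realType} {N : nat}.
Local Notation mu := (@lebesgue_rV R N).

Definition box (A : 'I_N -> set (measurableTypeR R)) : set 'rV[R]_N :=
  [set x | forall i, A i (x 0 i)].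

Lemma measurable_box A : (forall i, measurable (A i)) -> measurable (box A).
Proof.
move=> mA; rewrite (_ : box A = \bigcap_(i in [set: 'I_N])
  ((fun x : 'rV[R]_N => x 0 i : measurableTypeR R) @^-1` A i)).
  apply: fin_bigcap_measurable => // i _.
  by rewrite -[X in measurable X]setTI; exact: measurable_coord.
by rewrite predeqE => x; split=> [Bx i _|Bx i]; exact: Bx.
Qed.

(** Boxes generate the sigma-algebra and are stable under intersection, so a
    measure is determined by its values on them. *)
Let G : set (set 'rV[R]_N) := [set X | exists2 A, (forall i, measurable (A i)) & X = box A].

Let measurable_genE : (measurable : set (set 'rV[R]_N)) = <<s G >>.
Proof.
apply/seteqP; split.
  apply: smallest_sub; first exact: smallest_sigma_algebra.
  move=> Y; rewrite -bigcup_seq => -[i _ [B mB <-]]; apply: sub_sigma_algebra.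
  exists (fun j => if j == i then B else setT) => [j|].
    by case: ifP => _ //; exact: measurableT.
  rewrite setTI predeqE => x; split=> /= [Bx j|/(_ i)]; last by rewrite eqxx.
  by case: ifPn => // /eqP ->.
apply: smallest_sub; first exact: sigma_algebra_measurable.
by move=> _ [A mA ->]; exact: measurable_box.
Qed.

Let G_cover (k : nat) : set 'rV[R]_N := box (fun=> `](- k%:R), k%:R]%classic).

Let bigcup_G_cover : \bigcup_k G_cover k = setT.
Proof.
rewrite predeqE => x; split=> // _.
have bd (i : 'I_N) : `|x 0 i| <= \sum_j `|x 0 j|.
  by rewrite (bigD1 i)//= lerDl sumr_ge0.
pose k := (Num.truncn (\sum_j `|x 0 j|)).+1.
have kP : \sum_j `|x 0 j| < k%:R by rewrite /k; exact: truncnS_gt.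
exists k => // i /=; rewrite in_itv/=.
have := le_lt_trans (bd i) kP; rewrite ltr_norml => /andP[-> /ltW].
by [].
Qed.

Lemma lebesgue_rV_affine (a : R) (b : 'rV[R]_N) (A : set 'rV[R]_N) : 0 < a ->
  measurable A ->
  mu ((fun x => a *: x + b) @^-1` A) = ((a ^- N)%:E * mu A)%E.
Proof.
move=> a0 mA.
pose f (x : 'rV[R]_N) : 'rV[R]_N := a *: x + b.
have mf : measurable_fun setT f.
  apply: measurable_fun_coordP => i; under eq_fun do rewrite /f !mxE.
  by apply: measurable_funD => //; apply: measurable_funM => //; exact: measurable_coord.
have aN : 0 <= a ^+ N by rewrite exprn_ge0// ltW.
pose an : {nonneg R} := NngNum aN.
pose m := pushforward_measure _ _ _ _ _ mu f mf.
suff -> : mu A = mscale an m A.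
  by rewrite /mscale/= muleA -EFinM mulVf ?mul1e// expf_eq0 gt_eqF// andbF.
apply: (measure_unique G G_cover _ _ _ _ mu (mscale an m)) => //.
- move=> _ _ [A1 mA1 ->] [A2 mA2 ->]; exists (fun i => A1 i `&` A2 i).
    by move=> i; exact: measurableI.
  by rewrite predeqE => x; split=> [[H1 H2] i|H]; [split|split=> i; have [] := H i].
- by move=> i; exists (fun=> `](- i%:R), i%:R]%classic) => // j; exact: measurable_itv.
- move=> _ [B mB ->]; rewrite -[RHS]/((a ^+ N)%:E * mu (f @^-1` box B))%E (_ : f @^-1` box B =
    box (fun i => (fun x : R => a * x + b 0 i) @^-1` B i)); last first.
    by rewrite predeqE => x; split=> H i; have := H i; rewrite /f !mxE.
  rewrite !lebesgue_rV_box//; last first.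
    move=> i; rewrite -[X in measurable X]setTI.
    suff : measurable_fun setT (fun x : measurableTypeR R => (a * x + b 0 i) : measurableTypeR R) by apply.
    by apply: measurable_funD => //; exact: measurable_funM.
  under [in RHS]eq_bigr do rewrite lebesgue_measure_affine//.
  rewrite big_split/= prodEFin muleA prodr_const card_ord -EFinM.
  rewrite exprVn mulfV ?mul1e; first exact: lebesgue_rV_box.
  by rewrite expf_eq0 gt_eqF// andbF.
- move=> k; rewrite [ltLHS](_ : _ = \prod_(i < N)
      lebesgue_measure (`](- k%:R : R)%R, (k%:R : R)%R]%classic : set (measurableTypeR R)))%E; last first.
    by apply: lebesgue_rV_box => i; exact: measurable_itv.
  rewrite (eq_bigr (fun=> ((if (- k%:R < k%:R :> R)%R then (k%:R - - k%:R) else 0) : R)%:E)).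
    by rewrite prodEFin ltry.
  by move=> i _; rewrite lebesgue_measure_itv/= lte_fin; case: ifP.
Qed.

Lemma measurable_affine_rV (a : R) (b : 'rV[R]_N) :
  measurable_fun setT (fun x : 'rV[R]_N => a *: x + b).
Proof.
apply: measurable_fun_coordP => i; under eq_fun do rewrite !mxE.
by apply: measurable_funD => //; apply: measurable_funM => //; exact: measurable_coord.
Qed.

Lemma ge0_integral_affine (a : R) (b : 'rV[R]_N) (f : 'rV[R]_N -> \bar R) :
  0 < a -> measurable_fun setT f -> (forall x, 0 <= f x)%E ->
  (\int[mu]_x f (a *: x + b)%R = (a ^- N)%:E * \int[mu]_x f x)%E.
Proof.
move=> a0 mf f0.
have ma := measurable_affine_rV a b.
pose g x : 'rV[R]_N := a *: x + b.
have aN : 0 <= a ^- N by rewrite invr_ge0 exprn_ge0// ltW.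
pose an : {nonneg R} := NngNum aN.
pose m := pushforward_measure _ _ _ _ _ mu g ma.
transitivity (\int[m]_x f x)%E.
  by rewrite ge0_integral_pushforward// => x _.
transitivity (\int[mscale an mu]_x f x)%E.
  apply: eq_measure_integral => A mA _.
  by rewrite /mscale/= /pushforward lebesgue_rV_affine.
by rewrite ge0_integral_mscale.
Qed.

Lemma integral_translation (b : 'rV[R]_N) (f : 'rV[R]_N -> \bar R) :
  measurable_fun setT f ->
  (\int[mu]_x f (x + b)%R = \int[mu]_x f x)%E.
Proof.
move=> mf.
have tr g : measurable_fun setT g -> (forall x, 0 <= g x)%E ->
    (\int[mu]_x g (x + b)%R = \int[mu]_x g x)%E.
  move=> mg g0; have := ge0_integral_affine 1 b g ltr01 mg g0.
  rewrite expr1n invr1 mul1e => <-.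
  by apply: eq_integral => x _; rewrite scale1r.
rewrite integralE [RHS]integralE; congr (_ - _)%E.
  rewrite -[RHS](tr _ (measurable_funepos mf) (fun x => funepos_ge0 _ x)).
  by apply: eq_integral => x _; rewrite !funeposE.
rewrite -[RHS](tr _ (measurable_funeneg mf) (fun x => funeneg_ge0 _ x)).
by apply: eq_integral => x _; rewrite !funenegE.
Qed.

Lemma Rintegral_translation (b : 'rV[R]_N) (f : 'rV[R]_N -> R) :
  measurable_fun setT f ->
  \int[mu]_x f (x + b)%R = \int[mu]_x f x.
Proof.
move=> mf; rewrite /Rintegral; congr fine.
by rewrite -(integral_translation b (fun x => (f x)%:E))//; exact/measurable_EFinP.
Qed.

End ChangeOfVariables.

(** * The Euclidean norm on row vectors *)

Section EuclideanNorm.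
Context {R : realType} {N : nat}.
Implicit Types (x y z a b h : 'rV[R]_N) (r s : R).

Definition dotr x y : R := \sum_(i < N) x 0 i * y 0 i.

Lemma dotrC x y : dotr x y = dotr y x.
Proof. by apply: eq_bigr => i _; rewrite mulrC. Qed.

Lemma dotrDr x y z : dotr x (y + z) = dotr x y + dotr x z.
Proof. by rewrite -big_split/=; apply: eq_bigr => i _; rewrite mxE mulrDr. Qed.

Lemma dotrZr x r y : dotr x (r *: y) = r * dotr x y.
Proof. by rewrite mulr_sumr; apply: eq_bigr => i _; rewrite mxE mulrCA. Qed.

Lemma dotrNr x y : dotr x (- y) = - dotr x y.
Proof. by rewrite -scaleN1r dotrZr mulN1r. Qed.

Lemma dotrDl x y z : dotr (x + y) z = dotr x z + dotr y z.
Proof. by rewrite dotrC dotrDr !(dotrC z). Qed.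

Lemma dotrZl r x y : dotr (r *: x) y = r * dotr x y.
Proof. by rewrite dotrC dotrZr dotrC. Qed.

Lemma dotrr_ge0 x : 0 <= dotr x x.
Proof. by apply: sumr_ge0 => i _; rewrite -expr2 sqr_ge0. Qed.

Lemma enormE x : enorm x = Num.sqrt (dotr x x).
Proof. by rewrite /enorm; congr Num.sqrt; apply: eq_bigr => i _; rewrite expr2. Qed.

Lemma enorm_ge0 x : 0 <= enorm x.
Proof. exact: sqrtr_ge0. Qed.

Lemma sqr_enorm x : enorm x ^+ 2 = dotr x x.
Proof. by rewrite enormE sqr_sqrtr// dotrr_ge0. Qed.

Lemma enormZ r x : enorm (r *: x) = `|r| * enorm x.
Proof.
by rewrite !enormE dotrZr dotrZl mulrA -expr2 sqrtrM ?sqr_ge0// sqrtr_sqr.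
Qed.

Lemma enormN x : enorm (- x) = enorm x.
Proof. by rewrite -scaleN1r enormZ normrN1 mul1r. Qed.

Lemma enormB x y : enorm (x - y) = enorm (y - x).
Proof. by rewrite -enormN opprB. Qed.

Lemma enorm0 : enorm (0 : 'rV[R]_N) = 0.
Proof. by rewrite -(scale0r 0) enormZ normr0 mul0r. Qed.

Lemma sqr_enormD x y : enorm (x + y) ^+ 2 = enorm x ^+ 2 + 2 * dotr x y + enorm y ^+ 2.
Proof. by rewrite !sqr_enorm dotrDr !dotrDl (dotrC y x); ring. Qed.

Lemma normr_coord_le_enorm x i : `|x 0 i| <= enorm x.
Proof.
rewrite -(@ler_pXn2r _ 2)// ?nnegrE ?enorm_ge0// sqr_enorm real_normK ?num_real//.
by rewrite /dotr (bigD1 i)//= -expr2 lerDl sumr_ge0// => j _; rewrite -expr2 sqr_ge0.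
Qed.

Lemma enorm_eq0 x : (enorm x == 0) = (x == 0).
Proof.
apply/eqP/eqP => [x0|->]; last exact: enorm0.
apply/rowP => i; rewrite mxE; apply/eqP; rewrite -normr_le0 -x0.
exact: normr_coord_le_enorm.
Qed.

Lemma enorm_gt0 x : (0 < enorm x) = (x != 0).
Proof. by rewrite lt_def enorm_ge0 andbT enorm_eq0. Qed.

Lemma normr_dotr_le x y : `|dotr x y| <= enorm x * enorm y.
Proof.
have [->|y0] := eqVneq y 0.
  by rewrite -(scale0r 0) dotrZr mul0r normr0 mulr_ge0// enorm_ge0.
have y2 : 0 < dotr y y by rewrite -sqr_enorm exprn_gt0// enorm_gt0.
rewrite -(@ler_pXn2r _ 2)// ?nnegrE ?mulr_ge0 ?enorm_ge0//.
rewrite real_normK ?num_real// exprMn !sqr_enorm.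
have := dotrr_ge0 (dotr y y *: x + (- dotr x y) *: y).
rewrite !(dotrDr, dotrDl, dotrZr, dotrZl) (dotrC y x) => H.
have : 0 <= dotr y y * (dotr x x * dotr y y - dotr x y ^+ 2).
  by apply: le_trans H _; rewrite le_eqVlt; apply/orP; left; apply/eqP; ring.
by rewrite pmulr_rge0// subr_ge0.
Qed.

Lemma enormD_le x y : enorm (x + y) <= enorm x + enorm y.
Proof.
rewrite -(@ler_pXn2r _ 2)// ?nnegrE ?addr_ge0 ?enorm_ge0// sqr_enormD sqrrD.
rewrite lerD2r lerD2l -(mulr_natl (_ * _)) ler_pM2l//.
exact: le_trans (ler_norm _) (normr_dotr_le _ _).
Qed.

Lemma enormB_le x y z : enorm (x - z) <= enorm (x - y) + enorm (y - z).
Proof. by have := enormD_le (x - y) (y - z); rewrite addrA subrK. Qed.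

Lemma normrB_enorm_le x y : `|enorm x - enorm y| <= enorm (x - y).
Proof.
have H1 := enormB_le y x 0; have H2 := enormB_le x y 0.
rewrite !subr0 (enormB y x) in H1 H2.
by rewrite ler_norml; apply/andP; split; lra.
Qed.

Lemma enorm_le_sum x : enorm x <= \sum_i `|x 0 i|.
Proof.
rewrite -(@ler_pXn2r _ 2)// ?nnegrE ?enorm_ge0 ?sumr_ge0//.
rewrite sqr_enorm [leRHS]expr2 mulr_suml; apply: ler_sum => i _.
rewrite -expr2 -real_normK ?num_real// expr2; apply: ler_wpM2l => //.
by rewrite (bigD1 i)//= lerDl sumr_ge0.
Qed.

Lemma enorm_le_card x r : (forall i, `|x 0 i| <= r) -> enorm x <= N%:R * r.
Proof.
move=> xr; apply: le_trans (enorm_le_sum x) _.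
apply: le_trans (ler_sum _ (fun i _ => xr i)) _.
by rewrite sumr_const card_ord mulr_natl.
Qed.

Lemma mx_norm_coord x i : `|x 0 i| <= `|x|.
Proof.
by rewrite [leRHS]/Num.norm/= mx_normrE; apply/bigmax_geP; right; exists (0, i).
Qed.

Lemma mx_norm_le_enorm x : `|x| <= enorm x.
Proof.
rewrite [leLHS]/Num.norm/= mx_normrE; apply/bigmax_leP; split; first exact: enorm_ge0.
by move=> [i j] _ /=; rewrite ord1; exact: normr_coord_le_enorm.
Qed.

(** The topology of row vectors comes from the sup norm; this and the next lemma
    turn it into Euclidean distances once and for all. *)
Lemma nbhs_enormP x (A : set 'rV[R]_N) :
  (exists2 e, 0 < e & forall y, enorm (y - x) < e -> A y) <-> nbhs x A.
Proof.
split=> [[e e0 eA]|/nbhs_ballP[e /= e0 eA]].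
  apply/nbhs_ballP; exists (e / N.+1%:R) => /= [|y /=]; first by rewrite divr_gt0.
  rewrite -ball_normE /= ltr_pdivlMr// => xy; apply: eA; rewrite enormB.
  have xyi i : `|(x - y) 0 i| <= `|x - y| by exact: mx_norm_coord.
  apply: le_lt_trans (enorm_le_card _ _ xyi) _; apply: le_lt_trans xy.
  by rewrite mulrC ler_wpM2l// ler_nat.
exists e => // y xy; apply: eA; rewrite -ball_normE /=.
by rewrite (le_lt_trans (mx_norm_le_enorm _))// enormB.
Qed.

Lemma continuous_enormP (f : 'rV[R]_N -> R) :
  continuous f <-> forall x e, 0 < e ->
    exists2 d, 0 < d & forall y, enorm (y - x) < d -> `|f y - f x| < e.
Proof.
split=> [cf x e e0|H x].
  have /cvgrPdist_lt/(_ e e0) := cf x.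
  move=> /nbhs_enormP[d d0 dP]; exists d => // y /dP.
  by rewrite distrC.
apply: (iffRL (@cvgrPdist_lt _ _ _ (nbhs x) _ f (f x))) => e e0.
apply/nbhs_enormP; by have [d d0 dP] := H x e e0; exists d => // y /dP; rewrite distrC.
Qed.

Lemma continuous_enorm : continuous (enorm : 'rV[R]_N -> R).
Proof.
apply/continuous_enormP => x e e0; exists e => // y.
exact: le_lt_trans (normrB_enorm_le _ _).
Qed.

Lemma continuous_measurable_rV (f : 'rV[R]_N -> R) :
  continuous f -> measurable_fun setT f.
Proof.
move=> /continuousP cf; apply: (measurability _ (RGenOpens.measurableE R)).
move=> _ [_ [a [b ->] <-]]; rewrite setTI; apply: open_measurable_rV.
exact/cf/interval_open.
Qed.

Lemma measurable_enorm : measurable_fun setT (enorm : 'rV[R]_N -> R).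
Proof. by apply: continuous_measurable_rV; exact: continuous_enorm. Qed.

Lemma compact_cball x r : compact [set y | enorm (y - x) <= r].
Proof.
apply: bounded_closed_compact.
  exists (r + enorm x); split; first exact: num_real.
  move=> M rM y /= yr; apply: le_trans (mx_norm_le_enorm y) _; apply: ltW.
  apply: le_lt_trans rM; have := enormB_le y x 0; rewrite !subr0 => /le_trans; apply.
  by rewrite lerD2r.
apply: (closed_comp (f := fun y => enorm (y - x)) (D := [set t | t <= r])).
  move=> y _; apply: continuous_comp; last exact: continuous_enorm.
  by apply: continuousB; [exact: id|exact: cst_continuous].
exact: closed_le.
Qed.

End EuclideanNorm.

(** * The kernel, its shells, and the measure of a slab *)

Section Kernel.
Context {R : realType} {N : nat}.
Local Notation mu := (@lebesgue_rV R N).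
Implicit Types (x y z a b h : 'rV[R]_N) (r s : R).

Definition kern h : R := (enorm h ^+ N)^-1.

Definition ann r s : set 'rV[R]_N := [set h | r <= enorm h < s].

Lemma kern_ge0 h : 0 <= kern h.
Proof. by rewrite invr_ge0 exprn_ge0// enorm_ge0. Qed.

Lemma measurable_kern : measurable_fun setT kern.
Proof.
rewrite (_ : kern = fun h => (enorm h ^+ N) `^ (-1)).
  apply: (measurableT_comp (measurable_powR _)).
  by apply: measurable_funX; exact: measurable_enorm.
by apply/funext => h; rewrite powR_inv1// exprn_ge0// enorm_ge0.
Qed.

Lemma measurable_lt_set (f g : 'rV[R]_N -> R) : measurable_fun setT f ->
  measurable_fun setT g -> measurable [set x | f x < g x].
Proof.
move=> mf mg; have := measurable_fun_ltr mf mg.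
by move=> /(_ measurableT [set true]); rewrite setTI; apply.
Qed.

Lemma measurable_le_set (f g : 'rV[R]_N -> R) : measurable_fun setT f ->
  measurable_fun setT g -> measurable [set x | f x <= g x].
Proof.
move=> mf mg; have := measurable_fun_ler mf mg.
by move=> /(_ measurableT [set true]); rewrite setTI; apply.
Qed.

Lemma measurable_ann r s : measurable (ann r s).
Proof.
rewrite (_ : ann r s = [set h | r <= enorm h] `&` [set h | enorm h < s]).
  apply: measurableI.
    by apply: measurable_le_set => //; exact: measurable_enorm.
  by apply: measurable_lt_set => //; exact: measurable_enorm.
by rewrite predeqE => h; split=> [/andP[? ?]|[? ?]]; [split|apply/andP; split].
Qed.

Lemma measurable_eball x r : measurable (eball x r).
Proof.
apply: measurable_lt_set => //.
apply: continuous_measurable_rV => y; apply: continuous_comp; last exact: continuous_enorm.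
by apply: continuousB; [exact: id|exact: cst_continuous].
Qed.

Lemma lebesgue_rV_cube (c : 'rV[R]_N) r : 0 < r ->
  mu (box (fun i => `[c 0 i - r, c 0 i + r]%classic)) = ((2 * r) ^+ N)%:E.
Proof.
move=> r0; transitivity ((\prod_(i < N) lebesgue_measure
  (`[(c 0 i - r)%R, (c 0 i + r)%R]%classic : set (measurableTypeR R)))%E).
  by apply: lebesgue_rV_box => i; exact: measurable_itv.
rewrite (eq_bigr (fun=> (2 * r)%:E)); last first.
  move=> i _; rewrite lebesgue_measure_itv/= lte_fin.
  rewrite ifT; last by lra.
  by rewrite -EFinD; congr EFin; ring.
by rewrite prodEFin prodr_const card_ord.
Qed.

Lemma lebesgue_rV_eball_le x r : 0 < r -> (mu (eball x r) <= ((2 * r) ^+ N)%:E)%E.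
Proof.
move=> r0; rewrite -(lebesgue_rV_cube x)//; apply: le_measure.
- by rewrite inE; exact: measurable_eball.
- by rewrite inE; apply: measurable_box => i; exact: measurable_itv.
- move=> y yr i /=; rewrite in_itv/=.
  have := le_lt_trans (normr_coord_le_enorm (y - x) i) yr.
  by rewrite !mxE ltr_norml => /andP[? ?]; apply/andP; split; lra.
Qed.

Lemma lebesgue_rV_translate (A : set 'rV[R]_N) b : measurable A ->
  mu [set x | A (x + b)] = mu A.
Proof.
move=> mA; rewrite -[RHS]mul1e -[1%E]/(1%:E) -[X in (X%:E * _)%E]invr1.
rewrite -[X in (X^-1%:E * _)%E](expr1n _ N) -(lebesgue_rV_affine 1 b)//.
by congr (lebesgue_rV N _); rewrite predeqE => x /=; rewrite scale1r.
Qed.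

(** A slab around a hyperplane meets a ball in a small set: translates of the
    slab along its normal are disjoint and stay in the doubled ball. *)
Lemma lebesgue_rV_slab_le a (s e : R) : a != 0 -> 0 < s -> 0 < e ->
  (mu [set h | (enorm h < s)%R /\ (`|dotr a h| < e)%R] <=
    ((4 * s) ^+ N * (4 * e / (enorm a * s)))%:E)%E.
Proof.
move=> a0 s0 e0; set S := [set h | _].
have an0 : 0 < enorm a by rewrite enorm_gt0.
have mdot : measurable_fun setT (dotr a).
  rewrite /dotr; apply: measurable_sum => i; apply: measurable_funM => //.
  exact: measurable_coord.
have mS : measurable S.
  rewrite (_ : S = [set h | enorm h < s] `&` [set h | `|dotr a h| < e])//.
  apply: measurableI; apply: measurable_lt_set => //; first exact: measurable_enorm.
  exact: measurableT_comp.
have Sball r : 0 < r -> (mu [set h | (enorm h < r)%R] <= ((2 * r) ^+ N)%:E)%E.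
  move=> r0; have := lebesgue_rV_eball_le 0 r r0; congr (_ <= _)%E.
  by congr (lebesgue_rV N _); rewrite predeqE => h /=; rewrite /eball/= subr0.
have mball r : measurable [set h : 'rV[R]_N | enorm h < r].
  by apply: measurable_lt_set => //; exact: measurable_enorm.
have [small|big] := ltP (enorm a * s) (2 * e).
  apply: (@le_trans _ _ ((2 * s) ^+ N)%:E).
    apply: le_trans (Sball _ s0); apply: le_measure; rewrite ?inE//.
    by move=> h [].
  rewrite lee_fin -[leLHS]mulr1; apply: ler_pM => //.
    by rewrite exprn_ge0// mulr_ge0// ltW.
    by rewrite lerXn2r ?nnegrE//; lra.
  by rewrite ler_pdivlMr ?mulr_gt0// mul1r; lra.
pose q := enorm a * s / (2 * e).
have q1 : 1 <= q by rewrite ler_pdivlMr ?mulr_gt0// mul1r.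
pose M := Num.truncn q.
have Mq : M%:R <= q by rewrite truncn_le//; lra.
have qM : q < M.+1%:R by exact: truncnS_gt.
have M1 : 1 <= M%:R :> R by rewrite ler1n truncn_gt0.
(* translating by [w] moves the slab by exactly its thickness *)
pose w := (2 * e / enorm a ^+ 2) *: a.
have aw : dotr a w = 2 * e.
  by rewrite dotrZr -sqr_enorm divfK// sqrf_eq0 gt_eqF.
have wn : enorm w = 2 * e / enorm a.
  rewrite enormZ ger0_norm ?divr_ge0 ?exprn_ge0 ?mulr_ge0 ?ltW//.
  by field; rewrite gt_eqF.
clearbody w.
pose T (m : nat) := [set h | S (h + (- m%:R *: w))].
have mT m : measurable (T m).
  have := measurable_affine_rV 1 (- m%:R *: w) measurableT S mS.
  rewrite setTI; congr measurable.
  by rewrite predeqE => h /=; rewrite scale1r.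
have tT : trivIset `I_M T.
  move=> i j _ _ [h [[_ +] [_ +]]].
  rewrite !dotrDr !dotrZr aw !ltr_norml => /andP[i1 i2] /andP[j1 j2].
  apply/eqP; rewrite eqn_leq; apply/andP; split; rewrite -ltnS -(ltr_nat R) -natr1.
    by rewrite -(ltr_pM2r e0); lra.
  by rewrite -(ltr_pM2r e0); lra.
have UT : (\sum_(m < M) mu (T m) <= ((4 * s) ^+ N)%:E)%E.
  rewrite -measure_semi_additive_ord_I//; last exact: bigsetU_measurable.
  rewrite (_ : 4 * s = 2 * (2 * s)); last by ring.
  apply: le_trans (Sball _ _); last by lra.
  apply: le_measure; rewrite ?inE//; first exact: bigsetU_measurable.
  rewrite -bigcup_mkord => h [m /= mM [hs _]].
  rewrite -(subrK (m%:R *: w) h).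
  apply: le_lt_trans (enormD_le _ _) _; rewrite -scaleNr.
  rewrite (_ : 2 * s = s + s); last by ring.
  apply: ltr_leD => //; rewrite enormZ ger0_norm ?ler0n// wn.
  have : m%:R <= q by apply: le_trans Mq; rewrite ler_nat ltnW.
  rewrite /q ler_pdivlMr ?mulr_gt0// => mq.
  by rewrite mulrA ler_pdivrMr// (mulrC s).
rewrite (eq_bigr (fun=> mu S)) in UT; last by move=> m _; rewrite lebesgue_rV_translate.
have Sfin : mu S \is a fin_num.
  rewrite ge0_fin_numE//; apply: (@le_lt_trans _ _ ((2 * s) ^+ N)%:E); last by rewrite ltry.
  apply: le_trans (Sball _ s0); apply: le_measure; rewrite ?inE//.
  by move=> h [].
move: UT; rewrite -(fineK Sfin) sumEFin lee_fin sumr_const card_ord => UT.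
rewrite lee_fin -(ler_pM2l (lt_le_trans ltr01 M1)) [leLHS]mulr_natl; apply: le_trans UT _.
rewrite mulrCA -[leLHS]mulr1; apply: ler_wpM2l; first by rewrite exprn_ge0// mulr_ge0// ltW.
rewrite mulrA ler_pdivlMr ?mulr_gt0// mul1r.
move: qM; rewrite /q ltr_pdivrMr ?mulr_gt0// -natr1 => qM; nra.
Qed.

End Kernel.

(** * Integrals of the kernel over dyadic shells *)

Section KernelIntegrals.
Context {R : realType} {N : nat}.
Local Notation mu := (@lebesgue_rV R N).
Local Notation kern := (@kern R N).
Local Notation ann := (@ann R N).
Implicit Types (x y z a b h : 'rV[R]_N) (r s : R).

Lemma ann_lty r s : (mu (ann r s) < +oo)%E.
Proof.
apply: (@le_lt_trans _ _ ((2 * (`|s| + 1)) ^+ N)%:E); last exact: ltry.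
apply: le_trans (lebesgue_rV_eball_le 0 (`|s| + 1) _); last by rewrite ltr_wpDl.
apply: le_measure; rewrite ?inE.
- exact: measurable_ann.
- exact: measurable_eball.
- move=> h /andP[_ hs]; rewrite /eball/= subr0 (lt_le_trans hs)//.
  by rewrite (le_trans (ler_norm s))// lerDl.
Qed.

Lemma kern_ann_le r s h : 0 < r -> ann r s h -> kern h <= r ^- N.
Proof.
move=> r0 /andP[rh _]; rewrite lef_pV2 ?posrE ?exprn_gt0//; last exact: lt_le_trans rh.
by rewrite lerXn2r// nnegrE ?enorm_ge0// ltW.
Qed.

Lemma integrable_bounded (D : set 'rV[R]_N) (f : 'rV[R]_N -> R) (C : R) :
  measurable D -> (mu D < +oo)%E -> measurable_fun setT f ->
  (forall h, D h -> `|f h| <= C) -> mu.-integrable D (EFin \o f).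
Proof.
move=> mD Dfin mf fC; apply: measurable_bounded_integrable => //.
  exact: measurable_funS mf.
exists C; split; first exact: num_real.
by move=> M CM h Dh; apply: le_trans (fC h Dh) (ltW CM).
Qed.

Lemma integrable_kern_ann r s (f : 'rV[R]_N -> R) C : 0 < r ->
  measurable_fun setT f -> (forall h, ann r s h -> `|f h| <= C) ->
  mu.-integrable (ann r s) (EFin \o (fun h => f h * kern h)).
Proof.
move=> r0 mf fC; apply: (integrable_bounded _ _ (C * r ^- N)).
- exact: measurable_ann.
- exact: ann_lty.
- by apply: measurable_funM => //; exact: measurable_kern.
- move=> h hrs; rewrite normrM (ger0_norm (kern_ge0 _)) ler_pM ?kern_ge0 ?fC//.
  exact: kern_ann_le hrs.
Qed.

(** The mass that the kernel gives to any dyadic shell. *)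
Definition kap : R := \int[mu]_(h in ann 2^-1 1) kern h.

Lemma kap_ge0 : 0 <= kap.
Proof. by apply: Rintegral_ge0 => h _; exact: kern_ge0. Qed.

Lemma integrable_kern r s : 0 < r -> mu.-integrable (ann r s) (EFin \o kern).
Proof.
move=> r0; have := integrable_kern_ann r s (cst 1) 1 r0 (measurable_cst _).
rewrite (_ : (fun h => cst 1 h * kern h) = kern); last by apply/funext => h; rewrite mul1r.
by apply => h _; rewrite normr1.
Qed.

Lemma kapE : (\int[mu]_(h in ann 2^-1%R 1%R) (kern h)%:E)%E = kap%:E.
Proof.
rewrite /kap /Rintegral fineK//; apply: integrable_fin_num; first exact: measurable_ann.
by apply: integrable_kern; rewrite invr_gt0.
Qed.

(** The kernel is homogeneous of degree [- N], which is the Jacobian of the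
    dilation from one shell to another. *)
Lemma kern_dyadicE k :
  (\int[mu]_(h in ann (2 ^- k.+1)%R (2 ^- k)%R) (kern h)%:E)%E = kap%:E.
Proof.
rewrite -kapE integral_mkcond [RHS]integral_mkcond.
set f : _ -> \bar R := (fun h => (kern h)%:E) \_ (ann 2^-1 1).
have p0 : 0 < (2 ^+ k : R) by rewrite exprn_gt0.
have mf : measurable_fun setT f.
  apply/(measurable_restrictT _ (measurable_ann _ _)).
  apply/measurable_EFinP; apply: measurable_funTS; exact: measurable_kern.
have f0 h : (0 <= f h)%E by apply: erestrict_ge0 => x _; rewrite lee_fin kern_ge0.
have pN : (2 ^+ k) ^+ N != 0 :> R by rewrite !expf_neq0.
have -> : (\int[mu]_x f x = ((2 ^+ k) ^+ N)%:E * \int[mu]_x f ((2 ^+ k) *: x + 0)%R)%E.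
  by rewrite ge0_integral_affine// muleA -EFinM mulfV// mul1e.
rewrite -ge0_integralZl//; last first.
  by apply: (measurableT_comp mf); exact: measurable_affine_rV.
apply: eq_integral => h _; rewrite addr0 /f !patchE.
have nE : enorm (2 ^+ k *: h) = 2 ^+ k * enorm h by rewrite enormZ gtr0_norm.
have -> : (2 ^+ k *: h \in ann 2^-1 1) = (h \in ann (2 ^- k.+1) (2 ^- k)).
  apply: asbool_equiv_eq; rewrite /ann/= nE mulrC -ler_pdivrMr// -ltr_pdivlMr//.
  by rewrite mul1r exprS invfM.
case: ifPn => _; last by rewrite mule0.
by rewrite -EFinM /kern/= nE exprMn invfM mulrA mulfV// mul1r.
Qed.

Lemma Rintegral_kern_dyadic k : \int[mu]_(h in ann (2 ^- k.+1) (2 ^- k)) kern h = kap.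
Proof. by rewrite /Rintegral kern_dyadicE. Qed.

Lemma kap_gt0 : (0 < N)%N -> 0 < kap.
Proof.
move=> N0; rewrite -lte_fin -kapE.
(* a cube about a point of length 3/4 on a coordinate axis lies in the shell *)
pose c : 'rV[R]_N := \row_j (if j == Ordinal N0 then 3 / 4 else 0).
have N1 : 1 <= N%:R :> R by rewrite ler1n.
have r0 : 0 < (8 * N%:R)^-1 :> R by rewrite invr_gt0; lra.
pose B := box (fun i => `[c 0 i - (8 * N%:R)^-1, c 0 i + (8 * N%:R)^-1]%classic).
have mB : measurable B by apply: measurable_box => i; exact: measurable_itv.
have cE : enorm c = 3 / 4.
  rewrite enormE /dotr (bigD1 (Ordinal N0))//= big1 ?addr0; last first.
    by move=> i iN; rewrite !mxE (negPf iN) mulr0.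
  by rewrite !mxE eqxx -expr2 sqrtr_sqr ger0_norm// divr_ge0.
have BA : B `<=` ann 2^-1 1.
  move=> h Bh; rewrite /ann/=.
  have : enorm (h - c) <= 8^-1.
    rewrite (_ : 8^-1 = N%:R * (8 * N%:R)^-1); last by field; rewrite gt_eqF//; lra.
    apply: enorm_le_card => i; have := Bh i; rewrite /= in_itv/= !mxE => /andP[h1 h2].
    by rewrite ler_norml; apply/andP; split; lra.
  move=> hc; have := normrB_enorm_le h c; rewrite cE ler_norml => /andP[h1 h2].
  by apply/andP; split; lra.
apply: (@lt_le_trans _ _ (mu B)).
  by rewrite lebesgue_rV_cube// lte_fin exprn_gt0// mulr_gt0.
rewrite -[leLHS]mul1e -integral_cst//.
apply: (@le_trans _ _ (\int[mu]_(h in B) (kern h)%:E)%E).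
  apply: ge0_le_integral => //.
  - by apply/measurable_EFinP; apply: measurable_funTS; exact: measurable_kern.
  - move=> h /BA /andP[h1 h2]; rewrite lee_fin invf_ge1 ?exprn_gt0//.
      by rewrite exprn_ile1// ?enorm_ge0// ltW.
    by rewrite (lt_le_trans _ h1).
apply: ge0_subset_integral => //.
- exact: measurable_ann.
- by apply/measurable_EFinP; apply: measurable_funTS; exact: measurable_kern.
- by move=> h _; rewrite lee_fin kern_ge0.
Qed.

(** The dyadic shells carry equal kernel mass, so the factor [enorm h] turns
    the integral over the ball into a geometric series. *)
Lemma integral_enorm_kern_le m :
  (\int[mu]_(h in ann 0%R (2 ^- m)%R) (enorm h * kern h)%:E <= (2 * kap * 2 ^- m)%:E)%E.
Proof.
have half_lt i : (2 ^- i.+1 : R) < 2 ^- i.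
  by rewrite ltf_pV2 ?posrE ?exprn_gt0// exprS ltr_pMl ?exprn_gt0// ltr1n.
have half_le i j : (i <= j)%N -> (2 ^- j : R) <= 2 ^- i.
  by move=> ij; rewrite lef_pV2 ?posrE ?exprn_gt0// ler_weXn2l// ler1n.
pose F k := ann (2 ^- (m + k).+1) (2 ^- (m + k)).
have mF k : measurable (F k) by exact: measurable_ann.
have mf : measurable_fun setT (fun h => (enorm h * kern h)%:E).
  apply/measurable_EFinP; apply: measurable_funM; first exact: measurable_enorm.
  exact: measurable_kern.
have f0 h : (0 <= (enorm h * kern h)%:E)%E.
  by rewrite lee_fin mulr_ge0 ?kern_ge0 ?enorm_ge0.
have tF : trivIset setT F.
  apply: ltn_trivIset => j i ij; rewrite -subset0 => h [/andP[h1 h2] /andP[h3 h4]] /=.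
  have : enorm h < enorm h; last by rewrite ltxx.
  apply: lt_le_trans h4 _; apply: le_trans h1; apply: half_le.
  by rewrite -addnS leq_add2l.
have -> : (\int[mu]_(h in ann 0%R (2 ^- m)%R) (enorm h * kern h)%:E =
           \int[mu]_(h in \bigcup_k F k) (enorm h * kern h)%:E)%E.
  rewrite integral_mkcond [RHS]integral_mkcond; apply: eq_integral => h _.
  rewrite !patchE; have [->|h0] := eqVneq h 0.
    by rewrite enorm0 mul0r; do 2 case: ifP.
  suff -> : (h \in ann 0 (2 ^- m)) = (h \in \bigcup_k F k) by [].
  apply: asbool_equiv_eq; split=> [/andP[_ hm]|[k _ /andP[_ hk]]]; last first.
    by rewrite /ann/= enorm_ge0/= (lt_le_trans hk)// half_le// leq_addr.
  have hn0 : 0 < enorm h by rewrite enorm_gt0.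
  have : exists k, 2 ^- (m + k).+1 <= enorm h.
    exists (Num.truncn ((enorm h)^-1)).
    rewrite -[leRHS]invrK lef_pV2 ?posrE ?exprn_gt0 ?invr_gt0//.
    apply: ltW; apply: lt_le_trans (truncnS_gt _) _.
    rewrite -natrX ler_nat; apply: leq_trans (ltnW (ltn_expl _ (ltnSn 1))) _.
    by rewrite leq_exp2l// ltnS leq_addl.
  move=> /ex_minnP[k hk kmin]; exists k => //.
  rewrite /F /ann/= hk/=; case: k kmin {hk} => [|k] kmin; first by rewrite addn0.
  by rewrite addnS ltNge; apply/negP => /kmin; rewrite ltnn.
rewrite ge0_integral_bigcup//; last exact: measurable_funTS.
apply: (@le_trans _ _ (\sum_(0 <= k <oo) (kap * 2 ^- (m + k))%:E)%E).
  apply: lee_nneseries => [k _ _|k _]; first exact: integral_ge0.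
  apply: (@le_trans _ _ (\int[mu]_(h in F k) ((2 ^- (m + k))%:E * (kern h)%:E))%E).
    apply: ge0_le_integral => //.
    - exact: measurable_funTS.
    - apply: measurable_funTS; apply/measurable_EFinP; apply: measurable_funM => //.
      exact: measurable_kern.
    - move=> h /andP[_ hk]; rewrite -EFinM lee_fin ler_wpM2r ?kern_ge0//.
      exact: ltW.
  rewrite ge0_integralZl//.
  - by rewrite /F kern_dyadicE -EFinM mulrC.
  - apply/measurable_EFinP; apply: measurable_funTS; exact: measurable_kern.
  - by move=> h _; rewrite lee_fin kern_ge0.
apply: lime_le.
  by apply: is_cvg_nneseries => k _ _; rewrite lee_fin mulr_ge0 ?kap_ge0// invr_ge0 exprn_ge0.
apply: nearW => n; rewrite sumEFin lee_fin.
rewrite (_ : 2 * kap * 2 ^- m = kap * (2 * 2 ^- m)); last by ring.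
rewrite -mulr_sumr ler_wpM2l ?kap_ge0//.
suff : \sum_(0 <= k < n) (2 ^- (m + k) : R) = 2 * 2 ^- m - 2 * 2 ^- (m + n).
  by move=> ->; rewrite gerBl mulr_ge0// invr_ge0 exprn_ge0.
elim: n => [|n IHn]; first by rewrite big_geq// addn0 subrr.
rewrite big_nat_recr//= IHn addnS exprS invfM.
by rewrite mulrA mulfV// mul1r; ring.
Qed.

Lemma integrable_enorm_kern (f : 'rV[R]_N -> R) C : measurable_fun setT f ->
  (forall h, `|f h| <= C * enorm h) ->
  mu.-integrable (ann 0 1) (EFin \o (fun h => f h * kern h)).
Proof.
move=> mf fC.
have ie : mu.-integrable (ann 0 1) (EFin \o (fun h => C * (enorm h * kern h))).
  have : mu.-integrable (ann 0 1) (EFin \o (fun h => enorm h * kern h)).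
    apply/integrableP; split.
      apply/measurable_EFinP; apply: measurable_funTS; apply: measurable_funM.
        exact: measurable_enorm.
      exact: measurable_kern.
    under eq_integral do rewrite /= ger0_norm ?mulr_ge0 ?kern_ge0 ?enorm_ge0//.
    have := integral_enorm_kern_le 0; rewrite expr0 invr1 => /le_lt_trans; apply.
    exact: ltry.
  move=> /(integrableZl (measurable_ann _ _) C); apply: eq_integrable => //.
  exact: measurable_ann.
apply: le_integrable ie => //; first exact: measurable_ann.
  apply/measurable_EFinP; apply: measurable_funTS; apply: measurable_funM => //.
  exact: measurable_kern.
move=> h _ /=; rewrite lee_fin mulrA !normrM (ger0_norm (kern_ge0 _)).
apply: ler_wpM2r; first exact: kern_ge0.
by apply: le_trans (fC h) _; rewrite -normrM ler_norm.
Qed.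

Lemma Rintegral_enorm_kern_le m :
  \int[mu]_(h in ann 0 (2 ^- m)) (enorm h * kern h) <= 2 * kap * 2 ^- m.
Proof.
rewrite -lee_fin /Rintegral fineK; first exact: integral_enorm_kern_le.
rewrite ge0_fin_numE; first exact: le_lt_trans (integral_enorm_kern_le _) (ltry _).
by apply: integral_ge0 => h _; rewrite lee_fin mulr_ge0 ?kern_ge0 ?enorm_ge0.
Qed.

(** The vectors whose angle with [a] has a cosine below [2 ^ (- i) / |a|] in absolute value. *)
Definition slab a (i : nat) : set 'rV[R]_N := [set h | `|dotr a h| < 2 ^- i * enorm h].

Lemma measurable_dotr a : measurable_fun setT (dotr a).
Proof.
by apply: measurable_sum => i; apply: measurable_funM => //; exact: measurable_coord.
Qed.

Lemma measurable_slab a i : measurable (slab a i).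
Proof.
apply: measurable_lt_set; first by apply: measurableT_comp => //; exact: measurable_dotr.
by apply: measurable_funM => //; exact: measurable_enorm.
Qed.

(** In units of the radius of the shell, the slab has thickness proportional to
    [2 ^ (- i)]; hence the sum over [i] stays bounded. *)
Lemma Rintegral_slab_le a k i : a != 0 ->
  \int[mu]_(h in ann (2 ^- k.+1) (2 ^- k)) (\1_(slab a i) h * kern h) <=
  8 ^+ N * 4 / enorm a * 2 ^- i.
Proof.
move=> a0; have an0 : 0 < enorm a by rewrite enorm_gt0.
set s : R := 2 ^- k; have s0 : 0 < s by rewrite invr_gt0 exprn_gt0.
have i0 : 0 < 2 ^- i :> R by rewrite invr_gt0 exprn_gt0.
set D := ann _ _; have mD : measurable D by exact: measurable_ann.
pose c : R := (2 ^+ k.+1) ^+ N.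
have c0 : 0 <= c by rewrite !exprn_ge0.
have bnd : (\int[mu]_(h in D) (\1_(slab a i) h * kern h)%:E <=
    c%:E * mu (slab a i `&` D))%E.
  rewrite -integral_indic//; last exact: measurable_slab.
  rewrite -ge0_integralZl//; last first.
    by apply/measurable_EFinP; apply: measurable_funTS; apply: measurable_indic; exact: measurable_slab.
  apply: ge0_le_integral => //.
  - by move=> h _; rewrite lee_fin mulr_ge0 ?kern_ge0.
  - apply/measurable_EFinP; apply: measurable_funTS; apply: measurable_funM.
      by apply: measurable_indic; exact: measurable_slab.
    exact: measurable_kern.
  - apply/measurable_EFinP; apply: measurable_funTS; apply: measurable_funM => //.
    by apply: measurable_indic; exact: measurable_slab.
  - move=> h Dh; rewrite -EFinM lee_fin mulrC ler_wpM2r//.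
    have := kern_ann_le _ _ _ _ Dh; rewrite exprVn invrK; apply.
    by rewrite invr_gt0 exprn_gt0.
have : (c%:E * mu (slab a i `&` D) <= (8 ^+ N * 4 / enorm a * 2 ^- i)%:E)%E.
  apply: (@le_trans _ _ (c%:E * ((4 * s) ^+ N * (4 * (2 ^- i * s) / (enorm a * s)))%:E)%E).
    apply: lee_wpmul2l; first by rewrite lee_fin.
    have e0 : 0 < 2 ^- i * s by rewrite mulr_gt0.
    apply: le_trans (lebesgue_rV_slab_le a s _ a0 s0 e0).
    have mS : measurable [set h | enorm h < s /\ `|dotr a h| < 2 ^- i * s].
      apply: measurableI; apply: measurable_lt_set => //; first exact: measurable_enorm.
      by apply: measurableT_comp => //; exact: measurable_dotr.
    apply: le_measure; rewrite ?inE//; first by apply: measurableI => //; exact: measurable_slab.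
    move=> h [sl /andP[_ hs]]; split => //.
    by apply: lt_le_trans sl _; rewrite ler_pM2l// ltW.
  rewrite -EFinM lee_fin le_eqVlt; apply/orP; left; apply/eqP.
  have c8 : c * (4 * s) ^+ N = 8 ^+ N.
    by rewrite /c /s -exprMn; congr (_ ^+ _); rewrite exprS; field; rewrite expf_neq0.
  rewrite [LHS]mulrA c8; field; rewrite !gt_eqF// exprn_gt0.
move=> cb; rewrite -lee_fin /Rintegral fineK; first exact: le_trans bnd cb.
rewrite ge0_fin_numE; first exact: le_lt_trans (le_trans bnd cb) (ltry _).
by apply: integral_ge0 => h _; rewrite lee_fin mulr_ge0 ?kern_ge0.
Qed.

End KernelIntegrals.

(** * The profile: the square root of ell *)

Section Profile.
Context {R : realType}.
Implicit Types (r s t : R).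

Definition prof s : R := Num.sqrt (ell s).

Local Notation tenth := (10%:R^-1 : R).

Lemma ell_le0 s : s <= 0 -> ell s = 0.
Proof.
move=> s0; rewrite /ell; case: ifPn => // sn0.
rewrite min_l; last by apply: le_trans s0 _; rewrite invr_ge0.
by rewrite ln0// normr0 invr0 mulr0.
Qed.

Lemma ln_tenth : ln tenth <= -1.
Proof.
have e1 : 2^-1 <= expR (- 2^-1) :> R.
  by have := expR_ge1Dx (- 2^-1 : R); apply: le_trans; lra.
rewrite -(expRK (-1 : R)) ler_ln ?posrE ?expR_gt0 ?invr_gt0//.
rewrite (_ : -1 = - 2^-1 - 2^-1 :> R); last by lra.
rewrite expRD; have := ler_pM _ _ e1 e1; rewrite !invr_ge0.
move=> /(_ (ler0n _ _) (ler0n _ _)); apply: le_trans; lra.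
Qed.

Lemma ell_gt0E s : 0 < s -> ell s = (- ln (Num.min s tenth))^-1.
Proof.
move=> s0; rewrite /ell gt_eqF// div1r ltr0_norm//.
apply: le_lt_trans (_ : ln tenth < 0); last by have := ln_tenth; lra.
by rewrite ler_ln ?posrE ?lt_min ?s0 ?invr_gt0//= ge_min lexx orbT.
Qed.

Lemma ge1_lnmin s : 0 < s -> 1 <= - ln (Num.min s tenth).
Proof.
move=> s0; rewrite lerNr; apply: le_trans (ln_tenth).
by rewrite ler_ln ?posrE ?lt_min ?s0 ?invr_gt0//= ge_min lexx orbT.
Qed.

Lemma prof_le0 s : s <= 0 -> prof s = 0.
Proof. by move=> s0; rewrite /prof ell_le0// sqrtr0. Qed.

Lemma prof_ge0 s : 0 <= prof s.
Proof. exact: sqrtr_ge0. Qed.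

Lemma prof_gt0E s : 0 < s -> prof s = (Num.sqrt (- ln (Num.min s tenth)))^-1.
Proof.
by move=> s0; rewrite /prof ell_gt0E// sqrtrV// (le_trans ler01)// ge1_lnmin.
Qed.

Lemma prof_gt0 s : 0 < s -> 0 < prof s.
Proof.
by move=> s0; rewrite prof_gt0E// invr_gt0 sqrtr_gt0 (lt_le_trans ltr01)// ge1_lnmin.
Qed.

Lemma prof_le1 s : prof s <= 1.
Proof.
have [s0|s0] := leP s 0; first by rewrite prof_le0.
have A1 := ge1_lnmin _ s0; rewrite prof_gt0E// invf_le1; last by rewrite sqrtr_gt0; lra.
by rewrite -[leLHS]sqrtr1; exact: ler_wsqrtr.
Qed.

Lemma prof_homo r s : r <= s -> prof r <= prof s.
Proof.
move=> rs; have [r0|r0] := leP r 0; first by rewrite (prof_le0 _ r0) prof_ge0.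
have s0 := lt_le_trans r0 rs.
have A1 := ge1_lnmin _ r0; have B1 := ge1_lnmin _ s0.
rewrite !prof_gt0E// lef_pV2 ?posrE ?sqrtr_gt0; [|lra|lra].
apply: ler_wsqrtr; rewrite lerN2 ler_ln ?posrE ?lt_min ?r0 ?s0 ?invr_gt0//=.
by rewrite le_min !ge_min rs lexx orbT.
Qed.

(** The derivative of [t |-> t^(-1/2)] is monotone, so the increment of [prof]
    is controlled by the slope at the larger argument. *)
Lemma prof_sub_le s r : 0 < s -> s <= r -> r <= tenth ->
  prof r - prof s <= prof r ^+ 3 * (ln (r / s) / 2).
Proof.
move=> s0 sr r1; have r0 := lt_le_trans s0 sr.
have A1 := ge1_lnmin _ r0; have B1 := ge1_lnmin _ s0.
rewrite !prof_gt0E// ln_div ?posrE// !(min_l r1) !(min_l (le_trans sr r1)) in A1 B1 *.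
have AB : - ln r <= - ln s by rewrite lerN2 ler_ln.
set A := - ln r in A1 AB *; set B := - ln s in B1 AB *.
rewrite (_ : ln r - ln s = B - A); last by rewrite /A /B; ring.
have p0 : 0 < Num.sqrt A by rewrite sqrtr_gt0; lra.
have q0 : 0 < Num.sqrt B by rewrite sqrtr_gt0; lra.
have pq : Num.sqrt A <= Num.sqrt B by rewrite ler_wsqrtr.
rewrite -[X in _ * ((_ - X) / _)](@sqr_sqrtr _ A); last by lra.
rewrite -[X in _ * ((X - _) / _)](@sqr_sqrtr _ B); last by lra.
set p := Num.sqrt A in p0 pq *; set q := Num.sqrt B in q0 pq *.
rewrite -subr_ge0 (_ : _ - _ = (q - p) * ((q + p) * q - 2 * p ^+ 2) / (2 * p ^+ 3 * q)).
  by apply: divr_ge0; [apply: mulr_ge0; nra|rewrite !mulr_ge0 ?exprn_ge0// ltW].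
by field; rewrite !gt_eqF.
Qed.

(** The logarithm has slope at most [1 / s] beyond [s], and [prof ^ 3 <= 1]. *)
Lemma prof_lip s r : 0 < s -> s <= r -> prof r - prof s <= (r - s) / s.
Proof.
move=> s0 sr; have r0 := lt_le_trans s0 sr.
have minE t : prof (Num.min t tenth) = prof t.
  have [t0|t0] := leP t 0; first by rewrite min_l// (le_trans t0)// invr_ge0.
  by rewrite !prof_gt0E ?lt_min ?t0 ?invr_gt0//= -minA minxx.
have [s1|s1] := leP s tenth; last first.
  have r1 := lt_le_trans s1 sr.
  rewrite -(minE r) -(minE s) (min_r (ltW s1)) (min_r (ltW r1)) subrr.
  by rewrite divr_ge0 ?subr_ge0// ltW.
set r' := Num.min r tenth.
have sr' : s <= r' by rewrite le_min sr.
rewrite -(minE r); apply: le_trans (prof_sub_le _ _ s0 sr' _) _; first by rewrite ge_min lexx orbT.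
have l0 : 0 <= ln (r' / s) by rewrite ln_ge0// ler_pdivlMr// mul1r.
apply: (@le_trans _ _ (ln (r' / s))).
  apply: (@le_trans _ _ (1 * (ln (r' / s) / 2))); last by lra.
  apply: ler_wpM2r; first by lra.
  by rewrite exprn_ile1// ?prof_ge0 ?prof_le1.
have -> : r' / s = 1 + (r' - s) / s by field; rewrite gt_eqF.
apply: le_trans (le_ln1Dx _) _.
  by rewrite (lt_le_trans (ltrN10 _))// divr_ge0 ?subr_ge0// ltW.
by rewrite ler_pM2r ?invr_gt0// lerD2r ge_min lexx.
Qed.

Lemma normr_prof_sub_le s r t : 0 < t -> t <= s -> t <= r ->
  `|prof r - prof s| <= `|r - s| / t.
Proof.
move=> t0; wlog sr : s r / s <= r.
  move=> H ts tr; have [sr|/ltW rs] := leP s r; first exact: H.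
  by rewrite distrC (distrC r); exact: H.
move=> ts tr; rewrite !ger0_norm ?subr_ge0 ?prof_homo//.
have s0 := lt_le_trans t0 ts.
apply: le_trans (prof_lip _ _ s0 sr) _.
by rewrite ler_wpM2l ?subr_ge0// lef_pV2.
Qed.

Lemma prof_dyadicE k : (4 <= k)%N -> prof (2 ^- k) = (Num.sqrt (k%:R * ln 2))^-1.
Proof.
move=> k4; rewrite prof_gt0E ?invr_gt0 ?exprn_gt0// min_l; last first.
  rewrite lef_pV2 ?posrE ?exprn_gt0//.
  by rewrite (@le_trans _ _ (2 ^+ 4))//; [rewrite -natrX ler_nat|rewrite ler_weXn2l// ler1n].
by rewrite lnV ?posrE ?exprn_gt0// opprK lnXn// mulr_natl.
Qed.

(** Squaring the argument doubles its logarithm. Thus [t ^ 2], the order of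
    [r ^ 2 - |x - y| ^ 2] that is guaranteed at depth [t], serves as well as
    [t] up to a constant. *)
Lemma prof_sqr t : 0 < t -> t <= tenth -> prof (t ^+ 2) = prof t / Num.sqrt 2.
Proof.
move=> t0 t1; have t2 : t ^+ 2 <= tenth by nra.
rewrite !prof_gt0E ?exprn_gt0// !min_l// lnXn// -mulNrn -[_ *+ 2]mulr_natl.
by rewrite sqrtrM// invfM mulrC.
Qed.

Lemma continuous_prof : continuous prof.
Proof.
move=> t; apply: (iffRL (@cvgrPdist_lt _ _ _ (nbhs t) _ prof (prof t))) => e e0.
have [t0|t0|->] := ltgtP t 0.
- near=> s; rewrite !prof_le0 ?subrr ?normr0 ?ltW//.
  by near: s; exact: lt_nbhsl.
- have t20 : 0 < t / 2 by rewrite divr_gt0.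
  have h0 : 0 < e * (t / 2) by rewrite mulr_gt0.
  near=> s.
  have s2 : t / 2 <= s by apply/ltW; near: s; apply: lt_nbhsr; lra.
  apply: le_lt_trans (normr_prof_sub_le s t (t / 2) t20 s2 _) _; first by lra.
  rewrite ltr_pdivrMr//; near: s.
rewrite prof_le0//.
pose d : R := Num.min tenth (expR (- (e ^+ 2)^-1)).
have d0 : 0 < d by rewrite lt_min expR_gt0 andbT invr_gt0.
near=> s; rewrite sub0r normrN ger0_norm ?prof_ge0//.
have [s0|s0] := leP s 0; first by rewrite prof_le0.
have sd : s < d by near: s; apply: lt_nbhsl.
have s1 : s <= tenth by rewrite (ltW (lt_le_trans sd _))// ge_min lexx.
have se : s < expR (- (e ^+ 2)^-1) by rewrite (lt_le_trans sd)// ge_min lexx orbT.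
rewrite prof_gt0E// min_l//.
rewrite -[ltRHS]invrK ltf_pV2 ?posrE ?invr_gt0//; last first.
  by rewrite sqrtr_gt0 -(min_l s1) (lt_le_trans ltr01)// ge1_lnmin.
rewrite -(@ltr_pXn2r _ 2)// ?nnegrE ?invr_ge0 ?sqrtr_ge0 ?ltW//.
rewrite sqr_sqrtr; last by rewrite -(min_l s1) (le_trans ler01)// ge1_lnmin.
by rewrite exprVn ltrNr -[ltRHS]expRK ltr_ln// ?posrE// expR_gt0.
Unshelve. all: by end_near.
Qed.

End Profile.

(** * The barrier and its second differences *)

Section Barrier.
Context {R : realType} {N : nat}.
Local Notation mu := (@lebesgue_rV R N).
Local Notation kern := (@kern R N).
Local Notation ann := (@ann R N).
Local Notation kap := (@kap R N).
Implicit Types (x y z a b h : 'rV[R]_N) (r s t : R).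

Definition barrier y r x : R := prof (r ^+ 2 - enorm (x - y) ^+ 2).

Definition sdiff (f : 'rV[R]_N -> R) z h : R := 2 * f z - f (z + h) - f (z - h).

Lemma barrier_ge0 y r x : 0 <= barrier y r x.
Proof. exact: prof_ge0. Qed.

Lemma barrier_le1 y r x : barrier y r x <= 1.
Proof. exact: prof_le1. Qed.

Lemma barrier_out y r x : 0 <= r -> r <= enorm (x - y) -> barrier y r x = 0.
Proof.
by move=> r0 rx; rewrite /barrier prof_le0// subr_le0 lerXn2r ?nnegrE ?enorm_ge0.
Qed.

Lemma continuous_barrier y r : continuous (barrier y r).
Proof.
move=> x; apply: continuous_comp; last exact: continuous_prof.
apply: continuousB; first exact: cst_continuous.
have ce : {for x, continuous (fun x : 'rV[R]_N => enorm (x - y))}.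
  apply: continuous_comp; last exact: continuous_enorm.
  by apply: continuousB; [exact: id|exact: cst_continuous].
by rewrite (_ : (fun _ => _) = (fun x => enorm (x - y) * enorm (x - y)))//; exact: continuousM.
Qed.

Lemma barrierD y r z h : barrier y r (z + h) =
  prof (r ^+ 2 - enorm (z - y) ^+ 2 - 2 * dotr (z - y) h - enorm h ^+ 2).
Proof. by rewrite /barrier addrAC (sqr_enormD (z - y)); congr prof; ring. Qed.

Lemma barrierN y r z h : barrier y r (z - h) =
  prof (r ^+ 2 - enorm (z - y) ^+ 2 + 2 * dotr (z - y) h - enorm h ^+ 2).
Proof. by rewrite barrierD dotrNr enormN; congr prof; ring. Qed.

Lemma measurable_sdiff (f : 'rV[R]_N -> R) z :
  measurable_fun setT f -> measurable_fun setT (sdiff f z).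
Proof.
move=> mf; apply: measurable_funB; [apply: measurable_funB => //|].
  rewrite (_ : (fun _ => _) = f \o (fun h => 1 *: h + z)).
    by apply: measurableT_comp => //; exact: measurable_affine_rV.
  by apply/funext => h /=; rewrite scale1r addrC.
rewrite (_ : (fun _ => _) = f \o (fun h => (-1) *: h + z)).
  by apply: measurableT_comp => //; exact: measurable_affine_rV.
by apply/funext => h /=; rewrite scaleN1r addrC.
Qed.

(** With [t] for [r ^ 2 - |z - y| ^ 2], the argument of [prof] stays above
    [t / 2] when [|h| <= t / 2]; for larger [h] the bound by 2 suffices. *)
Lemma normr_sdiff_barrier_le y r z h : 0 < r -> r <= 4^-1 -> enorm (z - y) < r ->
  `|sdiff (barrier y r) z h| <= 4 / (r ^+ 2 - enorm (z - y) ^+ 2) * enorm h.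
Proof.
move=> r0 r4 zr; set t := r ^+ 2 - _.
have n0 := enorm_ge0 (z - y); have h0 := enorm_ge0 h.
have t0 : 0 < t by rewrite subr_gt0 ltrXn2r// ?nnegrE ?(ltW r0).
have t1 : t <= 16^-1 by rewrite /t; nra.
have [ht|ht] := leP (enorm h) (t / 2); last first.
  apply: (@le_trans _ _ 2).
    rewrite ler_norml /sdiff.
    move: (barrier_ge0 y r z) (barrier_ge0 y r (z + h)) (barrier_ge0 y r (z - h)).
    move: (barrier_le1 y r z) (barrier_le1 y r (z + h)) (barrier_le1 y r (z - h)).
    move: (barrier y r z) (barrier y r (z + h)) (barrier y r (z - h)) => a b c.
    by move=> *; apply/andP; split; lra.
  by rewrite mulrAC ler_pdivlMr//; clear -ht; lra.
have d := normr_dotr_le (z - y) h.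
have dr : `|dotr (z - y) h| <= r * enorm h.
  by apply: le_trans d _; apply: ler_wpM2r => //; exact: ltW.
move: dr; rewrite ler_norml => /andP[d1 d2].
have bd (q : R) : - enorm h <= q <= enorm h -> `|prof (t + q) - prof t| <= 2 / t * enorm h.
  move=> /andP[q1 q2].
  apply: le_trans (normr_prof_sub_le t (t + q) (t / 2) _ _ _) _; [lra|lra|lra|].
  rewrite (_ : t + q - t = q); last by ring.
  rewrite (_ : 2 / t * enorm h = enorm h / (t / 2)); last by field; rewrite gt_eqF.
  by rewrite ler_pM2r ?invr_gt0 ?divr_gt0// ler_norml q1.
have b1 := bd (- 2 * dotr (z - y) h - enorm h ^+ 2).
have b2 := bd (2 * dotr (z - y) h - enorm h ^+ 2).
rewrite /sdiff barrierD barrierN /barrier -/t.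
rewrite (_ : t - 2 * dotr (z - y) h - enorm h ^+ 2 =
  t + (- 2 * dotr (z - y) h - enorm h ^+ 2)); last by ring.
rewrite (_ : t + 2 * dotr (z - y) h - enorm h ^+ 2 =
  t + (2 * dotr (z - y) h - enorm h ^+ 2)); last by ring.
have {}b1 : `|prof (t + (- 2 * dotr (z - y) h - enorm h ^+ 2)) - prof t| <= 2 / t * enorm h.
  by apply: b1; apply/andP; split; nra.
have {}b2 : `|prof (t + (2 * dotr (z - y) h - enorm h ^+ 2)) - prof t| <= 2 / t * enorm h.
  by apply: b2; apply/andP; split; nra.
have e4 : 4 / t * enorm h = 2 / t * enorm h + 2 / t * enorm h by rewrite -mulrDl -mulrDl -natrD.
move: b1 b2; rewrite e4 !ler_norml => /andP[b11 b12] /andP[b21 b22].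
by apply/andP; split; lra.
Qed.

Lemma integrable_sdiff_barrier y r z : 0 < r -> r <= 4^-1 -> enorm (z - y) < r ->
  mu.-integrable (ann 0 1) (EFin \o (fun h => sdiff (barrier y r) z h * kern h)).
Proof.
move=> r0 r4 zr.
apply: (integrable_enorm_kern _ (4 / (r ^+ 2 - enorm (z - y) ^+ 2))).
  by apply: measurable_sdiff; apply: continuous_measurable_rV; exact: continuous_barrier.
by move=> h; exact: normr_sdiff_barrier_le.
Qed.

(** Of the two points [z + h] and [z - h] one lies on the inner side, where the
    argument of [prof] is at least [`|dotr (z - y) h|]; replacing it by the
    length of [h] costs the logarithm of the cosine of an angle, which is
    counted by the slabs containing [h]. *)
Lemma sdiff_barrier_shell_le y r z h k : 0 < r -> r <= 4^-1 -> enorm (z - y) < r ->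
  (4 <= k)%N -> ann (2 ^- k.+1) (2 ^- k) h ->
  sdiff (barrier y r) z h <= 2 * barrier y r z - prof (2 ^- k.+1) +
    (prof (2 ^- k) ^+ 3 * (\sum_(i < k) \1_(slab (z - y) i) h)
     + \1_(slab (z - y) k) h).
Proof.
move=> r0 r4 zr k4 /andP[hk1 hk2].
have p0 i : 0 < 2 ^- i :> R by rewrite invr_gt0 exprn_gt0.
have half_le i j : (i <= j)%N -> (2 ^- j : R) <= 2 ^- i.
  by move=> ij; rewrite lef_pV2 ?posrE ?exprn_gt0// ler_weXn2l// ler1n.
have hgt0 : 0 < enorm h by exact: lt_le_trans hk1.
have zy0 := enorm_ge0 (z - y).
have t0 : 0 < r ^+ 2 - enorm (z - y) ^+ 2 by rewrite subr_gt0 ltrXn2r// ?nnegrE ?(ltW r0).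
have S0 : 0 <= prof (2 ^- k : R) ^+ 3 * (\sum_(i < k) \1_(slab (z - y) i) h).
  by rewrite mulr_ge0 ?exprn_ge0 ?prof_ge0// sumr_ge0.
have [sk|sk] := pselect (slab (z - y) k h).
  rewrite [\1_(slab _ k) h]indicE mem_set//.
  have p1 := prof_le1 (2 ^- k.+1 : R).
  have bp := barrier_ge0 y r (z + h); have bm := barrier_ge0 y r (z - h).
  by rewrite /sdiff/=; clear -S0 p1 bp bm; lra.
rewrite [\1_(slab _ k) h]indicE memNset// addr0.
pose q := `|dotr (z - y) h|.
have mx : sdiff (barrier y r) z h <= 2 * barrier y r z - prof q.
  have qh : enorm h ^+ 2 <= q.
    move/negP: sk; rewrite -leNgt; apply: le_trans.
    by rewrite expr2 ler_pM2r// ltW.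
  have [dp|dn] := leP 0 (dotr (z - y) h).
    have : prof q <= barrier y r (z - h).
      by rewrite barrierN; apply: prof_homo; rewrite /q ger0_norm// in qh *; lra.
    by have b0 := barrier_ge0 y r (z + h); rewrite /sdiff => pq; clear -b0 pq; lra.
  have : prof q <= barrier y r (z + h).
    by rewrite barrierD; apply: prof_homo; rewrite /q ltr0_norm// in qh *; lra.
  by have b0 := barrier_ge0 y r (z - h); rewrite /sdiff => pq; clear -b0 pq; lra.
apply: le_trans mx _; rewrite -addrA lerD2l lerNl opprD opprK.
(* [n] is the first slab that misses [h]; the [n] slabs before it contain [h]
   and count the halvings from the length of [h] down to [q] *)
have ex : exists n, `[< ~ slab (z - y) n h >] by exists k; apply/asboolP.
have [n /asboolP Nn minn] := ex_minnP ex.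
have nk : (n <= k)%N by apply: minn; apply/asboolP.
have sl i : (i < n)%N -> \1_(slab (z - y) i) h = 1 :> R.
  move=> i_n; rewrite indicE mem_set//; apply: contrapT => /asboolP/minn.
  by rewrite leqNgt i_n.
have Sn : n%:R <= \sum_(i < k) (\1_(slab (z - y) i) h : R).
  rewrite -(subnKC nk) big_split_ord/=; apply: ler_wpDr; first exact: sumr_ge0.
  rewrite -[X in X%:R]card_ord -sumr_const; apply: ler_sum => i _ /=.
  by rewrite sl.
have qn : 2 ^- n * 2 ^- k.+1 <= q.
  move/negP: Nn; rewrite -leNgt; apply: le_trans.
  by rewrite ler_pM2l.
have s0 : 0 < 2 ^- n * 2 ^- k.+1 :> R by rewrite mulr_gt0.
have sr : 2 ^- n * 2 ^- k.+1 <= 2 ^- k.+1 :> R.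
  by rewrite ler_piMl ?(ltW (p0 _))// invf_le1 ?exprn_gt0// exprn_ege1// ler1n.
have r1 : 2 ^- k.+1 <= 10%:R^-1 :> R.
  apply: le_trans (half_le 4%N k.+1 _) _; first exact: leq_trans k4 _.
  by rewrite lef_pV2 ?posrE// -natrX ler_nat.
have H := prof_sub_le _ _ s0 sr r1.
have P := prof_homo _ _ qn.
suff : prof (2 ^- k.+1) ^+ 3 * (ln (2 ^- k.+1 / (2 ^- n * 2 ^- k.+1)) / 2) <=
   prof (2 ^- k) ^+ 3 * \sum_(i < k) (\1_(slab (z - y) i) h : R).
  by lra.
apply: ler_pM.
- by rewrite exprn_ge0// prof_ge0.
- rewrite divr_ge0// ln_ge0// ler_pdivlMr// mul1r//.
- by rewrite lerXn2r ?nnegrE ?prof_ge0//; apply: prof_homo; exact: half_le.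
- apply: le_trans Sn.
  rewrite (_ : 2 ^- k.+1 / (2 ^- n * 2 ^- k.+1) = 2 ^+ n); last first.
    by field; rewrite !expf_neq0.
  rewrite lnXn// -[ln 2 *+ n]mulr_natl -mulrA -[leRHS]mulr1 ler_wpM2l//.
  have l2 : ln (1 + 1) <= 1 :> R by apply: le_ln1Dx; lra.
  by lra.
Qed.

End Barrier.

(** * The logarithmic Laplacian of the barrier is bounded above *)

Lemma ex_dyadic_le {R : realType} (x : R) : 0 < x -> exists M : nat, 2 ^- M <= x.
Proof.
move=> x0; exists (Num.truncn (x^-1)).+1.
rewrite -[leRHS]invrK lef_pV2 ?posrE ?exprn_gt0 ?invr_gt0//.
apply: ltW; apply: lt_le_trans (truncnS_gt _) _.
by rewrite -natrX ler_nat; exact/ltnW/ltn_expl.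
Qed.

Section BarrierBound.
Context {R : realType} {N : nat}.
Local Notation mu := (@lebesgue_rV R N).
Local Notation kern := (@kern R N).
Local Notation ann := (@ann R N).
Local Notation kap := (@kap R N).
Implicit Types (x y z a b h : 'rV[R]_N) (r s t : R).

Let half_gt0 i : 0 < 2 ^- i :> R. Proof. by rewrite invr_gt0 exprn_gt0. Qed.

Let half_le i j : (i <= j)%N -> (2 ^- j : R) <= 2 ^- i.
Proof. by move=> ij; rewrite lef_pV2 ?posrE ?exprn_gt0// ler_weXn2l// ler1n. Qed.

Lemma ann_sub r s r' s' : r' <= r -> s <= s' -> ann r s `<=` ann r' s'.
Proof. by move=> r'r ss' h /andP[h1 h2]; rewrite /ann/= (le_trans r'r)// (lt_le_trans h2). Qed.

Lemma ann_dyadic_sub1 k : ann (2 ^- k.+1) (2 ^- k) `<=` ann 0 1.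
Proof. by apply: ann_sub; [exact: ltW|rewrite -[leRHS]invr1; apply: (half_le 0)]. Qed.

Lemma Rintegral_ann_split (f : 'rV[R]_N -> R) r s t : r <= s -> s <= t ->
  mu.-integrable (ann r t) (EFin \o f) ->
  \int[mu]_(h in ann r t) f h = \int[mu]_(h in ann r s) f h + \int[mu]_(h in ann s t) f h.
Proof.
move=> rs st intf.
have E : ann r t = ann r s `|` ann s t.
  rewrite predeqE => h; split=> [/andP[h1 h2]|[/andP[h1 h2]|/andP[h1 h2]]].
  - have [hs|hs] := ltP (enorm h) s; [left|right]; apply/andP; split => //.
  - by apply/andP; split => //; exact: lt_le_trans h2 _.
  - by apply/andP; split => //; exact: le_trans h1.
rewrite E Rintegral_setU -?E//; try exact: measurable_ann.
apply/disj_setPS => h [/andP[_ h1] /andP[h2 _]].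
by have := le_lt_trans h2 h1; rewrite ltxx.
Qed.

Lemma Rintegral_dyadic_split (f : 'rV[R]_N -> R) n j :
  mu.-integrable (ann 0 1) (EFin \o f) ->
  \int[mu]_(h in ann 0 (2 ^- n)) f h = \int[mu]_(h in ann 0 (2 ^- (n + j))) f h +
    \sum_(n <= k < n + j) \int[mu]_(h in ann (2 ^- k.+1) (2 ^- k)) f h.
Proof.
move=> intf; elim: j => [|j IHj]; first by rewrite addn0 big_geq// addr0.
rewrite IHj addnS big_nat_recr ?leq_addr//=.
rewrite (@Rintegral_ann_split _ _ (2 ^- (n + j).+1) (2 ^- (n + j))); first by ring.
- exact: ltW.
- exact: half_le.
apply: integrableS intf; try exact: measurable_ann.
by apply: ann_sub => //; rewrite -[leRHS]invr1; apply: (half_le 0).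
Qed.

Lemma Rintegral_kern_outer n : \int[mu]_(h in ann (2 ^- n) 1) kern h = n%:R * kap.
Proof.
elim: n => [|n IHn].
  rewrite expr0 invr1 mul0r (_ : ann 1 1 = set0) ?Rintegral_set0//.
  by rewrite -subset0 => h /andP[h1 h2]; have := le_lt_trans h1 h2; rewrite ltxx.
rewrite (@Rintegral_ann_split _ _ (2 ^- n)); last 3 first.
  exact: half_le.
  by rewrite -[leRHS]invr1; apply: (half_le 0).
  exact: integrable_kern.
by rewrite IHn Rintegral_kern_dyadic -natr1; ring.
Qed.

Lemma sum_slab_integrable a k n :
  mu.-integrable (ann (2 ^- k.+1) (2 ^- k))
    (EFin \o (fun h => (\sum_(i < n) \1_(slab a i) h) * kern h)).
Proof.
apply: (integrable_kern_ann _ _ _ n%:R) => //.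
  apply: measurable_sum => i; apply: measurable_indic; exact: measurable_slab.
move=> h _; apply: le_trans (ler_norm_sum _ _ _) _.
rewrite -[X in X%:R]card_ord -sumr_const; apply: ler_sum => i _.
by rewrite ger0_norm// indicE; case: (_ \in _).
Qed.

Lemma slab_integrable a k i :
  mu.-integrable (ann (2 ^- k.+1) (2 ^- k))
    (EFin \o (fun h => \1_(slab a i) h * kern h)).
Proof.
apply: (integrable_kern_ann _ _ _ 1) => //.
  apply: measurable_indic; exact: measurable_slab.
by move=> h _; rewrite ger0_norm// indicE; case: (_ \in _).
Qed.

(** The series of the measures of the slabs is geometric. *)
Lemma Rintegral_sum_slab_le a k n : a != 0 ->
  \int[mu]_(h in ann (2 ^- k.+1) (2 ^- k)) ((\sum_(i < n) \1_(slab a i) h) * kern h)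
  <= 8 ^+ N * 4 / enorm a * (2 - 2 * 2 ^- n).
Proof.
move=> a0; elim: n => [|n IHn].
  rewrite expr0 invr1 mulr1 subrr mulr0.
  under eq_Rintegral do rewrite big_ord0 mul0r.
  by rewrite Rintegral_cst ?mul0r//; exact: measurable_ann.
under eq_Rintegral do rewrite big_ord_recr/= mulrDl.
rewrite RintegralD; last 3 first.
  exact: measurable_ann.
  exact: sum_slab_integrable.
  exact: slab_integrable.
apply: le_trans (lerD IHn (Rintegral_slab_le a k n a0)) _.
rewrite -mulrDr ler_wpM2l//.
  by rewrite divr_ge0 ?enorm_ge0// mulr_ge0// exprn_ge0.
by rewrite exprS invfM; lra.
Qed.

Lemma Rintegral_sdiff_shell_le y r z k : 0 < r -> r <= 4^-1 -> enorm (z - y) < r ->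
  z - y != 0 -> (4 <= k)%N ->
  \int[mu]_(h in ann (2 ^- k.+1) (2 ^- k)) (sdiff (barrier y r) z h * kern h) <=
  (2 * barrier y r z - prof (2 ^- k.+1)) * kap +
  8 ^+ N * 4 / enorm (z - y) * (2 * prof (2 ^- k) ^+ 3 + 2 ^- k).
Proof.
move=> r0 r4 zr zy k4; set D := ann _ _; set a := z - y.
have mD : measurable D by exact: measurable_ann.
set A := 2 * _ - _; set B := prof _ ^+ 3.
have i1 : mu.-integrable D (EFin \o (fun h => A * kern h)).
  apply: (integrable_kern_ann _ _ (cst A) `|A|) => //.
have i2 : mu.-integrable D (EFin \o (fun h => (\sum_(i < k) \1_(slab a i) h) * kern h)).
  exact: sum_slab_integrable.
have i2' : mu.-integrable D
    (EFin \o (fun h => B * ((\sum_(i < k) \1_(slab a i) h) * kern h))).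
  by have /(integrableZl mD B) := i2; apply: eq_integrable.
have i3 : mu.-integrable D (EFin \o (fun h => \1_(slab a k) h * kern h)).
  exact: slab_integrable.
have i4 : mu.-integrable D (EFin \o (fun h =>
     B * ((\sum_(i < k) \1_(slab a i) h) * kern h) + \1_(slab a k) h * kern h)).
  by have := integrableD mD i2' i3; apply: eq_integrable.
have i5 : mu.-integrable D (EFin \o (fun h => A * kern h +
     (B * ((\sum_(i < k) \1_(slab a i) h) * kern h) + \1_(slab a k) h * kern h))).
  by have := integrableD mD i1 i4; apply: eq_integrable.
apply: (@le_trans _ _ (\int[mu]_(h in D) (A * kern h +
     (B * ((\sum_(i < k) \1_(slab a i) h) * kern h) + \1_(slab a k) h * kern h)))).
  apply: le_Rintegral => //.
    apply: integrableS (integrable_sdiff_barrier y r z r0 r4 zr) => //.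
      exact: measurable_ann.
    exact: ann_dyadic_sub1.
  move=> h Dh; have := sdiff_barrier_shell_le y r z h k r0 r4 zr k4 Dh.
  rewrite -/a -/A -/B => /(ler_wpM2r (kern_ge0 h))/le_trans; apply.
  by rewrite le_eqVlt; apply/orP; left; apply/eqP; ring.
rewrite RintegralD// (RintegralD mD i2' i3) (RintegralZl B mD i2).
rewrite (RintegralZl A mD); last exact: integrable_kern.
rewrite Rintegral_kern_dyadic lerD2l mulrDr.
have c0 : 0 <= 8 ^+ N * 4 / enorm a.
  by rewrite divr_ge0 ?enorm_ge0// mulr_ge0// exprn_ge0.
apply: lerD; last exact: Rintegral_slab_le.
rewrite mulrCA mulrA; apply: (@le_trans _ _ (B * (8 ^+ N * 4 / enorm a * 2))); last first.
  by rewrite le_eqVlt; apply/orP; left; apply/eqP; ring.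
apply: ler_wpM2l; first by rewrite exprn_ge0// prof_ge0.
apply: le_trans (Rintegral_sum_slab_le _ _ _ zy) _.
by apply: ler_wpM2l => //; have := half_gt0 k; lra.
Qed.

Let sg (n : nat) : R := Num.sqrt n%:R.
Let lam : R := (Num.sqrt (ln 2))^-1.

Let sg_gt0 n : (0 < n)%N -> 0 < sg n.
Proof. by move=> n0; rewrite sqrtr_gt0 ltr0n. Qed.

Let sg_sqr n : sg n ^+ 2 = n%:R.
Proof. by rewrite sqr_sqrtr. Qed.

Let lam_ge0 : 0 <= lam. Proof. by rewrite invr_ge0 sqrtr_ge0. Qed.

Let prof_sg k : (4 <= k)%N -> prof (2 ^- k) = lam / sg k.
Proof. by move=> k4; rewrite prof_dyadicE// sqrtrM// invfM mulrC. Qed.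

Let sg_le i j : (i <= j)%N -> sg i <= sg j.
Proof. by move=> ij; apply: ler_wsqrtr; rewrite ler_nat. Qed.

(** The cancellation that singles out the exponent one half: on each shell the
    positive term is [2 * prof t], while the sum of [prof (2 ^- k)] over the
    shells down to scale [t] is twice [prof t] times their number, because the
    partial sums of [1 / sqrt k] grow like [2 * sqrt n]. *)
Lemma sum_shell_le (w c : R) n j : 0 <= c -> (4 <= n)%N ->
  \sum_(n <= k < n + j) ((2 * w - prof (2 ^- k.+1)) * kap +
    c * (2 * prof (2 ^- k) ^+ 3 + 2 ^- k)) <=
  2 * w * kap * j%:R - 2 * lam * kap * (sg (n + j).+1 - sg n.+1) +
  c * (4 * lam ^+ 3 * ((sg n.-1)^-1 - (sg (n + j).-1)^-1) + (2 * 2 ^- n - 2 * 2 ^- (n + j))).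
Proof.
move=> c0 n4; elim: j => [|j IHj].
  by rewrite addn0 big_geq// !subrr !mulr0 subrr addr0 mulr0 add0r.
rewrite addnS big_nat_recr ?leq_addr//=.
apply: le_trans (lerD IHj (lexx _)) _.
set k := (n + j)%N; have k4 : (4 <= k)%N by rewrite (leq_trans n4)// leq_addr.
have k0 : (0 < k)%N by exact: leq_trans k4.
rewrite (prof_sg k.+1) ?(leq_trans k4)// prof_sg// -[j.+1%:R]natr1.
have s1 := sg_gt0 k.+1 isT; have s2 := sg_gt0 k.+2 isT.
have sk := sg_gt0 k k0.
have sk1 : 0 < sg k.-1 by apply: sg_gt0; rewrite -ltnS prednK// (leq_trans _ k4).
have q1 : sg k.+1 ^+ 2 = k%:R + 1 by rewrite sg_sqr -natr1.
have q2 : sg k.+2 ^+ 2 = k%:R + 2 by rewrite sg_sqr -natr1 -natr1; ring.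
have q3 : sg k.-1 ^+ 2 = k%:R - 1 by rewrite sg_sqr -{2}(prednK k0) -natr1 addrK.
have q0 : sg k ^+ 2 = k%:R by rewrite sg_sqr.
have l1 := sg_le k.-1 k (leq_pred _).
have l2 := sg_le k.+1 k.+2 (leqnSn _).
have N1 : 2 * (sg k.+2 - sg k.+1) <= (sg k.+1)^-1.
  by rewrite -[leRHS]div1r ler_pdivlMr//; nra.
have N2 : (sg k)^-1 ^+ 3 <= 2 * ((sg k.-1)^-1 - (sg k)^-1).
  rewrite -subr_ge0 (_ : _ - _ =
     (2 * (sg k - sg k.-1) * sg k ^+ 2 - sg k.-1) / (sg k.-1 * sg k ^+ 3)); last first.
    by field; rewrite !gt_eqF.
  apply: divr_ge0; last by rewrite mulr_ge0 ?exprn_ge0// ltW.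
  have d1 : (sg k - sg k.-1) * (sg k + sg k.-1) = 1.
    by rewrite -[X in _ = X](_ : sg k ^+ 2 - sg k.-1 ^+ 2 = 1); [ring|lra].
  have d2 : 1 <= (sg k - sg k.-1) * (2 * sg k) by nra.
  by nra.
have K0 := @kap_ge0 R N.
have H1 : 0 <= lam * kap * ((sg k.+1)^-1 - 2 * (sg k.+2 - sg k.+1)).
  by rewrite !mulr_ge0// subr_ge0.
have H2 : 0 <= c * (2 * lam ^+ 3 * (2 * ((sg k.-1)^-1 - (sg k)^-1) - (sg k)^-1 ^+ 3)).
  by rewrite !mulr_ge0 ?exprn_ge0// subr_ge0.
have E1 : 2 ^- k = 2 * 2 ^- k.+1 :> R by rewrite exprS invfM mulrA mulfV// mul1r.
rewrite -subr_ge0; apply: le_trans (addr_ge0 H1 H2) _.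
rewrite le_eqVlt; apply/orP; left; apply/eqP.
rewrite !E1 [(lam / _) ^+ 3]exprMn /=.
set x1 := (sg k.+1)^-1; set x2 := (sg k)^-1; set x3 := (sg k.-1)^-1; set x4 := (sg n.-1)^-1.
by ring.
Qed.

(** Uniformity in the radius matters: the comparison is made on balls slightly
    smaller than the tangent one. *)
Lemma barrier_bound n r0 : 0 < r0 -> r0 <= 4^-1 -> (4 <= n)%N ->
  exists2 C : R, 0 <= C & forall y r z, r0 / 2 <= r -> r <= r0 -> enorm (z - y) < r ->
    \int[mu]_(h in ann 0 (2 ^- n)) (sdiff (barrier y r) z h * kern h) <= C.
Proof.
move=> r00 r04 n4.
(* points with [t >= t0] see finitely many shells, in a number that depends on
   [r0] only; the others are away from the centre of the ball, where the slabs
   have a normal of definite length *)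
pose t0 := r0 ^+ 2 / 8.
have t00 : 0 < t0 by rewrite divr_gt0// exprn_gt0.
have [M0 M0P] := ex_dyadic_le _ (divr_gt0 t00 (ltr0Sn R 1)).
pose c := 8 ^+ N * 4 / (r0 / 8) : R.
have c0 : 0 <= c by rewrite divr_ge0 ?divr_ge0 ?(ltW r00)// mulr_ge0// exprn_ge0.
have K0 := @kap_ge0 R N.
pose CA := 2 * kap * lam * (1 + sg n.+1) + c * (4 * lam ^+ 3 + 2).
have CA0 : 0 <= CA.
  have s1 := sg_gt0 n.+1 isT.
  apply: addr_ge0; apply: mulr_ge0 => //; first by rewrite !mulr_ge0.
    by rewrite addr_ge0// ltW.
  by rewrite addr_ge0// mulr_ge0// exprn_ge0.
exists (4 * kap + CA + 2 * kap * M0%:R).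
  by apply: addr_ge0; [apply: addr_ge0 => //|]; rewrite !mulr_ge0.
move=> y r z r1 r2 zr.
have r_gt0 : 0 < r by lra.
have r4 : r <= 4^-1 by lra.
have zy0 := enorm_ge0 (z - y).
set t := r ^+ 2 - enorm (z - y) ^+ 2.
have tpos : 0 < t by rewrite subr_gt0 ltrXn2r// ?nnegrE ?(ltW r_gt0).
have intf := integrable_sdiff_barrier y r z r_gt0 r4 zr.
have mann := @measurable_ann R N.
(* on the ball of radius t / 2 the barrier is Lipschitz with constant 2 / t *)
have inner M : 2 ^- M <= t / 2 ->
    \int[mu]_(h in ann 0 (2 ^- M)) (sdiff (barrier y r) z h * kern h) <= 4 * kap.
  move=> Mt; have sub1 : ann 0 (2 ^- M) `<=` ann 0 1.
    by apply: ann_sub => //; rewrite -[leRHS]invr1; apply: (half_le 0).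
  have ie : mu.-integrable (ann 0 (2 ^- M)) (EFin \o (fun h => enorm h * kern h)).
    apply: integrableS sub1 _; try exact: mann.
    apply: (integrable_enorm_kern _ 1); first exact: measurable_enorm.
    by move=> h; rewrite mul1r ger0_norm// enorm_ge0.
  apply: (@le_trans _ _ (\int[mu]_(h in ann 0 (2 ^- M)) (4 / t * (enorm h * kern h)))).
    apply: le_Rintegral => //.
    - by apply: integrableS sub1 intf; exact: mann.
    - by have /(integrableZl (mann _ _) (4 / t)) := ie; apply: eq_integrable => //; exact: mann.
    - move=> h _; rewrite mulrA; apply: ler_wpM2r; first exact: kern_ge0.
      exact: le_trans (ler_norm _) (normr_sdiff_barrier_le _ _ _ _ r_gt0 r4 zr).
  rewrite RintegralZl//; apply: (@le_trans _ _ (4 / t * (2 * kap * (t / 2)))).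
    rewrite ler_wpM2l ?divr_ge0 ?(ltW tpos)//.
    by apply: le_trans (Rintegral_enorm_kern_le _) _; rewrite ler_wpM2l// mulr_ge0.
  by rewrite le_eqVlt; apply/orP; left; apply/eqP; field; rewrite gt_eqF.
have pos1 : 0 <= 2 * kap * M0%:R by rewrite !mulr_ge0.
have small M : (M <= n)%N -> 2 ^- M <= t / 2 ->
    \int[mu]_(h in ann 0 (2 ^- n)) (sdiff (barrier y r) z h * kern h) <= 4 * kap.
  by move=> Mn Mt; apply: inner; apply: le_trans Mt; exact: half_le.
have [tt0|tt0] := leP t0 t.
  have Mt : 2 ^- M0 <= t / 2 by apply: le_trans M0P _; lra.
  have [Mn|/ltnW nM] := leqP M0 n; first by have := small _ Mn Mt; lra.
  rewrite (Rintegral_dyadic_split _ n (M0 - n))// subnKC//.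
  have : \sum_(n <= k < M0) \int[mu]_(h in ann (2 ^- k.+1) (2 ^- k))
      (sdiff (barrier y r) z h * kern h) <= 2 * kap * M0%:R.
    apply: (@le_trans _ _ (\sum_(n <= k < M0) (2 * kap))).
      apply: ler_sum => k _.
      have ik : mu.-integrable (ann (2 ^- k.+1) (2 ^- k)) (EFin \o kern).
        exact: integrable_kern.
      rewrite -(Rintegral_kern_dyadic k) -RintegralZl//.
      apply: le_Rintegral => //.
      - by apply: integrableS (ann_dyadic_sub1 k) intf; exact: mann.
      - by have /(integrableZl (mann _ _) 2) := ik; apply: eq_integrable => //; exact: mann.
      - move=> h _; apply: ler_wpM2r; first exact: kern_ge0.
        have := barrier_ge0 y r (z + h); have := barrier_ge0 y r (z - h).
        by have := barrier_le1 y r z; rewrite /sdiff; lra.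
    rewrite sumr_const_nat -[leLHS]mulr_natr ler_wpM2l ?mulr_ge0// ler_nat.
    exact: leq_subr.
  by have := inner _ Mt; lra.
have a8 : r0 / 8 <= enorm (z - y).
  rewrite leNgt; apply/negP => lt8; move: tt0; rewrite ltNge => /negP; apply.
  by rewrite /t /t0; nra.
have zy : z - y != 0 by rewrite -enorm_gt0; lra.
(* [m] is the dyadic scale of [t] *)
have [m mP mmin] : exists2 m : nat, 2 ^- m.+1 <= t & forall i : nat, 2 ^- i.+1 <= t -> (m <= i)%N.
  have ex : exists m : nat, 2 ^- m.+1 <= t.
    by have [m mt] := ex_dyadic_le _ tpos; exists m; apply: le_trans mt; exact: half_le.
  by have [m mP mmin] := ex_minnP ex; exists m.
have t16 : t < 2 ^- 4.
  rewrite -natrX; have : t0 <= 128^-1 by rewrite /t0; nra.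
  by lra.
have m4 : (4 <= m)%N.
  rewrite leqNgt; apply/negP => m4; have := le_trans (half_le m.+1 4 m4) mP.
  by rewrite leNgt t16.
have tm : t < 2 ^- m.
  rewrite ltNge; apply/negP; case: m m4 mP mmin => // m _ _ mmin /mmin.
  by rewrite ltnn.
have Mt : 2 ^- m.+2 <= t / 2.
  rewrite ler_pdivlMr// mulrC; apply: le_trans mP.
  by rewrite exprS invfM mulrA mulfV// mul1r.
have [Mn|nM] := leqP m.+2 n; first by have := small _ Mn Mt; lra.
have {}nM := ltnW nM.
rewrite (Rintegral_dyadic_split _ n (m.+2 - n))// subnKC//.
suff : \sum_(n <= k < m.+2) \int[mu]_(h in ann (2 ^- k.+1) (2 ^- k))
      (sdiff (barrier y r) z h * kern h) <= CA.
  by have := inner _ Mt; lra.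
set w := barrier y r z.
have wm : w <= lam / sg m.
  by rewrite -prof_sg//; apply: prof_homo; exact: ltW.
have w0 : 0 <= w by exact: barrier_ge0.
apply: (@le_trans _ _ (\sum_(n <= k < m.+2) ((2 * w - prof (2 ^- k.+1)) * kap +
    c * (2 * prof (2 ^- k) ^+ 3 + 2 ^- k)))).
  apply: ler_sum_nat => k /andP[nk _].
  apply: le_trans (Rintegral_sdiff_shell_le y r z k r_gt0 r4 zr zy (leq_trans n4 nk)) _.
  rewrite lerD2l ler_wpM2r//.
    by rewrite addr_ge0 ?mulr_ge0 ?exprn_ge0 ?prof_ge0// ltW.
  by rewrite ler_wpM2l ?mulr_ge0 ?exprn_ge0// lef_pV2 ?posrE ?divr_gt0//; lra.
have := sum_shell_le w c n (m.+2 - n) c0 n4; rewrite subnKC// => /le_trans; apply.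
have sm0 : 2 <= sg m.
  rewrite -[leLHS](_ : Num.sqrt 4 = 2); last first.
    by rewrite (_ : 4 = 2 ^+ 2) ?sqrtr_sqr ?ger0_norm// -natrX.
  by apply: ler_wsqrtr; rewrite ler_nat.
have wj : w * (m.+2 - n)%:R <= lam * (sg m + 1).
  apply: (@le_trans _ _ (lam / sg m * (m%:R + 2))).
    by apply: ler_pM => //; rewrite -natrD ler_nat addn2 leq_subr.
  rewrite -mulrA ler_wpM2l// mulrC ler_pdivrMr; last by lra.
  by rewrite -sg_sqr; nra.
have s3 := sg_le m m.+3 (leq_trans (leqnSn _) (leq_trans (leqnSn _) (leqnSn _))).
have i0 : 0 <= (sg (m.+2).-1)^-1 by rewrite invr_ge0 sqrtr_ge0.
have i1 : (sg n.-1)^-1 <= 1.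
  rewrite invf_le1; last by apply: sg_gt0; case: (n) n4 => [|[]].
  by rewrite -[leLHS]sqrtr1; apply: ler_wsqrtr; rewrite ler1n; case: (n) n4 => [|[]].
have h1 := half_gt0 m.+2.
have h2 : 2 ^- n <= 1 :> R by rewrite -[leRHS]invr1; apply: (half_le 0).
rewrite /CA; apply: lerD.
  have P1 : 0 <= kap * (lam * (sg m + 1) - w * (m.+2 - n)%:R) by rewrite mulr_ge0// subr_ge0.
  have P2 : 0 <= lam * kap * (sg m.+3 - sg m) by rewrite !mulr_ge0// subr_ge0.
  by rewrite -subr_ge0; move: P1 P2; set j := (_ - _)%:R; nra.
apply: ler_wpM2l => //; apply: lerD; last by lra.
rewrite -[leRHS]mulr1 ler_wpM2l ?mulr_ge0 ?exprn_ge0//.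
by lra.
Qed.

End BarrierBound.

(** * Smooth functions built from exp (- 1 / s) *)

Section FlatFunction.
Context {R : realType}.
Implicit Types (p : {poly R}) (s t : R).

(** The functions [p (1/s) * exp (-1/s)], extended by zero to [s <= 0]: they
    contain the classical flat function and are stable under derivation. *)
Definition flat p s : R := if 0 < s then p.[s^-1] * expR (- s^-1) else 0.

Lemma flat_le0 p s : s <= 0 -> flat p s = 0.
Proof. by move=> s0; rewrite /flat ltNge s0. Qed.

Lemma flat_gt0E p s : 0 < s -> flat p s = p.[s^-1] * expR (- s^-1).
Proof. by move=> s0; rewrite /flat s0. Qed.

(** The exponential beats the polynomial by any power; the second power is what
    differentiability at the origin takes. *)
Lemma flat_quadratic p : exists2 C : R, 0 <= C & forall s, `|s| <= 1 -> `|flat p s| <= C * s ^+ 2.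
Proof.
pose S := \sum_(i < size p) `|p`_i|.
have S0 : 0 <= S by exact: sumr_ge0.
exists (S * (size p).+2`!%:R) => [|s s1]; first by rewrite mulr_ge0.
have [s0|s0] := leP s 0.
  by rewrite flat_le0// normr0; apply: mulr_ge0; rewrite ?sqr_ge0 ?mulr_ge0.
rewrite flat_gt0E// normrM (ger0_norm (expR_ge0 _)).
set y := s^-1; have y0 : 0 < y by rewrite invr_gt0.
have y1 : 1 <= y by rewrite invf_ge1//; move: s1; rewrite ger0_norm// ltW.
have Sp : `|p.[y]| <= S * y ^+ (size p).
  rewrite horner_coef mulr_suml; apply: le_trans (ler_norm_sum _ _ _) _.
  apply: ler_sum => i _; rewrite normrM normrX (ger0_norm (ltW y0)) ler_wpM2l//.
  by rewrite ler_weXn2l// ltnW.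
have E : expR (- y) <= (size p).+2`!%:R / y ^+ (size p).+2.
  have := @expR_ge1Dxn R y (size p).+1 (ltW y0).
  have f0 : 0 < (size p).+2`!%:R :> R by rewrite ltr0n fact_gt0.
  have yn0 : 0 < y ^+ (size p).+2 by rewrite exprn_gt0.
  move=> H; rewrite expRN -invf_div lef_pV2 ?posrE ?expR_gt0 ?divr_gt0//.
  by apply: le_trans H; rewrite lerDr.
apply: (@le_trans _ _ (S * y ^+ size p * ((size p).+2`!%:R / y ^+ (size p).+2))).
  by apply: ler_pM => //; exact: expR_ge0.
rewrite -[s]invrK -/y le_eqVlt; apply/orP; left; apply/eqP.
by rewrite !exprS; field; rewrite expf_neq0 ?gt_eqF.
Qed.

Lemma is_derive_flat p s : is_derive s 1 (flat p) (flat ('X^2 * (p - p^`())) s).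
Proof.
have [s0|s0|->] := ltgtP s 0.
- rewrite [X in is_derive _ _ _ X]flat_le0 ?ltW//.
  apply: (@near_eq_is_derive _ _ _ (cst 0)).
  near=> t; rewrite flat_le0//; apply: ltW; near: t; exact: lt_nbhsl.
- pose g t : R := (horner p \o (fun t => t^-1)) t * (expR \o (fun t => - t^-1)) t.
  apply: (@near_eq_is_derive _ _ _ g).
    near=> t; rewrite flat_gt0E//; near: t; exact: lt_nbhsr.
  have di : is_derive s (1 : R) (fun t : R => t^-1) (- s ^- 2).
    have := @is_deriveV R id s 1 1 (lt0r_neq0 s0) (is_derive_id _ _).
    by rewrite scaler1.
  have dp : is_derive s (1 : R) (horner p \o (fun t => t^-1)) (p^`().[s^-1] * (- s ^- 2)).
    exact: is_derive1_comp.
  have de : is_derive s (1 : R) (expR \o (fun t => - t^-1)) (expR (- s^-1) * s ^- 2).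
    apply: is_derive1_comp.
    by have := is_deriveN di; rewrite opprK.
  apply: is_derive_eq (is_deriveM dp de) _.
  rewrite flat_gt0E// hornerM hornerXn hornerD hornerN /= exprVn.
  by rewrite /GRing.scale/=; ring.
rewrite [X in is_derive _ _ _ X]flat_le0//.
have [C C0 CP] := flat_quadratic p.
have lim0 : (fun h => h^-1 *: ((flat p \o shift 0) (h *: (1 : R)) - flat p 0)) @ 0^' --> (0 : R).
  apply/cvgr0Pnorm_lt => e e0.
  have d0 : 0 < Num.min 1 (e / (C + 1)) by rewrite lt_min ltr01 divr_gt0//; lra.
  near=> h.
  have hd : `|h| < Num.min 1 (e / (C + 1)).
    by near: h; apply: dnbhs0_lt.
  move: hd; rewrite lt_min => /andP[h1 h2].
  rewrite /= addr0 scaler1 (flat_le0 _ 0)// subr0.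
  have [->|h0] := eqVneq h 0; first by rewrite invr0 scale0r normr0.
  rewrite normrZ normrV ?unitfE// mulrC ltr_pdivrMr ?normr_gt0//.
  apply: le_lt_trans (CP h (ltW h1)) _.
  rewrite -real_normK ?num_real// expr2 mulrA ltr_pM2r ?normr_gt0//.
  move: h2; rewrite ltr_pdivlMr; last by lra.
  by have := normr_ge0 h; nra.
split; first by apply/cvg_ex; exists 0.
by apply/cvg_lim.
Unshelve. all: by end_near.
Qed.

Lemma continuous_flat p : continuous (flat p).
Proof.
move=> s; apply/differentiable_continuous/derivable1_diffP.
exact: (@ex_derive _ _ _ _ _ _ _ (is_derive_flat p s)).
Qed.

Lemma flat1_ge0 s : 0 <= flat 1 s.
Proof. by rewrite /flat; case: ifP => // _; rewrite hornerC mul1r expR_ge0. Qed.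

Lemma flat1_le1 s : flat 1 s <= 1.
Proof.
rewrite /flat; case: ifP => // s0; rewrite hornerC mul1r expR_le1.
by rewrite oppr_le0 invr_ge0 ltW.
Qed.

Lemma flat1_gt0 s : 0 < s -> 0 < flat 1 s.
Proof. by move=> s0; rewrite flat_gt0E// hornerC mul1r expR_gt0. Qed.

Lemma flat1_lip s t : `|flat 1 s - flat 1 t| <= 2 * `|s - t|.
Proof.
wlog st : s t / t <= s.
  move=> H; have [st|/ltW ts] := leP t s; first exact: H.
  by rewrite distrC (distrC s); exact: H.
have [c _ ->] := MVT_segment st (fun x _ => is_derive_flat 1 x)
  (continuous_subspaceT (@continuous_flat 1)).
rewrite normrM ler_wpM2r//.
rewrite -[1 : {poly R}]/(1%:P) derivC subr0 mulr1 /flat; case: ifP => [c0|_]; last by rewrite normr0.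
rewrite hornerXn ger0_norm ?mulr_ge0 ?exprn_ge0 ?expR_ge0 ?invr_ge0 ?(ltW c0)//.
have := @expR_ge1Dxn R c^-1 1; rewrite invr_ge0 => /(_ (ltW c0)) H.
rewrite expRN ler_pdivrMr ?expR_gt0//.
move: H; rewrite (_ : 2`!%:R = 2)//; lra.
Qed.

End FlatFunction.

Section SmoothGen.
Context {R : realType} {N : nat}.
Implicit Types (f g : 'rV[R]_N -> R).

(** Functions assembled from flat functions of one coordinate: a class closed
    under partial derivatives, hence made of smooth functions. *)
Inductive flat_gen : ('rV[R]_N -> R) -> Prop :=
| flat_gen_cst c : flat_gen (fun=> c)
| flat_gen_atom p (a b : R) i : flat_gen (fun x => flat p (a * x 0 i + b))
| flat_gen_add f g : flat_gen f -> flat_gen g -> flat_gen (fun x => f x + g x)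
| flat_gen_mul f g : flat_gen f -> flat_gen g -> flat_gen (fun x => f x * g x).

Lemma flat_gen_continuous f : flat_gen f -> continuous f.
Proof.
elim=> [c|p a b i|{}f g _ cf _ cg|{}f g _ cf _ cg] x.
- exact: cst_continuous.
- apply: (@continuous_comp _ _ _ (fun x : 'rV[R]_N => a * x 0 i + b)); last exact: continuous_flat.
  apply: continuousD; last exact: cst_continuous.
  by apply: continuousM; [exact: cst_continuous|exact: coord_continuous].
- by apply: continuousD; [exact: cf|exact: cg].
- by apply: continuousM; [exact: cf|exact: cg].
Qed.

Lemma is_derive_line f (x v : 'rV[R]_N) (d : R) :
  is_derive (0 : R) (1 : R) (fun s : R => f (s *: v + x)) d -> is_derive x v f d.
Proof.
have E : (fun h : R => h^-1 *: (((fun s : R => f (s *: v + x)) \o shift 0) (h *: (1 : R))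
     - f (0 *: v + x))) = (fun h => h^-1 *: ((f \o shift x) (h *: v) - f x)).
  by apply/funext => h /=; rewrite addr0 scaler1 scale0r add0r.
by case; rewrite /derivable /derive E => d1 d2; split.
Qed.

Lemma flat_gen_derive f (j : 'I_N) : flat_gen f ->
  exists2 g, flat_gen g & forall x, is_derive x (delta_mx 0 j) f (g x).
Proof.
elim=> [c|p a b i|{}f g Hf [f' Gf' Df] Hg [g' Gg' Dg]|{}f g Hf [f' Gf' Df] Hg [g' Gg' Dg]].
- exists (fun=> 0); first exact: flat_gen_cst.
  by move=> x; exact: is_derive_cst.
- exists (fun x => flat ('X^2 * (p - p^`())) (a * x 0 i + b) * (a * (j == i)%:R)).
    by apply: flat_gen_mul; [exact: flat_gen_atom|exact: flat_gen_cst].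
  move=> x; apply: is_derive_line.
  pose l (s : R) : R := (a * (j == i)%:R) * s + (a * x 0 i + b).
  have -> : (fun s : R => flat p (a * (s *: delta_mx 0 j + x) 0 i + b)) = flat p \o l.
    by apply/funext => s /=; rewrite !mxE eqxx/= /l eq_sym; congr flat; ring.
  have dl : is_derive (0 : R) 1 l (a * (j == i)%:R).
    have H : is_derive (0 : R) 1 l ((a * (j == i)%:R) *: (1 : R) + 0) :=
      is_deriveD (is_deriveZ (a * (j == i)%:R) (is_derive_id (0 : R) 1))
        (is_derive_cst (a * x 0 i + b) (0 : R) 1).
    by rewrite addr0 scaler1 in H.
  have l0 : a * x 0 i + b = l 0 by rewrite /l mulr0 add0r.
  rewrite l0; apply: is_derive1_comp; exact: is_derive_flat.
- exists (fun x => f' x + g' x); first exact: flat_gen_add.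
  by move=> x; exact: is_deriveD.
- exists (fun x => f x * g' x + g x * f' x).
    by apply: flat_gen_add; apply: flat_gen_mul.
  by move=> x; apply: is_derive_eq (is_deriveM (Df x) (Dg x)) _.
Qed.

Lemma flat_gen_partial f j : flat_gen f -> flat_gen (partial_derive j f).
Proof.
move=> /(flat_gen_derive _ j)[g Gg D].
suff -> : partial_derive j f = g by [].
by apply/funext => x; exact: (@derive_val _ _ _ _ _ _ _ (D x)).
Qed.

Lemma flat_gen_smooth f : flat_gen f -> smooth f.
Proof.
move=> Gf s /=.
have Gs : flat_gen (foldr partial_derive f s).
  by elim: s => //= i s IHs; exact: flat_gen_partial.
split; first exact: flat_gen_continuous.
move=> i x; have [g _ D] := flat_gen_derive _ i Gs.
exact: (@ex_derive _ _ _ _ _ _ _ (D x)).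
Qed.

Lemma flat_gen_prod (I : Type) (r : seq I) (F : I -> 'rV[R]_N -> R) :
  (forall i, flat_gen (F i)) -> flat_gen (fun x => \prod_(i <- r) F i x).
Proof.
move=> GF; elim: r => [|i r IHr].
  rewrite (_ : (fun _ => _) = (fun=> 1)); first exact: flat_gen_cst.
  by apply/funext => x; rewrite big_nil.
rewrite (_ : (fun _ => _) = (fun x => F i x * \prod_(i <- r) F i x)).
  exact: flat_gen_mul.
by apply/funext => x; rewrite big_cons.
Qed.

End SmoothGen.

(** * Mollifiers *)

Lemma normr_prodB_le {R : realDomainType} (I : Type) (r : seq I) (a b : I -> R) :
  (forall i, 0 <= a i <= 1) -> (forall i, 0 <= b i <= 1) ->
  `|\prod_(i <- r) a i - \prod_(i <- r) b i| <= \sum_(i <- r) `|a i - b i|.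
Proof.
move=> a01 b01; elim: r => [|i r IHr]; first by rewrite !big_nil subrr normr0.
rewrite !big_cons; set A := \prod_(j <- r) a j in IHr *; set B := \prod_(j <- r) b j in IHr *.
have /andP[A0 A1] : 0 <= A <= 1.
  rewrite prodr_ge0/= => [|j _]; last by case/andP: (a01 j).
  by apply: prodr_ile1 => j _; exact: a01.
have /andP[b0 b1] := b01 i.
rewrite (_ : a i * A - b i * B = (a i - b i) * A + b i * (A - B)); last by ring.
apply: le_trans (ler_normD _ _) _; rewrite !normrM (ger0_norm A0) (ger0_norm b0).
apply: lerD; first by rewrite ler_piMr.
by apply: le_trans IHr; rewrite ler_piMl.
Qed.

Section Bump.
Context {R : realType} {N : nat}.
Local Notation mu := (@lebesgue_rV R N).
Implicit Types (x y z h : 'rV[R]_N) (f : 'rV[R]_N -> R).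

Lemma integrable_csupp f z (r : R) : continuous f ->
  (forall x, f x != 0 -> enorm (x - z) <= r) -> mu.-integrable setT (EFin \o f).
Proof.
move=> cf fr; pose K := [set x | enorm (x - z) <= r].
have cK : compact K by exact: compact_cball.
have mf : measurable_fun setT f by exact: continuous_measurable_rV.
have mK : measurable K.
  apply: measurable_le_set => //; apply: continuous_measurable_rV => x.
  apply: continuous_comp; last exact: continuous_enorm.
  by apply: continuousB; [exact: id|exact: cst_continuous].
have [C CP] : exists C, forall x, K x -> `|f x| <= C.
  have [M [_ MP]] := compact_bounded (continuous_compact (continuous_subspaceT cf) cK).
  exists (M + 1) => x Kx; apply: (MP (M + 1)); first by rewrite ltrDl.
  by exists x.
have muK : (mu K < +oo)%E.
  apply: (@le_lt_trans _ _ (mu (eball z (`|r| + 1)))).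
    apply: le_measure; rewrite ?inE//; first exact: measurable_eball.
    move=> x /= xr; rewrite /eball/=; apply: le_lt_trans xr _.
    by rewrite (le_lt_trans (ler_norm r))// ltrDl.
  apply: le_lt_trans (lebesgue_rV_eball_le _ _ _) (ltry _).
  by rewrite ltr_wpDl.
have intK := integrable_bounded _ _ _ mK muK mf CP.
have /integrableP[_ fin] := intK.
apply/integrableP; split; first exact/measurable_EFinP.
rewrite (_ : (\int[mu]_x _)%E = (\int[mu]_(x in K) `|(EFin \o f) x|)%E)//.
rewrite [RHS]integral_mkcond; apply: eq_integral => x _.
rewrite patchE; case: ifPn => // xK; rewrite /= (_ : f x = 0) ?normr0//.
by apply/eqP; apply: contraNT xK => /fr; rewrite inE.
Qed.

(** A product over the coordinates, so that it is a finite combination of flat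
    functions of single coordinates; its support is a cube. *)
Definition bump (rho : R) x : R :=
  \prod_(i < N) (flat 1 (rho + x 0 i) * flat 1 (rho - x 0 i)).

Lemma bump_factor01 rho x i :
  0 <= flat 1 (rho + x 0 i) * flat 1 (rho - x 0 i) <= 1.
Proof.
by rewrite mulr_ge0 ?flat1_ge0//= mulr_ile1 ?flat1_ge0 ?flat1_le1.
Qed.

Lemma bump_ge0 rho x : 0 <= bump rho x.
Proof. by apply: prodr_ge0 => i _; case/andP: (bump_factor01 rho x i). Qed.

Lemma bump_neq0 rho x i : bump rho x != 0 -> `|x 0 i| < rho.
Proof.
apply: contraNT; rewrite -leNgt /bump (bigD1 i)//= => H.
suff -> : flat 1 (rho + x 0 i) * flat 1 (rho - x 0 i) = 0 by rewrite mul0r.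
have [x0|x0] := leP 0 (x 0 i).
  by rewrite ger0_norm// in H; rewrite (flat_le0 _ (rho - _)) ?mulr0// subr_le0.
rewrite ltr0_norm// in H; rewrite flat_le0 ?mul0r//; lra.
Qed.

Lemma bump_supp rho x : bump rho x != 0 -> enorm x <= N%:R * rho.
Proof. by move=> bx; apply: enorm_le_card => i; apply/ltW/bump_neq0. Qed.

Lemma bump_lip rho x y : `|bump rho x - bump rho y| <= 4 * N%:R * enorm (x - y).
Proof.
apply: le_trans (normr_prodB_le _ _ _ _ (bump_factor01 rho x) (bump_factor01 rho y)) _.
apply: (@le_trans _ _ (\sum_(i < N) 4 * enorm (x - y))); last first.
  by rewrite sumr_const card_ord -[leLHS]mulr_natr mulrAC.
apply: ler_sum => i _.
set a := flat 1 (rho + x 0 i); set b := flat 1 (rho - x 0 i).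
set c := flat 1 (rho + y 0 i); set d := flat 1 (rho - y 0 i).
have xy : `|x 0 i - y 0 i| <= enorm (x - y).
  by have := normr_coord_le_enorm (x - y) i; rewrite !mxE.
have ac : `|a - c| <= 2 * enorm (x - y).
  apply: le_trans (flat1_lip _ _) _; rewrite ler_pM2l//.
  by rewrite (_ : _ - _ = x 0 i - y 0 i)//; ring.
have bd : `|b - d| <= 2 * enorm (x - y).
  apply: le_trans (flat1_lip _ _) _; rewrite ler_pM2l//.
  by rewrite (_ : _ - _ = - (x 0 i - y 0 i)) ?normrN//; ring.
rewrite (_ : a * b - c * d = (a - c) * b + c * (b - d)); last by ring.
apply: le_trans (ler_normD _ _) _; rewrite !normrM.
rewrite (ger0_norm (flat1_ge0 _ : 0 <= b)) (ger0_norm (flat1_ge0 _ : 0 <= c)).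
rewrite (_ : 4 * _ = 2 * enorm (x - y) + 2 * enorm (x - y)); last by ring.
apply: lerD.
  by apply: le_trans ac; rewrite ler_piMr// flat1_le1.
by apply: le_trans bd; rewrite ler_piMl// flat1_le1.
Qed.

Lemma bump_shift_flat_gen rho z : flat_gen (fun x => bump rho (x - z)).
Proof.
rewrite (_ : (fun _ => _) = fun x => \prod_(i < N)
  (flat 1 (1 * x 0 i + (rho - z 0 i)) * flat 1 ((-1) * x 0 i + (rho + z 0 i)))).
  by apply: flat_gen_prod => i; apply: flat_gen_mul; exact: flat_gen_atom.
apply/funext => x; apply: eq_bigr => i _; rewrite !mxE.
by congr (flat _ _ * flat _ _); ring.
Qed.

Lemma continuous_bump rho : continuous (bump rho).
Proof.
have := flat_gen_continuous _ (bump_shift_flat_gen rho 0).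
by rewrite (_ : (fun _ => _) = bump rho)//; apply/funext => x; rewrite subr0.
Qed.

Lemma integrable_bump rho : mu.-integrable setT (EFin \o bump rho).
Proof.
apply: (integrable_csupp _ 0 (N%:R * rho)); first exact: continuous_bump.
by move=> x; rewrite subr0; exact: bump_supp.
Qed.

Definition bump_mass rho : R := \int[mu]_x bump rho x.

Lemma bump_mass_gt0 rho : 0 < rho -> 0 < bump_mass rho.
Proof.
move=> rho0; have r2 : 0 < rho / 2 by rewrite divr_gt0.
pose B := box (fun i => `[(0 : 'rV[R]_N) 0 i - rho / 2, (0 : 'rV[R]_N) 0 i + rho / 2]%classic).
have mB : measurable B by apply: measurable_box => i; exact: measurable_itv.
have muB : mu B = ((2 * (rho / 2)) ^+ N)%:E by exact: lebesgue_rV_cube.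
pose c := (flat 1 (rho / 2) * flat 1 (rho / 2)) ^+ N.
have c0 : 0 < c by rewrite exprn_gt0// mulr_gt0// flat1_gt0.
have flat1_homo (s t : R) : 0 < s -> s <= t -> flat 1 s <= flat 1 t.
  move=> s0 st; have t0 := lt_le_trans s0 st.
  rewrite !flat_gt0E// !hornerC !mul1r ler_expR lerN2 lef_pV2//.
have intb := integrable_bump rho.
rewrite /bump_mass.
apply: (@lt_le_trans _ _ (\int[mu]_(x in B) c)).
  rewrite Rintegral_cst// [fine _](congr1 fine muB)/= mulr_gt0// exprn_gt0//.
  exact: mulr_gt0.
apply: (@le_trans _ _ (\int[mu]_(x in B) bump rho x)).
  apply: le_Rintegral => //.
  - by apply: (integrable_bounded _ _ `|c|) => //; rewrite [X in (X < _)%E]muB ltry.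
  - by apply: integrableS intb.
  - move=> x Bx; rewrite /c -[X in _ ^+ X](card_ord N) -prodr_const /bump.
    apply: ler_prod => i _; rewrite mulr_ge0 ?flat1_ge0//=.
    have := Bx i; rewrite /= in_itv/= !mxE => /andP[x1 x2].
    by apply: ler_pM; rewrite ?flat1_ge0//; apply: flat1_homo => //; lra.
rewrite Rintegral_mkcond; apply: le_Rintegral => //.
  by rewrite -restrict_EFin; apply/integrable_restrict => //; rewrite setTI; apply: integrableS intb.
by move=> x _; rewrite patchE; case: ifP => // _; exact: bump_ge0.
Qed.

Definition moll rho z x : R := bump rho (x - z) / bump_mass rho.

Lemma moll_flat_gen rho z : flat_gen (moll rho z).
Proof. by apply: flat_gen_mul; [exact: bump_shift_flat_gen|exact: flat_gen_cst]. Qed.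

Lemma continuous_moll rho z : continuous (moll rho z).
Proof. exact/flat_gen_continuous/moll_flat_gen. Qed.

Lemma moll_ge0 rho z x : 0 < rho -> 0 <= moll rho z x.
Proof. by move=> r0; rewrite divr_ge0 ?bump_ge0// ltW// bump_mass_gt0. Qed.

Lemma moll_supp rho z x : moll rho z x != 0 -> enorm (x - z) <= N%:R * rho.
Proof. by rewrite mulf_eq0 negb_or => /andP[+ _]; exact: bump_supp. Qed.

Lemma moll_lip rho z x y : 0 < rho ->
  `|moll rho z x - moll rho z y| <= 4 * N%:R / bump_mass rho * enorm (x - y).
Proof.
move=> r0; have m0 := bump_mass_gt0 rho r0.
rewrite /moll -mulrBl normrM (gtr0_norm (_ : 0 < _^-1)) ?invr_gt0//.
rewrite mulrAC ler_pM2r ?invr_gt0//; apply: le_trans (bump_lip _ _ _) _.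
by rewrite (_ : x - z - (y - z) = x - y)// opprB addrA subrK.
Qed.

Lemma mollD rho z h x : moll rho (z + h) (x + h) = moll rho z x.
Proof. by rewrite /moll opprD addrACA subrr addr0. Qed.

Lemma integral_moll rho z : 0 < rho -> \int[mu]_x moll rho z x = 1.
Proof.
move=> r0; have m0 := bump_mass_gt0 rho r0.
rewrite -(Rintegral_translation z); last first.
  by apply: continuous_measurable_rV; exact: continuous_moll.
rewrite /moll; under eq_Rintegral do rewrite addrK.
by rewrite RintegralZr// ?mulfV ?gt_eqF//; exact: integrable_bump.
Qed.

Lemma moll_test_function (Omega : set 'rV[R]_N) rho z :
  (forall x, enorm (x - z) <= N%:R * rho -> Omega x) ->
  test_function Omega (moll rho z).
Proof.
move=> sub; pose K := [set x | enorm (x - z) <= N%:R * rho].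
have cK : compact K by exact: compact_cball.
have clK : closed K by apply: compact_closed => //; exact: norm_hausdorff.
have SK : closure [set x | moll rho z x != 0] `<=` K.
  apply: (@subset_trans _ (closure K)).
    by apply: closure_subset => x; exact: moll_supp.
  by rewrite -(iffLR (closure_id K) clK).
split; first exact/flat_gen_smooth/moll_flat_gen.
  by apply: subclosed_compact cK SK; exact: closed_closure.
by apply: subset_trans SK _ => x /sub.
Qed.

End Bump.

(** * The near part of the form as an integral of second differences *)

Section NearForm.
Context {R : realType} {N : nat}.
Local Notation mu := (@lebesgue_rV R N).
Local Notation kern := (@kern R N).
Local Notation ann := (@ann R N).
Implicit Types (x y z h : 'rV[R]_N).

(** The convolution of [v] with the reflection of [phi]. *)
Definition corr (v phi : 'rV[R]_N -> R) h : R := \int[mu]_x (v (x + h) * phi x).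

Context (v phi : 'rV[R]_N -> R) (z : 'rV[R]_N) (rho Lam : R).
Context (cv : continuous v) (cphi : continuous phi).
Context (phi_supp : forall x, phi x != 0 -> enorm (x - z) <= rho).
Context (phi_lip : forall x y, `|phi x - phi y| <= Lam * enorm (x - y)).

Let continuous_shift (f : 'rV[R]_N -> R) h : continuous f -> continuous (fun x => f (x + h)).
Proof.
move=> cf x; apply: (@continuous_comp _ _ _ (fun x => x + h)); last exact: cf.
by apply: continuousD; [exact: id|exact: cst_continuous].
Qed.

Let corr_integrable h k :
  mu.-integrable setT (EFin \o (fun x => v (x + h) * phi (x + k))).
Proof.
apply: (integrable_csupp _ (z - k) rho).
  by move=> x; apply: continuousM; apply: continuous_shift.
move=> x; rewrite mulf_eq0 negb_or => /andP[_ /phi_supp].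
by rewrite opprB addrA addrAC.
Qed.

Let corr_shift h k : \int[mu]_x (v (x + h) * phi (x + k)) = corr v phi (h - k).
Proof.
rewrite /corr -(Rintegral_translation k (fun x => v (x + (h - k)) * phi x)).
  by apply: eq_Rintegral => x _; rewrite -addrA (addrC k) subrK.
apply: continuous_measurable_rV => x.
by apply: continuousM; [apply: continuous_shift|exact: cphi].
Qed.

Let F (p : 'rV[R]_N * 'rV[R]_N) : R :=
  (v p.1 - v (p.1 + p.2)) * (phi p.1 - phi (p.1 + p.2)) * (kern p.2 * \1_(ann 0 1) p.2).

Let measurable_addp : measurable_fun setT (fun p : 'rV[R]_N * 'rV[R]_N => p.1 + p.2).
Proof.
apply: measurable_fun_coordP => i; under eq_fun do rewrite mxE.
apply: measurable_funD.
  apply: (measurableT_comp (measurable_coord i)); exact: measurable_fst.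
apply: (measurableT_comp (measurable_coord i)); exact: measurable_snd.
Qed.

Let mv : measurable_fun setT v. Proof. exact: continuous_measurable_rV. Qed.
Let mphi : measurable_fun setT phi. Proof. exact: continuous_measurable_rV. Qed.

Let measurable_F : measurable_fun setT F.
Proof.
apply: measurable_funM; [apply: measurable_funM|apply: measurable_funM].
- apply: measurable_funB; first exact: measurableT_comp mv measurable_fst.
  exact: measurableT_comp mv measurable_addp.
- apply: measurable_funB; first exact: measurableT_comp mphi measurable_fst.
  exact: measurableT_comp mphi measurable_addp.
- exact: measurableT_comp (@measurable_kern R N) measurable_snd.
- apply: (measurableT_comp (f := \1_(ann 0 1) : _ -> R)) => //.
  apply: measurable_indic; exact: measurable_ann.
Qed.

Let F_bound : exists2 C : R, 0 <= C & forall x h,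
  `|F (x, h)| <= \1_(eball z (rho + 2)) x * (C * (enorm h * kern h * \1_(ann 0 1) h)).
Proof.
have cK : compact [set x | enorm (x - z) <= rho + 3] by exact: compact_cball.
have [M MP] : exists M, forall x, enorm (x - z) <= rho + 3 -> `|v x| <= M.
  have [M [_ MP]] := compact_bounded (continuous_compact (continuous_subspaceT cv) cK).
  exists (M + 1) => x Kx; apply: (MP (M + 1)); first by rewrite ltrDl.
  by exists x.
exists (2 * `|M| * `|Lam|); first by rewrite !mulr_ge0.
move=> x h; have [h1|h1] := boolP (h \in ann 0 1); last first.
  by rewrite /F/= indicE (negPf h1)/= ?mulr0n !mulr0 normr0 ?mulr0.
have : enorm h < 1 by move: h1; rewrite inE => /andP[].
move=> {h1} h1; have hn0 := enorm_ge0 h.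
have RHS0 : 0 <= \1_(eball z (rho + 2)) x *
     (2 * `|M| * `|Lam| * (enorm h * kern h * \1_(ann 0 1) h)).
  by rewrite !mulr_ge0 ?kern_ge0 ?enorm_ge0.
have [p0|p0] := eqVneq (phi x - phi (x + h)) 0.
  by rewrite /F/= p0 mulr0 mul0r normr0.
have xz : enorm (x - z) <= rho + 1.
  have [px|px] := eqVneq (phi x) 0.
    have /phi_supp xh : phi (x + h) != 0 by apply: contraNneq p0 => ->; rewrite px subrr.
    have := enormD_le (x + h - z) (- h); rewrite enormN addrAC addrK => H.
    by lra.
  by have := phi_supp _ px; lra.
rewrite indicE mem_set ?mul1r /eball/=; last by lra.
rewrite /F/= !normrM (ger0_norm (kern_ge0 h)) (ger0_norm (_ : 0 <= \1_(ann 0 1) h))//.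
rewrite (_ : _ * _ * _ * (_ * _) = (2 * `|M|) * (`|Lam| * enorm h) * (kern h * \1_(ann 0 1) h)).
  apply: ler_pM; rewrite ?mulr_ge0 ?kern_ge0//; apply: ler_pM => //.
    apply: le_trans (ler_normB _ _) _.
    have vx : `|v x| <= `|M| by apply: le_trans (ler_norm M); apply: MP; lra.
    have vxh : `|v (x + h)| <= `|M|.
      apply: le_trans (ler_norm M); apply: MP.
      by have := enormD_le (x - z) h; rewrite addrAC => H; lra.
    by lra.
  apply: le_trans (phi_lip _ _) _.
  rewrite (_ : x - (x + h) = - h) ?enormN; last by rewrite opprD addrA subrr add0r.
  by rewrite ler_wpM2r// ler_norm.
ring.
Qed.

Let F_inner x : mu.-integrable setT (EFin \o (fun h => F (x, h))).
Proof.
have [C C0 CP] := F_bound.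
have ie : mu.-integrable setT (EFin \o (fun h => enorm h * kern h * \1_(ann 0 1) h)).
  have := integrable_enorm_kern enorm 1 (@measurable_enorm R N).
  have -> : (forall h, `|enorm h| <= 1 * enorm h) = True.
    by rewrite propeqE; split => // _ h; rewrite mul1r ger0_norm// enorm_ge0.
  move=> /(_ I); rewrite (integrable_mkcond _ (measurable_ann _ _)).
  apply: eq_integrable => // h _; rewrite patchE/= indicE.
  by case: ifP => _; rewrite ?mulr1 ?mulr0.
apply: (le_integrable measurableT _ _ (integrableZl measurableT C ie)) => [|h _].
  apply/measurable_EFinP.
  exact: (measurableT_comp measurable_F (measurable_pair1 x)).
rewrite /= lee_fin; apply: le_trans (CP x h) _.
apply: (@le_trans _ _ (1 * (C * (enorm h * kern h * \1_(ann 0 1) h)))).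
  apply: ler_wpM2r; last by rewrite indicE lern1; case: (_ \in _).
  by rewrite !mulr_ge0 ?kern_ge0 ?enorm_ge0.
by rewrite mul1r ler_norm.
Qed.

Let integrable_F : (mu \x mu)%E.-integrable setT (EFin \o F).
Proof.
have [C C0 CP] := F_bound.
apply/integrable12ltyP; first exact/measurable_EFinP.
have mg : measurable_fun setT (fun h => (C * (enorm h * kern h * \1_(ann 0 1) h))%:E).
  apply/measurable_EFinP; apply: measurable_funM => //; apply: measurable_funM.
    by apply: measurable_funM; [exact: measurable_enorm|exact: measurable_kern].
  by apply: measurable_indic; exact: measurable_ann.
have g0 h : (0 <= (C * (enorm h * kern h * \1_(ann 0 1) h))%:E)%E.
  by rewrite lee_fin !mulr_ge0 ?kern_ge0 ?enorm_ge0.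
have gK : (\int[mu]_h (C * (enorm h * kern h * \1_(ann 0 1) h))%:E <=
    (C * (2 * kap (R := R) (N := N)))%:E)%E.
  under eq_integral do rewrite EFinM.
  rewrite ge0_integralZl//; last 2 first.
    apply/measurable_EFinP; apply: measurable_funM.
      by apply: measurable_funM; [exact: measurable_enorm|exact: measurable_kern].
    by apply: measurable_indic; exact: measurable_ann.
    by move=> h _; rewrite lee_fin !mulr_ge0 ?kern_ge0 ?enorm_ge0.
  rewrite EFinM; apply: lee_wpmul2l; first by rewrite lee_fin.
  have := @integral_enorm_kern_le R N 0; rewrite expr0 invr1 mulr1; apply: le_trans.
  rewrite [leRHS]integral_mkcond le_eqVlt; apply/orP; left; apply/eqP.
  apply: eq_integral => h _; rewrite patchE indicE.
  by case: ifP => _; rewrite ?mulr1 ?mulr0.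
have inner x : (\int[mu]_h `|(F (x, h))%:E| <=
    (C * (2 * kap (R := R) (N := N)))%:E * (\1_(eball z (rho + 2)) x)%:E)%E.
  have [xB|xB] := boolP (x \in eball z (rho + 2)); rewrite indicE ?xB ?(negPf xB)/=.
    rewrite mule1; apply: le_trans gK; apply: ge0_le_integral => //.
      by have /integrableP[/measurable_EFinP mFx _] := F_inner x; apply/measurable_EFinP; exact: measurableT_comp.
    by move=> h _; rewrite lee_fin; have := CP x h; rewrite indicE xB mul1r.
  rewrite mule0 integral0_eq// => h _; apply/eqP; rewrite eqe normr_eq0.
  by have := CP x h; rewrite indicE (negPf xB) mul0r normr_le0.
apply: (@le_lt_trans _ _ (\int[mu]_x ((C * (2 * kap (R := R) (N := N)))%:E *
    (\1_(eball z (rho + 2)) x)%:E))%E).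
  apply: ge0_le_integral => //.
  - by move=> x _; exact: integral_ge0.
  - apply: (measurable_fun_fubini_tonelli_F (m2 := mu) (abse \o (EFin \o F))) => //.
      by apply: measurableT_comp => //; exact/measurable_EFinP.
    by move=> p; exact: abse_ge0.
  - apply: measurable_funeM; apply/measurable_EFinP; apply: measurable_indic.
    exact: measurable_eball.
  - by move=> x _; exact: inner.
rewrite ge0_integralZl//; last 2 first.
  apply/measurable_EFinP; apply: measurable_indic; exact: measurable_eball.
  by rewrite lee_fin !mulr_ge0// kap_ge0.
rewrite integral_indic//; last exact: measurable_eball.
rewrite setIT lte_mul_pinfty//; first by rewrite lee_fin !mulr_ge0// kap_ge0.
have [r0|r0] := ltP 0 (rho + 2).
  exact: le_lt_trans (lebesgue_rV_eball_le _ _ r0) (ltry _).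
rewrite (_ : eball _ _ = set0) ?measure0// -subset0 => x; rewrite /eball/= => xr.
by have := lt_le_trans xr r0; rewrite ltNge enorm_ge0.
Qed.

(* the first two terms give [corr v phi 0] after translation, the last two
   give [corr v phi] at [- h] and at [h] *)
Let expand (a b c d : R) : (a - b) * (c - d) = a * c + b * d - (a * d + b * c).
Proof. by ring. Qed.

Let corr_second_diff h :
  \int[mu]_x ((v x - v (x + h)) * (phi x - phi (x + h))) = sdiff (corr v phi) 0 h.
Proof.
pose f1 x := v (x + 0) * phi (x + 0).
pose f2 x := v (x + h) * phi (x + h).
pose f3 x := v (x + 0) * phi (x + h).
pose f4 x := v (x + h) * phi (x + 0).
rewrite (@eq_Rintegral _ _ _ _ _ (fun x => (f1 x + f2 x) - (f3 x + f4 x))); last first.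
  move=> x _; rewrite /f1 /f2 /f3 /f4 !addr0; exact: expand.
have i12 : mu.-integrable setT (EFin \o (fun x => f1 x + f2 x)).
  by have := integrableD measurableT (corr_integrable 0 0) (corr_integrable h h); apply: eq_integrable.
have i34 : mu.-integrable setT (EFin \o (fun x => f3 x + f4 x)).
  by have := integrableD measurableT (corr_integrable 0 h) (corr_integrable h 0); apply: eq_integrable.
rewrite RintegralB// (RintegralD measurableT (corr_integrable 0 0) (corr_integrable h h)).
rewrite (RintegralD measurableT (corr_integrable 0 h) (corr_integrable h 0)).
rewrite /sdiff !corr_shift !subrr !sub0r !subr0 add0r; ring.
Qed.

(** Symmetrisation of the energy: after the substitution [y = x + h] and
    Fubini, the near part of the form acts on second differences of the
    correlation of [v] with [phi]. *)
Lemma near_form (S : 'rV[R]_N -> R) : sdiff (corr v phi) 0 = S ->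
  mu.-integrable (ann 0 1) (EFin \o (fun h => S h * kern h)) /\
  \int[mu]_x \int[mu]_(y in eball x 1) ((v x - v y) * (phi x - phi y) / enorm (x - y) ^+ N)
  = \int[mu]_(h in ann 0 1) (S h * kern h).
Proof.
move=> <-.
have FE h x : F (x, h) = (v x - v (x + h)) * (phi x - phi (x + h)) * (kern h * \1_(ann 0 1) h) by [].
have outer h : (\int[mu]_x (F (x, h))%:E)%E =
    (((fun h => sdiff (corr v phi) 0 h * kern h) \_ (ann 0 1)) h)%:E.
  have intq : mu.-integrable setT (EFin \o (fun x => (v x - v (x + h)) * (phi x - phi (x + h)))).
    have := integrableB measurableT (integrableD measurableT (corr_integrable 0 0) (corr_integrable h h))
      (integrableD measurableT (corr_integrable 0 h) (corr_integrable h 0)).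
    apply: eq_integrable => // x _ /=; rewrite !addr0; congr EFin; exact/esym/expand.
  under eq_integral do rewrite FE EFinM.
  rewrite integralZr// -[(\int[mu]_x _)%E]fineK; last exact: integrable_fin_num.
  rewrite -/(Rintegral mu setT (fun x => (v x - v (x + h)) * (phi x - phi (x + h)))).
  rewrite corr_second_diff -EFinM patchE indicE; congr EFin.
  by case: ifP => _; rewrite ?mulr1 ?mulr0.
split.
  have iG : mu.-integrable setT (fubini_G mu (EFin \o F)).
    apply/integrableP; split; first exact: measurable_fubini_G integrable_F.
    have mEF : measurable_fun setT (EFin \o F) by exact/measurable_EFinP.
    have fin := (integrable21ltyP mu mu mEF).1 integrable_F.
    apply: (le_lt_trans _ fin).
    apply: ge0_le_integral => //.
    - by apply: measurableT_comp => //; exact: measurable_fubini_G integrable_F.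
    - apply: (measurable_fun_fubini_tonelli_G (m1 := mu) (abse \o (EFin \o F))) => //.
        exact: measurableT_comp.
      by move=> p; exact: abse_ge0.
    - move=> h _; apply: le_abse_integral => //.
      exact: (measurableT_comp mEF (measurable_pair2 h)).
  move: iG; rewrite (integrable_mkcond _ (measurable_ann _ _)) restrict_EFin.
  by apply: eq_integrable => // h _; rewrite /fubini_G /= outer.
transitivity (\int[mu]_x \int[mu]_h F (x, h)).
  apply: eq_Rintegral => x _; rewrite Rintegral_mkcond.
  set G := (_ \_ _).
  have mG : measurable_fun setT G.
    apply/(measurable_restrictT _ (measurable_eball _ _)); apply: measurable_funTS.
    apply: measurable_funM.
      by apply: measurable_funM; apply: measurable_funB.
    rewrite (_ : (fun _ => _) = kern \o (fun y => (-1) *: y + x)).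
      by apply: measurableT_comp; [exact: measurable_kern|exact: measurable_affine_rV].
    by apply/funext => y /=; rewrite scaleN1r addrC.
  rewrite -(Rintegral_translation x G mG); apply: eq_Rintegral => h _.
  rewrite /G patchE FE (addrC h) /kern indicE.
  have E : enorm (x - (x + h)) = enorm h by rewrite opprD addrA subrr add0r enormN.
  rewrite E (_ : (x + h \in eball x 1) = (h \in ann 0 1)).
    by case: ifP => _; rewrite ?mulr1 ?mulr0.
  apply: asbool_equiv_eq; rewrite /eball/= /ann/= addrAC subrr add0r enorm_ge0.
  by [].
rewrite [RHS]Rintegral_mkcond /Rintegral.
under eq_integral do rewrite fineK ?(integrable_fin_num _ (F_inner _))//.
rewrite (Fubini integrable_F) /=; congr fine.
by apply: eq_integral => h _; rewrite outer.
Qed.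

End NearForm.

(** * Positivity of the constant in front of the form *)

Section GammaPositive.
Context {R : realType}.
Local Notation leb := (@lebesgue_measure R).

Let gam (s t : R) : R := t `^ (s - 1) * expR (- t).

Let gam_ge0 s t : 0 <= gam s t.
Proof. by rewrite mulr_ge0 ?powR_ge0 ?expR_ge0. Qed.

Let measurable_gam s : measurable_fun setT (EFin \o gam s).
Proof.
apply/measurable_EFinP; apply: measurable_funM; first exact: measurable_powR.
by apply: (measurableT_comp (@measurable_expR R)); exact: measurable_funN.
Qed.

(* on ]4^-(k+1), 4^-k] the integrand is at most t^(-1/2) <= 2^(k+1) *)
Let gamma_low_lty s : 2^-1 <= s -> (\int[leb]_(t in `]0%R, 1%R]) (gam s t)%:E < +oo)%E.
Proof.
move=> s2; pose F (k : nat) : set R := `]4 ^- k.+1, 4 ^- k]%classic.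
have mF k : measurable (F k : set (measurableTypeR R)) by exact: measurable_itv.
have p4 k : 0 < 4 ^- k :> R by rewrite invr_gt0 exprn_gt0.
have le4 i j : (i <= j)%N -> 4 ^- j <= 4 ^- i :> R.
  by move=> ij; rewrite lef_pV2 ?posrE ?exprn_gt0// ler_weXn2l// ler1n.
have -> : `]0%R, 1%R]%classic = \bigcup_k F k :> set R.
  rewrite predeqE => t; split => [|[k _]]; rewrite /F /= !in_itv/= => /andP[t0 t1]; last first.
    by rewrite (lt_trans (p4 k.+1) t0) (le_trans t1)// -[leRHS]invr1; apply: (le4 0).
  have ex : exists k : nat, 4 ^- k.+1 < t.
    have t20 : 0 < t / 2 by rewrite divr_gt0.
    have [k kt] := ex_dyadic_le _ t20; exists k.
    apply: (@le_lt_trans _ _ (t / 2)); last by rewrite ltr_pdivrMr//; lra.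
    apply: le_trans kt; rewrite lef_pV2 ?posrE ?exprn_gt0//.
    apply: (@le_trans _ _ (2 ^+ k.+1)); first by rewrite ler_weXn2l// ler1n.
    by rewrite lerXn2r ?nnegrE//; lra.
  have [k kt kmin] := ex_minnP ex; exists k => //; rewrite /F/= in_itv/= kt/=.
  case: k kt kmin => [|k] kt kmin; first by rewrite expr0 invr1.
  by rewrite leNgt; apply/negP => /kmin; rewrite ltnn.
rewrite ge0_integral_bigcup//; last 3 first.
- apply: measurable_funTS; exact: measurable_gam.
- by move=> t _; rewrite lee_fin gam_ge0.
- apply: ltn_trivIset => j i ij; rewrite -subset0 => t [].
  rewrite /F /= !in_itv/= => /andP[h1 h2] /andP[h3 h4].
  have : t < t; last by rewrite ltxx.
  by apply: (le_lt_trans h4); apply: (le_lt_trans _ h1); exact: le4.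
apply: (@le_lt_trans _ _ 4%:E); last exact: ltry.
apply: (@le_trans _ _ (\sum_(0 <= k <oo) (2 * 2 ^- k)%:E)%E).
  apply: lee_nneseries => [k _ _|k _].
    by apply: integral_ge0 => t _; rewrite lee_fin gam_ge0.
  apply: (@le_trans _ _ (\int[leb]_(t in F k) (2 ^+ k.+1)%:E)%E).
    apply: ge0_le_integral => //.
    - by move=> t _; rewrite lee_fin gam_ge0.
    - apply: measurable_funTS; exact: measurable_gam.
    - move=> t; rewrite /F/= in_itv/= => /andP[tk tk1]; rewrite lee_fin.
      have t0 : 0 < t by exact: lt_trans (p4 _) tk.
      have t1 : t <= 1 by apply: (le_trans tk1); rewrite -[leRHS]invr1; apply: (le4 0).
      apply: (@le_trans _ _ (t `^ (- 2^-1) * 1)).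
        apply: ler_pM; rewrite ?powR_ge0 ?expR_ge0//; last by rewrite expR_le1 oppr_le0 ltW.
        by apply: ger_powR; [rewrite t0|lra].
      rewrite mulr1 powRN (powR12_sqrt (ltW t0)) -[leRHS]invrK lef_pV2 ?posrE ?sqrtr_gt0 ?invr_gt0 ?exprn_gt0//.
      rewrite -[leLHS]ger0_norm ?invr_ge0 ?exprn_ge0// -sqrtr_sqr ler_wsqrtr//.
      rewrite exprVn -exprM mulnC exprM; apply: le_trans (ltW tk).
      by rewrite (_ : 2 ^+ 2 = 4 :> R)//; rewrite -natrX.
  have lF : leb (F k) = (4 ^- k - 4 ^- k.+1)%:E.
    rewrite lebesgue_measure_itv/= lte_fin ltf_pV2 ?posrE ?exprn_gt0//.
    by rewrite ltr_eXn2l ?ltr1n// ltnSn -EFinB.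
  rewrite integral_cst// [X in (_ * X)%E]lF -EFinM lee_fin.
  rewrite (_ : 4 ^- k = 2 ^- k * 2 ^- k :> R); last first.
    by rewrite -invfM -exprMn; congr (_ ^- _); lra.
  rewrite (_ : 2 ^+ k.+1 * _ =
    2 ^+ k.+1 * 2 ^- k * 2 ^- k - 2 ^+ k.+1 * 4 ^- k.+1); last by ring.
  rewrite exprS -(mulrA 2) mulfV ?expf_neq0// mulr1 gerBl.
  by rewrite -exprS mulr_ge0 ?invr_ge0 ?exprn_ge0.
apply: lime_le.
  by apply: is_cvg_nneseries => k _ _; rewrite lee_fin mulr_ge0// invr_ge0 exprn_ge0.
apply: nearW => n; rewrite sumEFin lee_fin.
suff : \sum_(0 <= k < n) (2 * 2 ^- k : R) = 4 - 4 * 2 ^- n.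
  by move=> ->; rewrite gerBl mulr_ge0// invr_ge0 exprn_ge0.
elim: n => [|n IHn]; first by rewrite big_geq// expr0 invr1 mulr1 subrr.
by rewrite big_nat_recr//= IHn exprS invfM; lra.
Qed.

Let gamma_high_lty s : (\int[leb]_(t in `]1%R, +oo[) (gam s t)%:E < +oo)%E.
Proof.
have [M sM] : exists M : nat, s - 1 <= M.+1%:R.
  exists (Num.truncn `|s - 1|).
  by apply: le_trans (ler_norm _) _; apply: ltW; exact: truncnS_gt.
pose C : R := 2 ^+ M.+1 * M.+1`!%:R * 2.
have C0 : 0 <= C by rewrite !mulr_ge0// exprn_ge0.
have hp : 0 < 2^-1 :> R by rewrite invr_gt0.
have ip := integrable_exponential_pdf hp.
have mp : measurable_fun setT (fun t : R => (exponential_pdf 2^-1 t)%:E).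
  apply/measurable_EFinP; exact: measurable_exponential_pdf.
have := integral_exponential_pdf hp => E1.
apply: (@le_lt_trans _ _ (\int[leb]_(t in `]1%R, +oo[) (C%:E * (exponential_pdf 2^-1 t)%:E))%E).
  apply: ge0_le_integral => //.
  - by move=> t _; rewrite lee_fin gam_ge0.
  - apply: measurable_funTS; exact: measurable_gam.
  - by apply: measurable_funeM; apply: measurable_funTS.
  - move=> t /=; rewrite in_itv/= andbT => t1; rewrite -EFinM lee_fin.
    have t0 : 0 <= t by lra.
    rewrite exponential_pdfE// /gam.
    have E : expR (- t) = expR (- (t / 2)) * expR (- 2^-1 * t).
      by rewrite -expRD; congr expR; lra.
    rewrite E mulrA [leRHS]mulrA; apply: ler_wpM2r; first exact: expR_ge0.
    have t20 : 0 <= t / 2 by lra.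
    have f0 : 0 < M.+1`!%:R :> R by rewrite ltr0n fact_gt0.
    have H : (t / 2) ^+ M.+1 / M.+1`!%:R <= expR (t / 2).
      by apply: le_trans (@expR_ge1Dxn R (t / 2) M t20); rewrite lerDr.
    rewrite ler_pdivrMr// exprMn exprVn in H.
    rewrite expRN ler_pdivrMr ?expR_gt0// /C mulfK//.
    apply: (@le_trans _ _ (t ^+ M.+1)).
      by rewrite -powR_mulrn//; apply: ler_powR => //; exact: ltW.
    have p2 : 0 < 2 ^+ M.+1 :> R by rewrite exprn_gt0.
    rewrite ler_pdivrMr// in H; apply: le_trans H _.
    by rewrite le_eqVlt; apply/orP; left; apply/eqP; ring.
rewrite ge0_integralZl//; last 2 first.
  exact: measurable_funTS.
  by move=> t _; rewrite lee_fin exponential_pdf_ge0// ltW.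
apply: lte_mul_pinfty => //.
apply: (@le_lt_trans _ _ (\int[leb]_t (exponential_pdf 2^-1 t)%:E)%E); last by rewrite E1 ltry.
by apply: ge0_subset_integral => // t _; rewrite lee_fin exponential_pdf_ge0// ltW.
Qed.

(** The integrand is positive, but a divergent integral would have the real
    value 0: finiteness is what has to be checked. For [s >= 1/2] the
    singularity at 0 is at most [t ^ (- 1/2)]. *)
Lemma Gamma_gt0 s : 2^-1 <= s -> 0 < Gamma s :> R.
Proof.
move=> s2; rewrite /Gamma /Rintegral.
have split01 : (\int[leb]_(t in `]0%R, +oo[) (gam s t)%:E =
   \int[leb]_(t in `]0%R, 1%R]) (gam s t)%:E + \int[leb]_(t in `]1%R, +oo[) (gam s t)%:E)%E.
  rewrite -ge0_integral_setU//.
  - congr (integral _ _ _); rewrite predeqE => t; split=> /=; rewrite !in_itv/= !andbT.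
      by move=> t0; have [t1|t1] := leP t 1; [left; rewrite t0|right].
    by case=> [/andP[]//|]; exact: lt_trans.
  - apply: measurable_funTS; exact: measurable_gam.
  - by move=> t _; rewrite lee_fin gam_ge0.
  - apply/disj_setPS => t [] /=; rewrite !in_itv/= andbT => /andP[_ t1] t1'.
    by have := le_lt_trans t1 t1'; rewrite ltxx.
have fin : (\int[leb]_(t in `]0%R, +oo[) (gam s t)%:E < +oo)%E.
  by rewrite split01 lte_add_pinfty ?gamma_low_lty ?gamma_high_lty.
rewrite fine_gt0// fin andbT.
have c0 : 0 < 2^-1 * expR (- 2) :> R by rewrite mulr_gt0 ?expR_gt0.
apply: (@lt_le_trans _ _ (\int[leb]_(t in `]1%R, 2%R]) (2^-1 * expR (- 2))%:E)%E).
  have l12 : leb (`]1%R, 2%R]%classic : set (measurableTypeR R)) = 1%E.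
    by rewrite lebesgue_measure_itv/= lte_fin ltr1n/= -EFinB; congr EFin; lra.
  by rewrite integral_cst// [X in (_ * X)%E]l12 mule1 lte_fin.
apply: (@le_trans _ _ (\int[leb]_(t in `]1%R, 2%R]) (gam s t)%:E)%E).
  apply: ge0_le_integral => //.
  - apply: measurable_funTS; exact: measurable_gam.
  - move=> t /=; rewrite in_itv/= => /andP[t1 t2]; rewrite lee_fin.
    apply: ler_pM; rewrite ?expR_ge0//; last by rewrite ler_expR lerN2.
    apply: (@le_trans _ _ (t `^ (- 1))).
      by rewrite powR_inv1 ?lef_pV2 ?posrE//; lra.
    by apply: ler_powR; [exact: ltW|lra].
apply: ge0_subset_integral => //.
- apply: measurable_funTS; exact: measurable_gam.
- by move=> t _; rewrite lee_fin gam_ge0.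
- by move=> t /=; rewrite !in_itv/= => /andP[t1 _]; rewrite andbT; lra.
Qed.

Lemma c_gt0 N : (1 <= N)%N -> 0 < c_ N :> R.
Proof.
move=> N1; rewrite mulr_gt0 ?powR_gt0 ?pi_gt0// Gamma_gt0//.
have : 1 <= N%:R :> R by rewrite ler1n.
by lra.
Qed.

End GammaPositive.

(** * A lower bound for the far part of the form *)

Section FarForm.
Context {R : realType} {N : nat}.
Local Notation mu := (@lebesgue_rV R N).
Implicit Types (x y z p : 'rV[R]_N).

Lemma lebesgue_rV_eball_gt0 p (r : R) : 0 < r -> (0 < mu (eball p r))%E.
Proof.
move=> r0; pose s := r / N.+1%:R.
have s0 : 0 < s by rewrite divr_gt0.
apply: (@lt_le_trans _ _ (mu (box (fun i => `[p 0 i - s, p 0 i + s]%classic)))).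
  by rewrite [ltRHS](lebesgue_rV_cube p s s0) lte_fin exprn_gt0// mulr_gt0.
apply: le_measure; rewrite ?inE.
- by apply: measurable_box => i; exact: measurable_itv.
- exact: measurable_eball.
- move=> y By; rewrite /eball/=.
  apply: (@le_lt_trans _ _ (N%:R * s)).
    apply: enorm_le_card => i; have := By i; rewrite /= in_itv/= !mxE => /andP[y1 y2].
    by rewrite ler_norml; apply/andP; split; lra.
  by rewrite /s mulrA ltr_pdivrMr// mulrC ltr_pM2l// ltr_nat.
Qed.

Lemma lebesgue_rV_eball_fin_num p (r : R) : 0 < r -> mu (eball p r) \is a fin_num.
Proof.
move=> r0; rewrite ge0_fin_numE//.
exact: le_lt_trans (lebesgue_rV_eball_le p r r0) (ltry _).
Qed.

(** The part over the ball about [p] times the support of [phi] gives the bound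
    at once by Tonelli. The double integral has to be finite, though, because
    a divergent one would have the real value 0: as [phi] has compact support,
    the integrand is at most a constant times
    [|v x| / (1 + |x|) ^ N * phi y]. *)
Lemma far_form_ge (v phi : 'rV[R]_N -> R) z p (sig rK c d : R) :
  continuous v -> (forall x, 0 <= v x) ->
  (\int[mu]_x (`|v x| / (1 + enorm x) ^+ N)%:E < +oo)%E ->
  continuous phi -> (forall x, 0 <= phi x) ->
  (forall x, phi x != 0 -> enorm (x - z) <= sig) -> \int[mu]_x phi x = 1 ->
  0 < rK -> 0 <= c -> 0 < d -> 0 <= sig ->
  (forall x, eball p rK x -> c <= v x) ->
  (forall x y, eball p rK x -> enorm (y - z) <= sig -> 1 <= enorm (x - y) <= d) ->
  c * d ^- N * fine (mu (eball p rK)) <=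
  \int[(mu \x mu)%E]_(q in [set q : 'rV[R]_N * 'rV[R]_N | 1 <= enorm (q.1 - q.2)])
    (v q.1 * phi q.2 / enorm (q.1 - q.2) ^+ N).
Proof.
move=> cv v0 vL cphi phi0 phis phi1 rK0 c0 d0 sig0 vK dK.
set S := [set q : _ * _ | _].
have mfst : measurable_fun setT (fun q : 'rV[R]_N * 'rV[R]_N => q.1) by exact: measurable_fst.
have msnd : measurable_fun setT (fun q : 'rV[R]_N * 'rV[R]_N => q.2) by exact: measurable_snd.
have mB : measurable_fun setT (fun q : 'rV[R]_N * 'rV[R]_N => q.1 - q.2).
  apply: measurable_fun_coordP => i; under eq_fun do rewrite !mxE.
  apply: measurable_funB; [exact: (measurableT_comp (measurable_coord i) mfst)|
    exact: (measurableT_comp (measurable_coord i) msnd)].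
have mE : measurable_fun setT (fun q : 'rV[R]_N * 'rV[R]_N => enorm (q.1 - q.2)).
  exact: (measurableT_comp (@measurable_enorm R N) mB).
have mS : measurable S.
  have := @measurable_fun_ler _ _ R setT (cst 1) _ (measurable_cst _) mE.
  by move=> /(_ measurableT [set true]); rewrite setTI; apply.
have mv : measurable_fun setT v by exact: continuous_measurable_rV.
have mphi : measurable_fun setT phi by exact: continuous_measurable_rV.
have iphi : mu.-integrable setT (EFin \o phi) by exact: (integrable_csupp _ z sig).
have Ephi : (\int[mu]_x (phi x)%:E = 1)%E.
  rewrite -[LHS]fineK; last exact: (integrable_fin_num measurableT iphi).
  by rewrite -[fine _]/(\int[mu]_x phi x) phi1.
have mG : measurable_fun setT (fun q => v q.1 * phi q.2 / enorm (q.1 - q.2) ^+ N).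
  apply: measurable_funM.
    by apply: measurable_funM; [exact: (measurableT_comp mv)|exact: (measurableT_comp mphi)].
  exact: (measurableT_comp (@measurable_kern R N) mB).
set G := (fun q => _ / _) in mG *.
have G0 q : 0 <= G q by rewrite mulr_ge0 ?mulr_ge0 ?invr_ge0 ?exprn_ge0 ?enorm_ge0.
pose f : 'rV[R]_N * 'rV[R]_N -> \bar R := (EFin \o G) \_ S.
have mf : measurable_fun setT f.
  by apply/(measurable_restrictT _ mS); apply: measurable_funTS; exact/measurable_EFinP.
have f0 q : (0 <= f q)%E by apply: erestrict_ge0 => t _; rewrite lee_fin.
have IE : (\int[(mu \x mu)%E]_(q in S) (G q)%:E = \int[mu]_x \int[mu]_y f (x, y))%E.
  by rewrite integral_mkcond fubini_tonelli1.
have mF : measurable_fun setT (fun x => \int[mu]_y f (x, y))%E.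
  exact: (measurable_fun_fubini_tonelli_F (m2 := mu) f).
have R00 : 0 <= enorm z + sig by rewrite addr_ge0 ?enorm_ge0.
pose C := (2 + (enorm z + sig)) ^+ N.
have C0 : 0 <= C by rewrite exprn_ge0//; lra.
pose g x : R := `|v x| / (1 + enorm x) ^+ N.
have n1 x : 0 < (1 + enorm x) ^+ N by rewrite exprn_gt0// ltr_wpDr ?enorm_ge0.
have mg : measurable_fun setT g.
  apply: measurable_funM; first exact: measurableT_comp.
  rewrite (_ : (fun x => _) = fun x => ((1 + enorm x) ^+ N) `^ (-1)).
    apply: (measurableT_comp (measurable_powR _)); apply: measurable_funX.
    by apply: measurable_funD => //; exact: measurable_enorm.
  by apply/funext => x; rewrite powR_inv1// ltW.
have g0 x : 0 <= g x by rewrite divr_ge0// ltW.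
have mphis x : measurable_fun setT (fun y => f (x, y)) by exact: (measurableT_comp mf (measurable_pair1 x)).
have Ffin : (\int[mu]_x \int[mu]_y f (x, y) < +oo)%E.
  apply: (@le_lt_trans _ _ (\int[mu]_x (C%:E * (g x)%:E))%E); last first.
    rewrite ge0_integralZl//; [|exact/measurable_EFinP|by move=> x _; rewrite lee_fin].
    by apply: lte_mul_pinfty; rewrite ?lee_fin.
  apply: ge0_le_integral => //.
  - by move=> x _; exact: integral_ge0.
  - by apply: measurable_funeM; exact/measurable_EFinP.
  - move=> x _; apply: (@le_trans _ _ (\int[mu]_y ((C * g x)%:E * (phi y)%:E))%E).
      apply: ge0_le_integral => //.
      - by apply: measurable_funeM; exact/measurable_EFinP.
      - move=> y _; rewrite /f patchE; case: ifPn => [|_]; last first.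
          by rewrite -EFinM lee_fin; apply: mulr_ge0 => //; exact: mulr_ge0.
        rewrite inE /S/= => xy; rewrite -EFinM lee_fin /G/=.
        have [->|py] := eqVneq (phi y) 0; first by rewrite !mulr0 mul0r.
        rewrite mulrAC ler_wpM2r// /C /g ger0_norm// mulrCA ler_wpM2l//.
        have e0 : 0 < enorm (x - y) ^+ N by rewrite exprn_gt0//; lra.
        rewrite -[leRHS](mulrC) ler_pdivlMl// ler_pdivrMr// -exprMn mulrC.
        apply: lerXn2r; rewrite ?nnegrE ?mulr_ge0 ?addr_ge0 ?enorm_ge0//.
        have y1 : enorm y <= enorm z + sig.
          have := enormD_le (y - z) z; rewrite subrK.
          by have := phis y py; lra.
        have := enormD_le (x - y) y; rewrite subrK.
        by nra.
    rewrite ge0_integralZl//.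
    - by rewrite Ephi mule1 EFinM.
    - exact/measurable_EFinP.
    - by move=> y _; rewrite lee_fin.
    - by rewrite lee_fin mulr_ge0.
have low : ((c * d ^- N)%:E * mu (eball p rK) <= \int[mu]_x \int[mu]_y f (x, y))%E.
  have mK := measurable_eball p rK.
  have cd0 : 0 <= c * d ^- N by rewrite mulr_ge0// invr_ge0 exprn_ge0// ltW.
  rewrite -[X in (_ * mu X)%E]setIT -integral_indic//.
  rewrite -ge0_integralZl//; last by apply/measurable_EFinP; exact: measurable_indic.
  apply: ge0_le_integral => //.
  - by move=> x _; rewrite -EFinM lee_fin mulr_ge0.
  - by apply: measurable_funeM; apply/measurable_EFinP; exact: measurable_indic.
  - move=> x _; rewrite indicE; have [xK|xK] := boolP (x \in eball p rK); last first.
      by rewrite mule0; exact: integral_ge0.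
    rewrite mule1.
    apply: (@le_trans _ _ (\int[mu]_y ((c * d ^- N)%:E * (phi y)%:E))%E).
      rewrite ge0_integralZl//.
      - by rewrite Ephi mule1.
      - exact/measurable_EFinP.
      - by move=> y _; rewrite lee_fin.
    apply: ge0_le_integral => //.
    - by move=> y _; rewrite -EFinM lee_fin mulr_ge0.
    - by apply: measurable_funeM; exact/measurable_EFinP.
    - move=> y _; rewrite /f patchE -EFinM.
      have [->|py] := eqVneq (phi y) 0.
        by rewrite mulr0; case: ifP => // _; rewrite lee_fin.
      have xK' : eball p rK x by rewrite inE in xK.
      have /andP[d1 d2] := dK x y xK' (phis y py).
      rewrite ifT; last by rewrite inE.
      rewrite lee_fin /G/= [leRHS]mulrAC ler_wpM2r//; apply: ler_pM => //.
      + by rewrite invr_ge0 exprn_ge0// ltW.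
      + exact: vK.
      + have e0 : 0 < enorm (x - y) by lra.
        by rewrite lef_pV2 ?posrE ?exprn_gt0// lerXn2r ?nnegrE// ltW.
rewrite -lee_fin /Rintegral fineK; last first.
  rewrite ge0_fin_numE; first by rewrite IE.
  by apply: integral_ge0 => q _; rewrite lee_fin.
rewrite IE EFinM fineK//; exact: lebesgue_rV_eball_fin_num.
Qed.

End FarForm.

(** * Mollified functions *)

Section Mollify.
Context {R : realType} {N : nat}.
Local Notation mu := (@lebesgue_rV R N).
Implicit Types (v : 'rV[R]_N -> R) (x y z h : 'rV[R]_N) (rho c : R).

Definition mollify v rho z : R := \int[mu]_x (v x * moll rho z x).

Lemma integrable_mollify v rho z : continuous v ->
  mu.-integrable setT (EFin \o (fun x => v x * moll rho z x)).
Proof.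
move=> cv; apply: (integrable_csupp _ z (N%:R * rho)).
  by move=> x; apply: continuousM; [exact: cv|exact: continuous_moll].
by move=> x; rewrite mulf_eq0 negb_or => /andP[_]; exact: moll_supp.
Qed.

(** Mollifiers are translates of one another, so correlating with one of them is
    evaluating the mollified function. *)
Lemma corr_moll v rho z h : continuous v ->
  corr v (moll rho z) h = mollify v rho (z + h).
Proof.
move=> cv; rewrite /mollify -(Rintegral_translation h (fun x => v x * moll rho (z + h) x)).
  by apply: eq_Rintegral => x _; rewrite mollD.
apply: continuous_measurable_rV => x.
by apply: continuousM; [exact: cv|exact: continuous_moll].
Qed.

Lemma mollify_ge0 v rho z : 0 < rho -> (forall x, 0 <= v x) -> 0 <= mollify v rho z.
Proof. by move=> r0 v0; apply: Rintegral_ge0 => x _; rewrite mulr_ge0// moll_ge0. Qed.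

Lemma integrable_moll rho z : mu.-integrable setT (EFin \o moll rho z).
Proof.
apply: (integrable_csupp _ z (N%:R * rho)); first exact: continuous_moll.
exact: moll_supp.
Qed.

Lemma Rintegral_Zmoll rho z c : 0 < rho -> \int[mu]_x (c * moll rho z x) = c.
Proof.
by move=> r0; rewrite RintegralZl//; [rewrite integral_moll// mulr1|exact: integrable_moll].
Qed.

Lemma mollify_ge v rho z c : continuous v -> 0 < rho ->
  (forall x, enorm (x - z) <= N%:R * rho -> c <= v x) -> c <= mollify v rho z.
Proof.
move=> cv r0 vc; rewrite -[leLHS](Rintegral_Zmoll rho z c r0); apply: le_Rintegral => //.
- have /(integrableZl measurableT c) := integrable_moll rho z.
  by apply: eq_integrable.
- exact: integrable_mollify.
- move=> x _; have [->|mx] := eqVneq (moll rho z x) 0; first by rewrite !mulr0.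
  by rewrite ler_wpM2r ?moll_ge0// vc// moll_supp.
Qed.

Lemma mollify_le v rho z c : continuous v -> 0 < rho ->
  (forall x, enorm (x - z) <= N%:R * rho -> v x <= c) -> mollify v rho z <= c.
Proof.
move=> cv r0 vc; rewrite -[leRHS](Rintegral_Zmoll rho z c r0); apply: le_Rintegral => //.
- exact: integrable_mollify.
- have /(integrableZl measurableT c) := integrable_moll rho z.
  by apply: eq_integrable.
- move=> x _; have [->|mx] := eqVneq (moll rho z x) 0; first by rewrite !mulr0.
  by rewrite ler_wpM2r ?moll_ge0// vc// moll_supp.
Qed.

Lemma continuous_mollify v rho : continuous v -> 0 < rho -> continuous (mollify v rho).
Proof.
move=> cv r0; apply/continuous_enormP => z e e0.
have m0 := bump_mass_gt0 (N := N) rho r0.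
pose B := eball z (N%:R * rho + 2).
have Br : 0 < N%:R * rho + 2 by rewrite ltr_wpDl// mulr_ge0// ltW.
have mB : measurable B by exact: measurable_eball.
have cK : compact [set x | enorm (x - z) <= N%:R * rho + 3] by exact: compact_cball.
have [M M0 MP] : exists2 M, 0 <= M & forall x, enorm (x - z) <= N%:R * rho + 3 -> `|v x| <= M.
  have [M [_ MP]] := compact_bounded (continuous_compact (continuous_subspaceT cv) cK).
  exists (`|M| + 1) => [|x Kx]; first by rewrite addr_ge0.
  apply: (MP (`|M| + 1)); last by exists x.
  by rewrite (le_lt_trans (ler_norm M))// ltrDl.
pose L : R := 4 * N%:R / bump_mass (R := R) (N := N) rho.
have L0 : 0 <= L by rewrite divr_ge0 ?mulr_ge0// ltW.
have muB0 : 0 <= fine (mu B) by exact: fine_ge0.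
pose Q := M * L * fine (mu B).
have Q0 : 0 <= Q by rewrite /Q; apply: mulr_ge0 => //; exact: mulr_ge0.
exists (Num.min 1 (e / (Q + 1))); first by rewrite lt_min ltr01 divr_gt0//; lra.
move=> y; rewrite lt_min => /andP[y1 y2].
have iy := integrable_mollify v rho y cv; have iz := integrable_mollify v rho z cv.
rewrite /mollify -RintegralB//.
have idf : mu.-integrable setT
    (EFin \o (fun x => v x * moll rho y x - v x * moll rho z x)).
  by have := integrableB measurableT iy iz; apply: eq_integrable.
apply: le_lt_trans (le_normr_Rintegral measurableT idf) _.
have iB : mu.-integrable setT (EFin \o (\1_B : _ -> R)).
  apply/integrableP; split; first by apply/measurable_EFinP; exact: measurable_indic.
  under eq_integral do rewrite /= ger0_norm//.
  rewrite integral_indic// setIT -ge0_fin_numE//; exact: lebesgue_rV_eball_fin_num.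
have icst : mu.-integrable setT (EFin \o (fun x => M * (L * enorm (y - z)) * \1_B x)).
  by move: iB => /(integrableZl measurableT (M * (L * enorm (y - z)))); apply: eq_integrable.
apply: (@le_lt_trans _ _ (\int[mu]_x (M * (L * enorm (y - z)) * \1_B x))).
  apply: le_Rintegral => //.
    by have := integrable_abse idf; apply: eq_integrable.
  move=> x _; rewrite -mulrBr normrM indicE.
  have [xB|xB] := boolP (x \in B).
    rewrite mulr1; apply: ler_pM => //.
      by apply: MP; move: xB; rewrite inE /B /eball/=; lra.
    have := moll_lip rho 0 (x - y) (x - z) r0.
    rewrite /moll !subr0 (_ : x - y - (x - z) = - (y - z)) ?enormN//.
    by rewrite !opprB addrC addrA subrK.
  rewrite mulr0.
  have xf : N%:R * rho + 2 <= enorm (x - z).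
    by move: xB; rewrite notin_setE /B /eball/= => /negP; rewrite -leNgt.
  have -> : moll rho y x = 0.
    apply/eqP; apply: contraTT xf => /moll_supp xy; rewrite -ltNge.
    by have := enormB_le x y z; lra.
  have -> : moll rho z x = 0.
    by apply/eqP; apply: contraTT xf => /moll_supp xy; rewrite -ltNge; lra.
  by rewrite subrr normr0 mulr0.
rewrite RintegralZl//.
rewrite (_ : \int[mu]_x \1_B x = fine (mu B)); last first.
  by rewrite /Rintegral integral_indic// setIT.
rewrite (_ : _ * _ * _ = Q * enorm (y - z)); last by rewrite /Q; ring.
move: y2; rewrite ltr_pdivlMr; last by lra.
by have := enorm_ge0 (y - z); nra.
Qed.

End Mollify.

(** * Comparison with the barrier *)

Section Comparison.
Context {R : realType} {N : nat}.
Local Notation mu := (@lebesgue_rV R N).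
Local Notation kern := (@kern R N).
Local Notation ann := (@ann R N).
Local Notation kap := (@kap R N).
Implicit Types (v : 'rV[R]_N -> R) (x y z h p : 'rV[R]_N) (rho c r : R).

Definition weakly_superharmonic (Omega : set 'rV[R]_N) v :=
  forall phi : 'rV[R]_N -> R, test_function Omega phi ->
    (forall x, Omega x -> 0 <= phi x) -> 0 <= E_L v phi.

(** Mollification commutes with the operator, so testing with the mollifier at
    [z] evaluates the operator on the mollified function at [z]; only the far
    part is left in weak form. *)
Lemma E_L_moll v rho z V : continuous v -> 0 < rho -> V = mollify v rho ->
  mu.-integrable (ann 0 1) (EFin \o (fun h => sdiff V z h * kern h)) /\
  E_L v (moll rho z) =
    c_ N / 2 * \int[mu]_(h in ann 0 1) (sdiff V z h * kern h)
    - c_ N * \int[(mu \x mu)%E]_(q in [set q : 'rV[R]_N * 'rV[R]_N | 1 <= enorm (q.1 - q.2)])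
        (v q.1 * moll rho z q.2 / enorm (q.1 - q.2) ^+ N)
    + rho_ N * V z.
Proof.
move=> cv r0 ->.
have E : sdiff (corr v (moll rho z)) 0 = sdiff (mollify v rho) z.
  apply/funext => h; rewrite /sdiff.
  rewrite (corr_moll v rho z 0 cv) (corr_moll v rho z (0 + h) cv) (corr_moll v rho z (0 - h) cv).
  by rewrite addr0 add0r sub0r.
have [intf nf] := near_form v (moll rho z) z (N%:R * rho) _ cv
  (@continuous_moll R N rho z) (@moll_supp R N rho z)
  (fun x y => moll_lip rho z x y r0) _ E.
split; first exact: intf.
by rewrite /E_L nf.
Qed.

(** The lower bound [c] for [v] on a ball away from the barrier contributes a
    strictly negative amount to the operator, which outweighs the bounded
    contribution of the barrier once the latter is multiplied by a small
    constant. The alternative in the last hypothesis says whether that ball is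
    seen from the barrier through the near part of the form or through the far
    part. *)
Lemma barrier_comparison (Omega : set 'rV[R]_N) v y0 p (r0 rK c d : R) (n : nat) :
  (1 <= N)%N -> continuous v -> (forall x, 0 <= v x) ->
  (\int[mu]_x (`|v x| / (1 + enorm x) ^+ N)%:E < +oo)%E ->
  weakly_superharmonic Omega v ->
  0 < r0 -> r0 <= 4^-1 -> eball y0 r0 `<=` Omega ->
  (4 <= n)%N -> `|rho_ N| <= c_ N * (n%:R * kap) ->
  0 < rK -> 0 < c -> 0 < d -> (forall x, eball p (2 * rK) x -> c <= v x) ->
  (forall x z, eball p rK x -> eball y0 r0 z -> 2 ^- n <= enorm (x - z) < 1) \/
  (forall x z, eball p rK x -> eball y0 r0 z -> 1 <= enorm (x - z) <= d) ->
  exists2 eps : R, 0 < eps & forall r z, r0 / 2 <= r -> r < r0 ->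
    eps * barrier y0 r z <= v z.
Proof.
move=> N1 cv v0 vL sup r00 r04 yO n4 rhoN rK0 c0 d0 vK dich.
have cN : 0 < c_ N :> R by exact: c_gt0.
have K0 : 0 <= kap by exact: kap_ge0.
have [C C0 CP] := barrier_bound (N := N) n r0 r00 r04 n4.
pose mK : R := fine (mu (eball p rK)).
have mK0 : 0 < mK.
  apply: fine_gt0; rewrite lebesgue_rV_eball_gt0//=.
  exact: le_lt_trans (lebesgue_rV_eball_le p rK rK0) (ltry _).
(* [eps * A] bounds the contribution of the barrier, and [B] is that of the
   ball about [p] *)
pose A : R := c_ N / 2 * (C + 2 * (n%:R * kap)) + `|rho_ N|.
have A0 : 0 <= A.
  by rewrite addr_ge0// mulr_ge0 ?divr_ge0 ?(ltW cN)// addr_ge0// !mulr_ge0.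
pose B : R := Num.min (c_ N / 2 * (c * mK)) (c_ N * (c * d ^- N * mK)).
have B0 : 0 < B.
  have dN : 0 < d ^- N by rewrite invr_gt0 exprn_gt0.
  have c2 : 0 < c_ N / 2 :> R by rewrite divr_gt0.
  by rewrite lt_min (mulr_gt0 c2 (mulr_gt0 c0 mK0)) (mulr_gt0 cN (mulr_gt0 (mulr_gt0 c0 dN) mK0)).
have B1 : B <= c_ N / 2 * (c * mK) by rewrite ge_min lexx.
have B2 : B <= c_ N * (c * d ^- N * mK) by rewrite ge_min lexx orbT.
clearbody B.
pose eps := B / (A + 1).
have A1 : 0 < A + 1 by lra.
have eps0 : 0 < eps by rewrite divr_gt0.
have epsA : eps * A < B by rewrite /eps mulrAC ltr_pdivrMr//; nra.
have Aeq : eps * A = c_ N / 2 * (eps * C) + c_ N / 2 * (2 * eps * (n%:R * kap)) + `|rho_ N| * eps.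
  by rewrite /A; ring.
clearbody eps A.
exists eps => // r z0 r1 r2; rewrite leNgt; apply/negP => vz0.
have r_gt0 : 0 < r by lra.
have r4 : r <= 4^-1 by lra.
pose w := barrier y0 r.
have wE : w = barrier y0 r by [].
have wout z : r <= enorm (z - y0) -> w z = 0 by move=> zr; apply: barrier_out => //; exact: ltW.
have w_le1 z : w z <= 1 by exact: barrier_le1.
have w_ge0 z : 0 <= w z by exact: barrier_ge0.
have cw : continuous w by exact: continuous_barrier.
have vwz0 : v z0 < eps * w z0 by [].
clearbody w.
(* the midpoint leaves room to mollify [v] without losing the strict inequality
   at [z0] *)
pose q := (v z0 + eps * w z0) / 2.
have qE : q = (v z0 + eps * w z0) / 2 by [].
clearbody q.
have [s s0 sP] : exists2 s, 0 < s & forall x, enorm (x - z0) < s -> v x <= q.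
  have /continuous_enormP/(_ z0 (q - v z0)) := cv.
  have q0 : 0 < q - v z0 by rewrite qE; lra.
  move=> /(_ q0)[s s0 sP]; exists s => // x /sP; rewrite ltr_norml => /andP[_].
  by lra.
have N0 : 0 < N%:R :> R by rewrite ltr0n.
(* the radius of the mollifier: [v <= q] on a ball of this radius about [z0],
   [c <= v] near the ball about [p], and test functions stay supported in the
   tangent ball *)
pose sig := Num.min (s / 2) (Num.min rK ((r0 - r) / 2)).
have sig0 : 0 < sig by rewrite !lt_min rK0 !divr_gt0// subr_gt0.
have sig1 : sig < s.
  by apply: (@le_lt_trans _ _ (s / 2)); [rewrite ge_min lexx|rewrite ltr_pdivrMr//; lra].
have sig2 : sig <= rK by rewrite ge_min ge_min lexx orbT.
have sig3 : sig < r0 - r.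
  apply: (@le_lt_trans _ _ ((r0 - r) / 2)); first by rewrite !ge_min lexx !orbT.
  by rewrite ltr_pdivrMr//; lra.
pose rho := sig / N%:R.
have rho0 : 0 < rho by rewrite divr_gt0.
have Nrho : N%:R * rho = sig by rewrite /rho mulrC divfK// gt_eqF.
pose V := mollify v rho.
have VE : V = mollify v rho by [].
have V0 z : 0 <= V z by exact: mollify_ge0.
have Vz0 : V z0 <= q.
  by apply: mollify_le => // x; rewrite Nrho => xz; apply: sP; exact: le_lt_trans sig1.
have VK x : eball p rK x -> c <= V x.
  move=> xK; apply: mollify_ge => // t; rewrite Nrho => tx; apply: vK.
  by have H := enormB_le t x p; rewrite /eball/= in xK *; clear -H xK tx sig2; lra.
pose D z := eps * w z - V z.
have cD : continuous D.
  move=> z; have wz := cw z.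
  exact: cvgB (cvgMl_tmp (a := eps) wz) (continuous_mollify v rho cv rho0 z).
have DE t : D t = eps * w t - V t by [].
clearbody D.
clearbody V.
have D0 : 0 < D z0 by move: Vz0; rewrite DE qE; lra.
have Dout z : r <= enorm (z - y0) -> D z <= 0.
  by move=> /wout wz; rewrite DE wz mulr0 sub0r oppr_le0.
have z0in : enorm (z0 - y0) <= r.
  by rewrite leNgt; apply/negP => /ltW/Dout; rewrite leNgt D0.
have [z zK zmax] : exists2 z, z \in [set x | enorm (x - y0) <= r] &
    forall t, t \in [set x | enorm (x - y0) <= r] -> D t <= D z.
  apply: compact_EVT_max; [by exists z0|exact: compact_cball|exact: continuous_subspaceT].
have Dz0 : 0 < D z by apply: lt_le_trans D0 _; apply: zmax; rewrite inE.
have zr : enorm (z - y0) < r.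
  by rewrite ltNge; apply/negP => /Dout; rewrite leNgt Dz0.
have Dmax t : D t <= D z.
  have [tr|/ltW tr] := leP (enorm (t - y0)) r; first by apply: zmax; rewrite inE.
  exact: le_trans (Dout _ tr) (ltW Dz0).
have w1 := w_le1 z; have w0 := w_ge0 z.
have VD : V z = eps * w z - D z by rewrite DE; ring.
have Vle : V z <= eps - D z.
  by rewrite VD lerD2r -[leRHS]mulr1 ler_wpM2l// ltW.
have zin : eball y0 r0 z by exact: lt_trans zr r2.
have testz : test_function Omega (moll rho z).
  apply: moll_test_function => x; rewrite Nrho => xz; apply: yO; rewrite /eball/=.
  by have H := enormB_le x z y0; clear -H xz sig3 zr; lra.
have := sup _ testz (fun x _ => moll_ge0 rho z x rho0).
have [intV ->] := E_L_moll v rho z V cv rho0 VE.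
set T2 := \int[(mu \x mu)%E]_(_ in _) _.
have T20 : 0 <= T2.
  apply: Rintegral_ge0 => t _; apply: divr_ge0.
    by apply: mulr_ge0; [exact: v0|exact: moll_ge0].
  by rewrite exprn_ge0// enorm_ge0.
have h2n : 2 ^- n <= 1 :> R.
  by rewrite -[leRHS]invr1 lef_pV2 ?posrE ?exprn_gt0// exprn_ege1// ler1n.
have h2n0 : 0 < 2 ^- n :> R by rewrite invr_gt0 exprn_gt0.
rewrite (Rintegral_ann_split _ 0 (2 ^- n) 1 (ltW h2n0) h2n intV).
set Jin := \int[mu]_(h in ann 0 (2 ^- n)) _.
set Jout := \int[mu]_(h in ann (2 ^- n) 1) _.
have mann := @measurable_ann R N.
have intVi : mu.-integrable (ann 0 (2 ^- n)) (EFin \o (fun h => sdiff V z h * kern h)).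
  apply: integrableS intV; [exact: mann|exact: mann|exact: ann_sub].
have intVo : mu.-integrable (ann (2 ^- n) 1) (EFin \o (fun h => sdiff V z h * kern h)).
  by apply: integrableS intV; [exact: mann|exact: mann|apply: ann_sub => //; exact: ltW].
(* at a maximum of [eps * w - V] the second differences of [V] are at most
   those of [eps * w] *)
have Jin_le : Jin <= eps * C.
  have iw : mu.-integrable (ann 0 (2 ^- n)) (EFin \o (fun h => sdiff w z h * kern h)).
    rewrite wE; apply: integrableS (integrable_sdiff_barrier y0 r z r_gt0 r4 zr);
      [exact: mann|exact: mann|exact: ann_sub].
  apply: (@le_trans _ _ (\int[mu]_(h in ann 0 (2 ^- n)) (eps * (sdiff w z h * kern h)))).
    apply: le_Rintegral => //.
      by have /(integrableZl (mann _ _) eps) := iw; apply: eq_integrable => //; exact: mann.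
    move=> h _; rewrite mulrA ler_wpM2r ?kern_ge0//.
    have Dp := Dmax (z + h); have Dm := Dmax (z - h).
    by rewrite !DE in Dp Dm; rewrite /sdiff; clear -Dp Dm; lra.
  rewrite RintegralZl// ler_wpM2l//; first exact: ltW.
  by rewrite wE; apply: CP => //; exact: ltW.
(* outside the small ball only [eps * w <= eps] is used; the term [- D z] is
   kept, as it has to absorb the zero order term *)
have far_sdiff h : sdiff V z h <= 2 * (eps - D z) - V (z + h).
  by have Vh := V0 (z - h); rewrite /sdiff; clear -Vh Vle; lra.
have iok : mu.-integrable (ann (2 ^- n) 1) (EFin \o kern) by exact: integrable_kern.
have iok2 : mu.-integrable (ann (2 ^- n) 1) (EFin \o (fun h => 2 * (eps - D z) * kern h)).
  by have /(integrableZl (mann _ _) (2 * (eps - D z))) := iok; apply: eq_integrable => //; exact: mann.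
have Ik : \int[mu]_(h in ann (2 ^- n) 1) (2 * (eps - D z) * kern h) =
    2 * (eps - D z) * (n%:R * kap).
  by rewrite RintegralZl// Rintegral_kern_outer.
have Jout_le : Jout <= 2 * (eps - D z) * (n%:R * kap).
  rewrite -Ik; apply: le_Rintegral => // h hn; rewrite ler_wpM2r ?kern_ge0//.
  by have F := far_sdiff h; have Vh := V0 (z + h); clear -F Vh; lra.
have rhoV : rho_ N * V z <= `|rho_ N| * eps + `|rho_ N| * D z.
  have a1 : 0 <= `|rho_ N| - rho_ N :> R by rewrite subr_ge0 ler_norm.
  have a2 : 0 <= `|rho_ N| + rho_ N :> R by rewrite -lerBlDr sub0r -normrN ler_norm.
  have a3 : 0 <= eps * (1 - w z) by apply: mulr_ge0; [exact: ltW|rewrite subr_ge0].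
  have P1 := mulr_ge0 a1 (mulr_ge0 (ltW eps0) w0).
  have P2 := mulr_ge0 a2 (ltW Dz0).
  have P3 := mulr_ge0 (normr_ge0 (rho_ N : R)) a3.
  rewrite VD; move: P1 P2 P3; clear; set rr := rho_ N; set e1 := eps; set w1 := w z; set D1 := D z.
  by clearbody rr e1 w1 D1; nra.
have DN : `|rho_ N| * D z <= c_ N * (n%:R * kap) * D z by rewrite ler_wpM2r// ltW.
have cN2 : 0 <= c_ N / 2 :> R by rewrite divr_ge0// ltW.
have J1 := ler_wpM2l cN2 Jin_le.
have Deq : c_ N / 2 * (2 * (eps - D z) * (n%:R * kap)) =
    c_ N / 2 * (2 * eps * (n%:R * kap)) - c_ N * (n%:R * kap) * D z by field.
case: dich => dich.
  have T2' : 0 <= c_ N * T2 by rewrite mulr_ge0// ltW.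
  have Jout_le' : Jout <= 2 * (eps - D z) * (n%:R * kap) - c * mK.
    pose Kz := [set h | eball p rK (z + h)].
    have mKz : measurable Kz.
      have := measurable_affine_rV 1 z measurableT _ (measurable_eball p rK).
      rewrite setTI; congr measurable; rewrite predeqE => h.
      by rewrite /Kz/= scale1r addrC.
    have Kzn : Kz `<=` ann (2 ^- n) 1.
      move=> h /= hK; have := dich _ _ hK zin.
      by rewrite /ann/= (_ : z + h - z = h)// addrC addrA addNr add0r.
    have muKz : mu Kz = mu (eball p rK).
      rewrite -(lebesgue_rV_translate (eball p rK) z); last exact: measurable_eball.
      by congr (lebesgue_rV N _); rewrite predeqE => h; rewrite /Kz/= addrC.
    have iK : mu.-integrable (ann (2 ^- n) 1) (EFin \o (fun h => c * \1_Kz h)).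
      apply: (integrable_bounded _ _ c); [exact: mann|exact: ann_lty| |].
        by apply: measurable_funM => //; exact: measurable_indic.
      move=> h _; rewrite indicE ger0_norm; last by rewrite mulr_ge0// ltW.
      by case: (_ \in _); rewrite ?mulr1 ?mulr0// ltW.
    have IK : \int[mu]_(h in ann (2 ^- n) 1) (c * \1_Kz h) = c * mK.
      have iK1 : mu.-integrable (ann (2 ^- n) 1) (EFin \o (\1_Kz : _ -> R)).
        apply: (integrable_bounded _ _ 1); [exact: mann|exact: ann_lty|exact: measurable_indic|].
        by move=> h _; rewrite indicE ger0_norm//; case: (_ \in _).
      rewrite RintegralZl//; congr (_ * _).
      rewrite /Rintegral integral_indic//.
      by rewrite (setIidl Kzn); exact: (congr1 fine muKz).
    rewrite -IK -Ik -RintegralB//.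
    apply: le_Rintegral => //.
      by have := integrableB (mann _ _) iok2 iK; apply: eq_integrable => //; exact: mann.
    move=> h hn; have F := far_sdiff h.
    have [hK|hK] := boolP (h \in Kz); rewrite indicE ?hK ?(negPf hK)/=.
      have /andP[hn1 hn2] := hn.
      have k1 : 1 <= kern h.
        rewrite /kern invf_ge1; first by rewrite exprn_ile1 ?enorm_ge0// ltW.
        by rewrite exprn_gt0//; exact: lt_le_trans hn1.
      have cV : c <= V (z + h) by apply: VK; rewrite inE in hK.
      rewrite mulr1.
      apply: (@le_trans _ _ ((2 * (eps - D z) - c) * kern h)).
        by rewrite ler_wpM2r ?kern_ge0//; clear -F cV; lra.
      by rewrite mulrBl lerD2l lerN2 ler_peMr// ltW.
    rewrite mulr0 subr0 ler_wpM2r ?kern_ge0//.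
    by have Vh := V0 (z + h); clear -F Vh; lra.
  have J2 := ler_wpM2l cN2 Jout_le'.
  rewrite mulrBr Deq in J2.
  by rewrite mulrDr => E0; clear -E0 J1 J2 T2' rhoV DN Aeq epsA B1; lra.
have T2' : c * d ^- N * mK <= T2.
  apply: (far_form_ge v (moll rho z) z p sig rK c d) => //.
  - exact: continuous_moll.
  - by move=> x; exact: moll_ge0.
  - by move=> x /moll_supp; rewrite Nrho.
  - exact: integral_moll.
  - exact: ltW.
  - exact: ltW.
  - by move=> x xK; apply: vK; rewrite /eball/= in xK *; clear -xK rK0; lra.
  - move=> x t xK tz; apply: dich => //; rewrite /eball/=.
    by have H := enormB_le t z y0; clear -H tz sig3 zr; lra.
have J2 := ler_wpM2l cN2 Jout_le.
have T3 := ler_wpM2l (ltW cN) T2'.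
rewrite Deq in J2.
by rewrite mulrDr => E0; clear -E0 J1 J2 T3 rhoV DN Aeq epsA B2; lra.
Qed.

End Comparison.

(** * The behaviour at the boundary point *)

Theorem theorem1p4 (R : realType) (N : nat) (N_ge1 : (1 <= N)%N)
  (Omega : set 'rV[R]_N) (openOmega : open Omega)
  (x0 : 'rV[R]_N) (x0_boundary : boundary Omega x0)
  (isc : interior_sphere_condition Omega x0)
  (eta : 'rV[R]_N) (normal : outer_unit_normal Omega x0 eta)
  (v : 'rV[R]_N -> R) (cv : continuous v) (Vv : calV Omega v)
  (v_nontrivial : exists x, v x != 0) (v_ge0 : forall x, 0 <= v x)
  (v_x0 : v x0 = 0)
  (supersol : forall phi : 'rV[R]_N -> R, test_function Omega phi ->
     (forall x, Omega x -> 0 <= phi x) -> 0 <= E_L v phi) :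
  (0%E < limf_einf (fun t : R => (v (x0 - t *: eta) / Num.sqrt (ell t))%:E) 0^'+)%E.
Proof.
have [y [delta [[delta0 yO sph] etaE]]] := normal.
have ydelta : enorm (x0 - y) = delta.
  have : (esphere y delta `&` boundary Omega) x0 by rewrite sph.
  by case.
have eta1 : enorm eta = 1.
  by rewrite etaE enormZ ydelta gtr0_norm ?invr_gt0// mulVf// gt_eqF.
have vL : (\int[lebesgue_rV N]_x (`|v x| / (1 + enorm x) ^+ N)%:E < +oo)%E.
  have [_] := Vv; apply: le_lt_trans; rewrite -addeA leeDl// adde_ge0//.
    apply: integral_ge0 => q _; rewrite lee_fin divr_ge0// ?exprn_ge0 ?enorm_ge0//.
  by apply: integral_ge0 => q _; rewrite lee_fin sqr_ge0.
(* if [v] is positive at a point at distance 1 from [x0], moving this point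
   slightly outwards makes the distance larger than 1 *)
have [p [s [c [s0 c0 vp [d0 d1]]]]] : exists p s c, [/\ 0 < s, 0 < c,
    forall x, eball p s x -> c <= v x & 0 < enorm (p - x0) /\ enorm (p - x0) != 1].
  have [p vp] := v_nontrivial.
  have vp0 : 0 < v p by rewrite lt_def vp v_ge0.
  have px0 : 0 < enorm (p - x0).
    by rewrite enorm_gt0 subr_eq0; apply: contraNneq vp => ->; rewrite v_x0.
  have v2 : 0 < v p / 2 by rewrite divr_gt0.
  have [s s0 sP] := (continuous_enormP v).1 cv p _ v2.
  have near_p x : enorm (x - p) < s -> v p / 2 <= v x.
    by move=> /sP; rewrite ltr_norml => /andP[xp _]; lra.
  have [d1|d1] := eqVneq (enorm (p - x0)) 1; last by exists p, s, (v p / 2).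
  pose p' := p + (s / 2) *: (p - x0).
  have p'x : enorm (p' - x0) = 1 + s / 2.
    rewrite (_ : p' - x0 = (1 + s / 2) *: (p - x0)).
      by rewrite enormZ d1 mulr1 ger0_norm//; lra.
    by rewrite scalerDl scale1r /p' addrAC.
  exists p', (s / 4), (v p / 2); split => //; first by rewrite divr_gt0.
    move=> x; rewrite /eball/= => xp'; apply: near_p.
    have := enormB_le x p' p; rewrite (_ : p' - p = (s / 2) *: (p - x0)).
      by rewrite enormZ d1 mulr1 ger0_norm; lra.
    by rewrite /p' addrC addrA addNr add0r.
  by rewrite p'x; split; [lra|rewrite gt_eqF//; lra].
set d := enorm (p - x0) in d0 d1.
pose g := Num.min d `|1 - d|.
have g0 : 0 < g by rewrite lt_min d0 normr_gt0 subr_eq0 eq_sym.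
have gd : g <= d by rewrite ge_min lexx.
have gd1 : g <= `|1 - d| by rewrite ge_min lexx orbT.
clearbody g.
have cN : 0 < c_ N :> R by exact: c_gt0.
have K0 : 0 < @kap R N by exact: kap_gt0.
have cK : 0 < c_ N * @kap R N by exact: mulr_gt0.
have g40 : 0 < g / 4 by rewrite divr_gt0.
(* [n1] makes the tangent ball small compared with the distance to the mass of
   [v]; [n2] makes the kernel mass of the outer shells absorb the zero order
   term *)
have [n1 n1P] := ex_dyadic_le (g / 4) g40.
pose n2 := (Num.truncn (`|rho_ N : R| / (c_ N * @kap R N))).+1.
have n2P : `|rho_ N| <= c_ N * (n2%:R * @kap R N).
  rewrite mulrCA -ler_pdivrMr//; apply: ltW; exact: truncnS_gt.
pose n := (4 + n1 + n2)%N.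
have dyad i j : (i <= j)%N -> 2 ^- j <= 2 ^- i :> R.
  by move=> ij; rewrite lef_pV2 ?posrE ?exprn_gt0// ler_weXn2l// ler1n.
have ng : 2 ^- n <= g / 4.
  by apply: le_trans n1P; apply: dyad; rewrite /n addnAC leq_addl.
have n16 : 2 ^- n <= 16^-1 :> R.
  apply: le_trans (dyad 4%N n _) _; first by rewrite /n -addnA leq_addr.
  by rewrite lef_pV2 ?posrE ?exprn_gt0// -natrX ler_nat.
have nrho : `|rho_ N| <= c_ N * (n%:R * @kap R N).
  apply: le_trans n2P _; rewrite ler_pM2l// ler_pM2r// ler_nat.
  by rewrite /n leq_addl.
have n4 : (4 <= n)%N by rewrite /n -addnA leq_addr.
have h2n0 : 0 < 2 ^- n :> R by rewrite invr_gt0 exprn_gt0.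
clearbody n; clear n1 n1P n2 n2P.
pose r0 := Num.min (delta / 2) (2 ^- n / 2).
have r00 : 0 < r0 by rewrite lt_min !divr_gt0.
have r0d : r0 <= delta / 2 by rewrite ge_min lexx.
have r0n : r0 <= 2 ^- n / 2 by rewrite ge_min lexx orbT.
clearbody r0.
pose y0 := x0 - r0 *: eta.
have y0E : y0 = x0 - r0 *: eta by [].
clearbody y0.
have y0ball z : eball y0 r0 z -> enorm (z - x0) < 2 * r0.
  rewrite /eball/= => zr; have := enormB_le z y0 x0.
  rewrite (_ : y0 - x0 = - (r0 *: eta)); last by rewrite y0E addrAC subrr add0r.
  by rewrite enormN enormZ eta1 mulr1 ger0_norm//; lra.
have y0O : eball y0 r0 `<=` Omega.
  move=> z zr; apply: yO; move: zr; rewrite /eball/= => zr.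
  have := enormB_le z y0 y; rewrite (_ : y0 - y = (delta - r0) *: eta).
    by rewrite enormZ eta1 mulr1 ger0_norm; lra.
  rewrite scalerBl etaE scalerA mulfV ?gt_eqF// scale1r.
  by rewrite y0E etaE addrAC.
pose rK := Num.min (s / 2) (g / 4).
have rK0 : 0 < rK by rewrite lt_min !divr_gt0.
have rKs : rK <= s / 2 by rewrite ge_min lexx.
have rKg : rK <= g / 4 by rewrite ge_min lexx orbT.
clearbody rK.
have vK x : eball p (2 * rK) x -> c <= v x.
  by move=> xK; apply: vp; move: xK; rewrite /eball/=; lra.
have distK x z : eball p rK x -> eball y0 r0 z ->
    d - g / 2 <= enorm (x - z) <= d + g / 2.
  move=> xK /y0ball zx0; move: xK; rewrite /eball/= => xK.
  have a1 := enormB_le p x x0; have a2 := enormB_le x z x0.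
  have a3 := enormB_le x p z; have a4 := enormB_le p x0 z.
  rewrite (enormB p x) in a1; rewrite (enormB x0 z) in a4.
  by rewrite -/d in a1 a4; apply/andP; split; lra.
have dg0 : 0 < d + g / 2 by lra.
have dich : (forall x z, eball p rK x -> eball y0 r0 z -> 2 ^- n <= enorm (x - z) < 1) \/
    (forall x z, eball p rK x -> eball y0 r0 z -> 1 <= enorm (x - z) <= d + g / 2).
  have [dlt|dge] := ltP d 1; [left|right] => x z xK zB;
    have /andP[e1 e2] := distK x z xK zB.
    by rewrite ger0_norm in gd1; [apply/andP; split; lra|lra].
  rewrite ler0_norm in gd1; last by lra.
  by apply/andP; split; lra.
have [] := barrier_comparison Omega v y0 p r0 rK c (d + g / 2) n N_ge1 cv v_ge0 vL
  supersol r00 _ y0O _ nrho rK0 c0 dg0 vK dich.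
- by lra.
- exact: n4.
move=> eps eps0 cmp.
have sq2 : 0 < Num.sqrt 2 :> R by rewrite sqrtr_gt0.
have lower t : 0 < t -> t < r0 / 2 ->
    eps / Num.sqrt 2 <= v (x0 - t *: eta) / Num.sqrt (ell t).
  move=> t0 tr; rewrite ler_pdivlMr; last exact: (prof_gt0 _ t0).
  have t10 : t <= 10%:R^-1 by lra.
  have zE : enorm (x0 - t *: eta - y0) = r0 - t.
    rewrite (_ : x0 - t *: eta - y0 = (r0 - t) *: eta).
      by rewrite enormZ eta1 mulr1 ger0_norm//; lra.
    by rewrite y0E opprB addrC addrA subrK scalerBl.
  (* the comparison holds on balls smaller than the tangent one; radius
     [r0 - t / 4] still leaves depth of order [t] *)
  have r1 : r0 / 2 <= r0 - t / 4 by lra.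
  have r2 : r0 - t / 4 < r0 by lra.
  apply: le_trans (cmp _ (x0 - t *: eta) r1 r2).
  rewrite mulrAC -mulrA ler_pM2l// -[Num.sqrt (ell t)]/(prof t) -prof_sqr//.
  by rewrite /barrier zE; apply: prof_homo; nra.
rewrite limf_einfE; apply: (@lt_le_trans _ _ (eps / Num.sqrt 2)%:E).
  by rewrite lte_fin divr_gt0.
apply: (@le_trans _ _ (ereal_inf [set (v (x0 - t *: eta) / Num.sqrt (ell t))%:E | t in
    `]0, (r0 / 2)[%classic])).
  apply: le_ereal_inf_tmp => _ [t /= + <-]; rewrite in_itv/= => /andP[t0 tr].
  by rewrite lee_fin; exact: lower.
apply: ereal_sup_ubound; exists `]0, (r0 / 2)[%classic => //.
near=> t; rewrite /= in_itv/=; apply/andP; split; near: t.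
  exact: nbhs_right_gt.
by apply: nbhs_right_lt; rewrite divr_gt0.
Unshelve. all: by end_near. Qed.
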